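(* Let $K \subset \mathbb R^3$ be a regular convex cone such that $\dim \operatorname{Aut} K \geq 2$. Then $K$ is isomorphic to exactly one of the following cones (within the families 3, 4, 5, different parameter values count as different cones): 1. the cone obtained by the homogenization of the epigraph of the exponential function, i.e. $\{ (x,y,0)^T \mid x \leq 0,\ y \geq 0 \} \cup \{ (x,y,z)^T \mid \frac{y}{z} \geq \exp\frac{x}{z},\ z > 0 \}$; 2. the positive orthant $\mathbb R_+^3$; 3. the cone $\{ x \in \mathbb R^3 \mid x_2 \leq x_1^{1/p}x_3^{1/q},\ x_1 \geq 0,\ x_3 \geq 0\}$ for some $p \in [2,\infty)$, where $\frac1p+\frac1q = 1$; 4. the cone $\{ x \in \mathbb R^3 \mid -\alpha x_1^{1/p}x_3^{1/q} \leq x_2 \leq x_1^{1/p}x_3^{1/q},\ x_1 \geq 0,\ x_3 \geq 0\}$ for some $p \in [2,\infty)$ and $\alpha \in (0,1]$, where $\frac1p+\frac1q = 1$; 5. the cone $\{ x \in \mathbb R^3 \mid 0 \leq x_2 \leq x_1^{1/p}x_3^{1/q},\ x_1 \geq 0,\ x_3 \geq 0\}$ for some $p \in [2,\infty)$, where $\frac1p+\frac1q = 1$.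
   Context: A convex cone $K\subset\mathbb R^n$ (with vertex at the origin) is called regular if it is closed, has non-empty interior, and does not contain a line. $\operatorname{Aut} K = \{ g \in GL(n,\mathbb R) \mid g[K] = K\}$ is the automorphism group of $K$, considered as a Lie group; it always contains the homotheties $x \mapsto \lambda x$, $\lambda>0$. Two cones $K,\tilde K \subset \mathbb R^n$ are isomorphic if there exists $S \in GL(n,\mathbb R)$ with $S[K] = \tilde K$. *)

(* Defs.v *)
From HB Require Import structures.
From mathcomp Require Import all_boot all_order all_algebra.
From mathcomp Require Import all_classical all_reals all_analysis.

Set Implicit Arguments.
Unset Strict Implicit.
Unset Printing Implicit Defensive.

Import Order.TTheory GRing.Theory Num.Theory.
Import numFieldNormedType.Exports.

Local Open Scope classical_set_scope.
Local Open Scope ring_scope.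

Definition is_cone (R : realType) (n : nat) (K : set 'cV[R]_n) : Prop :=
  forall (l : R) (x : 'cV[R]_n), 0 < l -> K x -> K (l *: x).

Definition convex_cone (R : realType) (n : nat) (K : set 'cV[R]_n) : Prop :=
  is_cone K /\ convex_set K.

Definition contains_line (R : realType) (n : nat) (K : set 'cV[R]_n) : Prop :=
  exists a v : 'cV[R]_n, v != 0 /\ [set a + t *: v | t in [set: R]] `<=` K.

(* The apex belongs to [K] as soon as [K] is closed and nonempty. *)
Definition regular_cone (R : realType) (n : nat) (K : set 'cV[R]_n) : Prop :=
  [/\ convex_cone K, closed K, interior K !=set0 & ~ contains_line K].

Definition mx_image (R : realType) (n : nat) (g : 'M[R]_n) (K : set 'cV[R]_n) :
  set 'cV[R]_n := [set g *m x | x in K].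

Definition Aut_cone (R : realType) (n : nat) (K : set 'cV[R]_n) : set 'M[R]_n :=
  [set g | g \in unitmx /\ mx_image g K = K].

Definition isomorphic_cones (R : realType) (n : nat) (K L : set 'cV[R]_n) :
  Prop := exists2 S : 'M[R]_n, S \in unitmx & mx_image S K = L.

Definition expmx (R : realType) (n : nat) (X : 'M[R]_n) : 'M[R]_n :=
  lim (series (fun k : nat => k`!%:R^-1 *: X ^+ k) @ \oo).

(* For a closed subgroup [G] of GL(n, R), such as [Aut_cone K] with [K]
   closed, this is the Lie algebra of the Lie group [G]. *)
Definition lie_algebra (R : realType) (n : nat) (G : set 'M[R]_n) :
  set 'M[R]_n := [set X | forall t : R, G (expmx (t *: X))].

(* The dimension of a matrix Lie group is the dimension of its Lie algebra, a
   linear subspace of the space of matrices; the latter dimension is the largest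
   size of a linearly independent family, necessarily at most [n * n]. *)
Definition lie_dim (R : realType) (n : nat) (G : set 'M[R]_n) : nat :=
  \max_(d < (n * n).+1 |
      `[< exists s : d.-tuple 'M[R]_n,
            free s /\ forall i, lie_algebra G (tnth s i) >]) d.

(* In the cones below, the row indices [0], [1], [2] : 'I_3 stand for the
   coordinates x, y, z, respectively x_1, x_2, x_3. *)

Definition exp_cone (R : realType) : set 'cV[R]_3 :=
  [set v : 'cV[R]_3 | [/\ v 0 0 <= 0, 0 <= v 1 0 & v 2 0 = 0]] `|`
  [set v : 'cV[R]_3 | expR (v 0 0 / v 2 0) <= v 1 0 / v 2 0 /\ 0 < v 2 0].

Definition orthant (R : realType) : set 'cV[R]_3 :=
  [set v : 'cV[R]_3 | forall i, 0 <= v i 0].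

Arguments exp_cone : clear implicits.
Arguments orthant : clear implicits.

(* x_1^{1/p} x_3^{1/q}, only used for nonnegative x_1 and x_3. *)
Definition power_mean (R : realType) (p q : R) (v : 'cV[R]_3) : R :=
  (v 0 0) `^ p^-1 * (v 2 0) `^ q^-1.

Definition power_hypograph (R : realType) (p q : R) : set 'cV[R]_3 :=
  [set v : 'cV[R]_3 | [/\ v 1 0 <= power_mean p q v, 0 <= v 0 0 & 0 <= v 2 0]].

Definition power_cone (R : realType) (p q a : R) : set 'cV[R]_3 :=
  [set v : 'cV[R]_3 |
    [/\ - a * power_mean p q v <= v 1 0 <= power_mean p q v,
        0 <= v 0 0 & 0 <= v 2 0]].

Definition half_power_cone (R : realType) (p q : R) : set 'cV[R]_3 :=
  [set v : 'cV[R]_3 |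
    [/\ 0 <= v 1 0 <= power_mean p q v, 0 <= v 0 0 & 0 <= v 2 0]].

(* Labels of the entries of the list.  The exponent [q] is determined by [p]
   for admissible labels, so that distinct admissible labels are distinct cases
   or distinct parameter values. *)
Inductive cone_label (R : realType) : Type :=
| ExpCone
| Orthant
| PowerHypograph of R & R
| PowerCone of R & R & R
| HalfPowerCone of R & R.

Definition conjugate_exponents (R : realType) (p q : R) : Prop :=
  2 <= p /\ p^-1 + q^-1 = 1.

Definition admissible (R : realType) (c : cone_label R) : Prop :=
  match c with
  | ExpCone | Orthant => True
  | PowerHypograph p q | HalfPowerCone p q => conjugate_exponents p q
  | PowerCone p q a => conjugate_exponents p q /\ 0 < a <= 1
  end.

Definition cone_of (R : realType) (c : cone_label R) : set 'cV[R]_3 :=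
  match c with
  | ExpCone => exp_cone R
  | Orthant => orthant R
  | PowerHypograph p q => power_hypograph p q
  | PowerCone p q a => power_cone p q a
  | HalfPowerCone p q => half_power_cone p q
  end.

(* Main.v *)
Require Import Defs.
From mathcomp Require Import all_boot all_order all_algebra.
From mathcomp Require Import all_classical all_reals all_analysis.
From mathcomp Require Import ring lra.

(* Existence.  Two independent elements of the Lie algebra yield a non-scalar
   matrix [X] whose flow preserves [K].  Up to conjugation, scaling of time and
   addition of scalar matrices (homotheties preserve [K]), [X] is one of six real
   normal forms.  Limits of suitably rescaled orbits put coordinate rays in the
   closed cone [K], and since [K] contains no line they fix signs, rule out
   spirals and single shears, and leave [K] determined by a closed ray or segment
   of orbits: a Jordan block of size 3 or a rotation gives the Lorentz cone (type 4
   with [p = 2], [alpha = 1]), a block of size 2 with another eigenvalue gives the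
   exponential cone, a double semisimple eigenvalue gives the orthant, and
   [diag(1, theta, 0)] with [0 < theta <= 1/2] gives the orthant or types 3, 4, 5
   with [p = 1 / theta].

   Uniqueness.  Call [X] Lyapunov-like on [K] if [f X x = 0] whenever [f >= 0] on
   [K], [x] is in [K] and [f x = 0].  This linear condition is invariant under
   isomorphisms and holds for generators of flows preserving [K].  Evaluated along
   the boundary curve [(1, e^s, e^{qs})], it is a linear relation between
   exponentials, whose independence forces [X = diag(l, l/p + m/q, m)] on every
   cone of type 3, 4, 5 but the Lorentz cone.  The remaining three cones carry
   Lyapunov-like matrices that are not of this form.  For two cones of type 3, 4, 5
   the eigenvalue ratios recover [p] and make the isomorphism monomial, and the
   sections by [x_1 = x_3 = 1] are then compared up to scaling. *)

Set Implicit Arguments.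
Unset Strict Implicit.
Unset Printing Implicit Defensive.

Import Order.TTheory GRing.Theory Num.Theory.
Import numFieldNormedType.Exports.

Local Open Scope classical_set_scope.
Local Open Scope ring_scope.

(** * Coordinates and regular cones *)

Section Coordinates.
Context {R : realType}.
Implicit Types (x y v : 'cV[R]_3) (A B : 'M[R]_3).

(** One generator suffices because its flow and the homotheties together have two-dimensional
    generic orbits: modulo them a point keeps a single parameter, which closedness and convexity
    confine to a ray or a segment. Invariance is therefore recorded by solution curves of [z' = J z]
    staying in the cone, a property that passes through conjugation, change of time and addition of
    scalars without computing an exponential. The bound [p >= 2] comes from reversing time, which
    replaces [theta] by [1 - theta] and exchanges the first and third coordinates; [alpha <= 1]
    comes from reflecting the second coordinate. In the uniqueness part the Lorentz cone stands
    apart because at [q = 2] exponents of the boundary relation collide, and only boundary points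
    off the upper curve then separate the other cones from it. The orthant, the exponential cone and
    the Lorentz cone are handled by one identity: each carries a Lyapunov-like [X] with [X^4 = X^3],
    different from [0] and [1], while the matrices [diag(l, l/p + m/q, m)] satisfy it only if they
    are [0] or [1]. *)

Definition vec3 (a b c : R) : 'cV[R]_3 :=
  \col_i (if i == 0 then a else if i == 1 then b else c).

Definition row3 (a b c : R) : 'rV[R]_3 :=
  \row_i (if i == 0 then a else if i == 1 then b else c).

Definition mx3 (a b c d e f g h k : R) : 'M[R]_3 :=
  \matrix_(i, j) (if i == 0 then row3 a b c else if i == 1 then row3 d e f
                  else row3 g h k) 0 j.

Lemma ord3_ind (P : 'I_3 -> Prop) : P 0 -> P 1 -> P 2 -> forall i, P i.
Proof.
move=> P0 P1 P2 [[|[|[|//]]] lti].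
- by rewrite (_ : Ordinal lti = 0) //; apply: val_inj.
- by rewrite (_ : Ordinal lti = 1) //; apply: val_inj.
- by rewrite (_ : Ordinal lti = 2) //; apply: val_inj.
Qed.

Lemma sum3 (V : nmodType) (F : 'I_3 -> V) : \sum_i F i = F 0 + F 1 + F 2.
Proof.
rewrite !big_ord_recl big_ord0 addr0 addrA.
by congr (F _ + F _ + F _); apply: val_inj.
Qed.

Lemma vec3_0 a b c : vec3 a b c 0 0 = a. Proof. by rewrite mxE. Qed.
Lemma vec3_1 a b c : vec3 a b c 1 0 = b. Proof. by rewrite mxE. Qed.
Lemma vec3_2 a b c : vec3 a b c 2 0 = c. Proof. by rewrite mxE. Qed.
Definition vec3E := (vec3_0, vec3_1, vec3_2).

Lemma col3P x y : x 0 0 = y 0 0 -> x 1 0 = y 1 0 -> x 2 0 = y 2 0 -> x = y.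
Proof.
by move=> e0 e1 e2; apply/matrixP => i j; rewrite ord1; elim/ord3_ind: i.
Qed.

Lemma vec3_eta v : v = vec3 (v 0 0) (v 1 0) (v 2 0).
Proof. by apply: col3P; rewrite vec3E. Qed.

Lemma mx3_eta A : A = mx3 (A 0 0) (A 0 1) (A 0 2) (A 1 0) (A 1 1) (A 1 2)
  (A 2 0) (A 2 1) (A 2 2).
Proof.
by apply/matrixP => i j; elim/ord3_ind: i; elim/ord3_ind: j; rewrite !mxE.
Qed.

Lemma mx3_vec3 a b c d e f g h k r s t :
  mx3 a b c d e f g h k *m vec3 r s t =
  vec3 (a * r + b * s + c * t) (d * r + e * s + f * t) (g * r + h * s + k * t).
Proof. by apply: col3P; rewrite !mxE sum3 !mxE. Qed.

Lemma mx3_mul a b c d e f g h k a' b' c' d' e' f' g' h' k' :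
  mx3 a b c d e f g h k *m mx3 a' b' c' d' e' f' g' h' k' =
  mx3 (a * a' + b * d' + c * g') (a * b' + b * e' + c * h')
      (a * c' + b * f' + c * k')
      (d * a' + e * d' + f * g') (d * b' + e * e' + f * h')
      (d * c' + e * f' + f * k')
      (g * a' + h * d' + k * g') (g * b' + h * e' + k * h')
      (g * c' + h * f' + k * k').
Proof.
apply/matrixP => i j; elim/ord3_ind: i; elim/ord3_ind: j;
  by rewrite !mxE sum3 !mxE.
Qed.

Lemma row3_vec3 a b c r s t :
  (row3 a b c *m vec3 r s t) 0 0 = a * r + b * s + c * t.
Proof. by rewrite !mxE sum3 !mxE. Qed.

Lemma row_vec (f : 'rV[R]_3) v :
  (f *m v) 0 0 = f 0 0 * v 0 0 + f 0 1 * v 1 0 + f 0 2 * v 2 0.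
Proof. by rewrite !mxE sum3. Qed.

Lemma mx_vec A v i :
  (A *m v) i 0 = A i 0 * v 0 0 + A i 1 * v 1 0 + A i 2 * v 2 0.
Proof. by rewrite !mxE sum3. Qed.

Lemma det_mx3 a b c d e f g h k :
  \det (mx3 a b c d e f g h k) =
  a * (e * k - f * h) - b * (d * k - f * g) + c * (d * h - e * g).
Proof.
rewrite (expand_det_row _ 0) sum3 /cofactor.
rewrite !(expand_det_row (row' 0 (col' _ _)) 0) !big_ord_recl !big_ord0.
rewrite /cofactor !det_mx11 !mxE /=.
change (a * ((-1) ^+ 0 * (e * ((-1) ^+ 0 * k) + (f * ((-1) ^+ 1 * h) + 0))) +
  b * ((-1) ^+ 1 * (d * ((-1) ^+ 0 * k) + (f * ((-1) ^+ 1 * g) + 0))) +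
  c * ((-1) ^+ 2 * (d * ((-1) ^+ 0 * h) + (e * ((-1) ^+ 1 * g) + 0))) =
  a * (e * k - f * h) - b * (d * k - f * g) + c * (d * h - e * g)).
by ring.
Qed.

Lemma unitmx3 a b c d e f g h k :
  a * (e * k - f * h) - b * (d * k - f * g) + c * (d * h - e * g) != 0 ->
  mx3 a b c d e f g h k \in unitmx.
Proof. by move=> ?; rewrite unitmxE det_mx3 unitfE. Qed.

Lemma scalar_mx3 a : a%:M = mx3 a 0 0 0 a 0 0 0 a.
Proof.
apply/matrixP => i j.
by elim/ord3_ind: i; elim/ord3_ind: j; rewrite !mxE.
Qed.

Lemma vec3D a b c a' b' c' :
  vec3 a b c + vec3 a' b' c' = vec3 (a + a') (b + b') (c + c').
Proof. by apply: col3P; rewrite !mxE. Qed.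

Lemma vec3Z l a b c : l *: vec3 a b c = vec3 (l * a) (l * b) (l * c).
Proof. by apply: col3P; rewrite !mxE. Qed.

Lemma vec3N a b c : - vec3 a b c = vec3 (- a) (- b) (- c).
Proof. by apply: col3P; rewrite !mxE. Qed.

Lemma vec3_eq0 a b c : vec3 a b c = 0 -> [/\ a = 0, b = 0 & c = 0].
Proof.
by move=> e; split; [have := congr1 (fun v => v 0 0) e
  | have := congr1 (fun v => v 1 0) e | have := congr1 (fun v => v 2 0) e];
  rewrite !mxE.
Qed.

End Coordinates.

Section ProperCones.
Context {R : realType}.
Implicit Types (K : set 'cV[R]_3) (x y v w : 'cV[R]_3).

Definition lim_closed K := forall (x : nat -> 'cV[R]_3) w,
  (forall n, K (x n)) ->
  (forall i, (fun n => x n i 0) @ \oo --> w i 0) -> K w.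

(** The consequences of regularity that are used, in a form that passes to linear preimages without
    topology: closedness is sequential and coordinatewise, and the interior point is replaced by the
    fact that no plane through the origin contains the cone. *)
Record proper_cone K := Proper {
  cone_lim : lim_closed K;
  coneD : forall x y, K x -> K y -> K (x + y);
  coneZ : forall l x, 0 < l -> K x -> K (l *: x);
  cone_pointed : forall x, K x -> K (- x) -> x = 0;
  cone_span : forall f : 'rV[R]_3, f != 0 ->
    exists2 v, K v & (f *m v) 0 0 != 0 }.

Lemma cvg_mx m n (T : Type) (F : set_system T) (FF : Filter F)
    (f : T -> 'M[R]_(m, n)) (A : 'M[R]_(m, n)) :
  (forall i j, f x i j @[x --> F] --> A i j) -> f @ F --> A.
Proof.
move=> cf B [P PA PB]; rewrite nbhs_simpl /=.
have : \forall x \near F, forall i j, P i j (f x i j).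
  apply: filter_forall => i; apply: filter_forall => j.
  exact: (cf i j _ (PA i j)).
by apply: filterS => x Px; apply: PB.
Qed.

Lemma closed_lim_closed K : closed K -> lim_closed K.
Proof.
move=> cK x w Kx xw.
have cxw : x @ \oo --> w by apply: cvg_mx => i j; rewrite ord1.
by apply: (closed_cvg K cK _ w cxw); apply: nearW.
Qed.

Lemma regular_proper K : regular_cone K -> proper_cone K.
Proof.
move=> [[coneK convK] cK [v0 iv0] noline].
have KD x y : K x -> K y -> K (x + y).
  move=> Kx Ky; have i01 : (0 <= 2^-1 :> R) /\ (2^-1 <= 1 :> R) by lra.
  have := convK x y (Itv01 i01.1 i01.2); rewrite !inE => /(_ Kx Ky).
  move=> /(coneK 2 _ (ltr0n _ 2)).
  rewrite (_ : 2 *: _ = x + y) //.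
  have h : (2^-1 : R) + 2^-1 = 1 by field.
  rewrite /conv /= /unstable.onem -[X in X - _]h addrK scalerDr !scalerA.
  by rewrite mulfV ?pnatr_eq0 // !scale1r.
split => //.
- exact: closed_lim_closed.
- move=> x Kx KNx; apply/eqP; apply: contra_notT noline => x0.
  exists 0, x; split=> // _ [t _ <-]; rewrite add0r.
  have [t0|t0|->] := ltgtP t 0.
  + by rewrite -[t]opprK scaleNr -scalerN; apply: coneK => //; rewrite oppr_gt0.
  + exact: coneK.
  + by rewrite scale0r -(subrr x); exact: KD.
- move=> f f0.
  (* If [f] vanishes at the interior point [v0], move along its own gradient: at [v0 + e f^T] its
     value is [e |f|^2], and this point is in [K] for small [e]. *)
  have [fv0|] := eqVneq ((f *m v0) 0 0) 0; last first.
    by exists v0 => //; exact: interior_subset.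
  have : (fun n => v0 + harmonic n *: f^T) @ \oo --> v0.
    apply: cvg_mx => i j.
    under eq_fun do rewrite !mxE.
    rewrite (_ : v0 i j = v0 i j + 0 * f j i); last by rewrite mul0r addr0.
    apply: cvgD; last by apply: cvgMr_tmp; exact: cvg_harmonic.
    by rewrite mul0r addr0; exact: cvg_cst.
  move/(_ _ iv0) => [N _ /(_ N (leqnn N)) KN].
  exists (v0 + harmonic N *: f^T) => //.
  rewrite mulmxDr -scalemxAr mxE fv0 add0r mxE.
  apply: mulf_neq0; first by rewrite gt_eqF // harmonic_gt0.
  apply: contra_neq f0 => f0; apply/rowP => i; rewrite mxE.
  move/eqP: f0; rewrite mxE psumr_eq0; last by move=> k _; rewrite mxE -expr2 sqr_ge0.
  by move=> /allP /(_ i (mem_index_enum _)); rewrite mxE -expr2 sqrf_eq0 => /eqP.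
Qed.
End ProperCones.

(** * Flows and their transport *)

Section Derivatives.
Context {R : realType}.
Implicit Types (f g : R -> R) (t a b c : R).

Lemma deriveD_fun f g t a b : is_derive t (1 : R) f a -> is_derive t (1 : R) g b ->
  is_derive t (1 : R) (fun s => f s + g s) (a + b).
Proof. exact: is_deriveD. Qed.

Lemma deriveM_fun f g t a b : is_derive t (1 : R) f a -> is_derive t (1 : R) g b ->
  is_derive t (1 : R) (fun s => f s * g s) (f t * b + g t * a).
Proof. exact: is_deriveM. Qed.

Lemma deriveZ_fun f t a c : is_derive t (1 : R) f a ->
  is_derive t (1 : R) (fun s => c * f s) (c * a).
Proof. exact: is_deriveZ. Qed.

Lemma derive_scale f t a c : is_derive (c * t) (1 : R) f a ->
  is_derive t (1 : R) (fun s => f (c * s)) (c * a).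
Proof.
move=> df; rewrite mulrC; apply: is_derive1_comp.
by apply: is_derive_eq (deriveZ_fun _ (is_derive_id _ _)) _; rewrite mulr1.
Qed.

Lemma derive_exp t c :
  is_derive t (1 : R) (fun s => expR (c * s)) (c * expR (c * t)).
Proof. exact: derive_scale. Qed.

Lemma derive_affine t a b : is_derive t (1 : R) (fun s => a + b * s) b.
Proof.
have := deriveD_fun (is_derive_cst a t 1) (deriveZ_fun b (is_derive_id t 1)).
by rewrite add0r mulr1.
Qed.

Lemma derive_unique_fun f g (d : R -> R) :
  (forall t, is_derive t (1 : R) f (d t)) -> (forall t, is_derive t (1 : R) g (d t)) ->
  f 0 = g 0 -> forall t, f t = g t.
Proof.
move=> df dg fg0 t; apply/eqP; rewrite -subr_eq0; apply/eqP.
have /(_ t 0) := @is_derive_0_is_cst R (f - g).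
rewrite /= !fctE fg0 subrr; apply=> s.
by apply: is_derive_eq; rewrite subrr.
Qed.

(** The product [expR (- c t) f t] has zero derivative. *)
Lemma derive_exp_unique f c : (forall t, is_derive t (1 : R) f (c * f t)) ->
  forall t, f t = expR (c * t) * f 0.
Proof.
move=> df t; set g := fun s => expR (- c * s) * f s.
have /(_ t 0) : forall x y, g x = g y.
  move=> x y; apply: is_derive_0_is_cst => s.
  by apply: is_derive_eq (deriveM_fun (derive_exp _ _) (df s)) _; ring.
rewrite /g mulr0 expR0 mul1r mulNr expRN => <-.
by rewrite mulrA mulfV ?mul1r // gt_eqF // expR_gt0.
Qed.

(** Undoing the dilation and the rotation leaves a constant vector: [c1] and [c2] are its two
    coordinates, and they are solved for [f] and [g] with [cos^2 + sin^2 = 1]. *)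
Lemma derive_rotation_unique f g a :
  (forall t, is_derive t (1 : R) f (a * f t + g t)) ->
  (forall t, is_derive t (1 : R) g (a * g t - f t)) ->
  forall t, f t = expR (a * t) * (cos t * f 0 + sin t * g 0) /\
            g t = expR (a * t) * (cos t * g 0 - sin t * f 0).
Proof.
move=> df dg t.
set e := fun s : R => expR (- a * s).
have de s : is_derive s (1 : R) e (- a * e s) by exact: derive_exp.
have c1 : e t * (cos t * f t - sin t * g t) = f 0.
  transitivity (e 0 * (cos 0 * f 0 - sin 0 * g 0)); last first.
    by rewrite /e mulr0 expR0 cos0 sin0; ring.
  (* The difference is written with the factor [-1] to fit the rules for sums and scalar
     multiples. *)
  pose h s := e s * (cos s * f s + (-1) * (sin s * g s)).
  transitivity (h t); first by rewrite /h; ring.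
  transitivity (h 0); last by rewrite /h; ring.
  apply: is_derive_0_is_cst => s.
  apply: is_derive_eq (deriveM_fun (de s) (deriveD_fun
    (deriveM_fun (is_derive_cos s) (df s))
    (deriveZ_fun _ (deriveM_fun (is_derive_sin s) (dg s))))) _.
  by ring.
have c2 : e t * (sin t * f t + cos t * g t) = g 0.
  transitivity (e 0 * (sin 0 * f 0 + cos 0 * g 0)); last first.
    by rewrite /e mulr0 expR0 cos0 sin0; ring.
  apply: (@is_derive_0_is_cst R (fun s => e s * (sin s * f s + cos s * g s))).
  move=> s.
  apply: is_derive_eq (deriveM_fun (de s) (deriveD_fun
    (deriveM_fun (is_derive_sin s) (df s))
    (deriveM_fun (is_derive_cos s) (dg s)))) _.
  by ring.
have ee : expR (a * t) * e t = 1.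
  by rewrite /e mulNr expRN mulfV // gt_eqF // expR_gt0.
have cs := cos2Dsin2 t.
rewrite -c1 -c2; split.
  transitivity ((expR (a * t) * e t) * (cos t ^+ 2 + sin t ^+ 2) * f t); last by ring.
  by rewrite ee cs !mul1r.
transitivity ((expR (a * t) * e t) * (cos t ^+ 2 + sin t ^+ 2) * g t); last by ring.
by rewrite ee cs !mul1r.
Qed.

(** The point [0] is an interior minimum. This turns invariance under a flow, in both directions of
    time, into a linear equation on its generator. *)
Lemma derive_ge0_at_0 f d : is_derive (0 : R) (1 : R) f d ->
  (forall t, derivable f t 1) -> (forall t, 0 <= f t) -> f 0 = 0 -> d = 0.
Proof.
move=> df ddf f0 f00.
have m0 : (0 : R) \in `]-1, 1[ by rewrite in_itv /= ltrN10 ltr01.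
have m1 : (-1 : R) <= 1 by rewrite (le_trans (@lerN10 _)) // ler01.
have df0 : is_derive (0 : R) (1 : R) f 0.
  apply: (derive1_at_min m1 _ m0) => // t _.
  by rewrite f00.
by rewrite -(@derive_val _ _ _ _ _ _ _ df) (@derive_val _ _ _ _ _ _ _ df0).
Qed.
End Derivatives.

Section Transport.
Context {R : realType}.
Implicit Types (K : set 'cV[R]_3) (P J : 'M[R]_3) (x y v w : 'cV[R]_3).

Definition mx_preim P K : set 'cV[R]_3 := [set v | K (P *m v)].

(** Isomorphism stated pointwise, with [P] mapping the model cone onto [K]; it composes with
    preimages without handling images of sets. *)
Definition classified K := exists2 c : cone_label R, admissible c &
  exists2 P : 'M[R]_3, P \in unitmx & forall x, K (P *m x) <-> cone_of c x.

(** Invariance under [exp(tJ)] for all real [t], expressed by integral curves. Explicit curves can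
    then be supplied directly, and the normal forms are recovered by uniqueness of solutions. *)
Definition flow_in K J := forall v, K v -> exists z : R -> 'cV[R]_3,
  [/\ z 0 = v, forall t, K (z t) &
      forall t i, is_derive t (1 : R) (fun s => z s i 0) ((J *m z t) i 0)].

(** The conclusion for all cones at once is a property of the generator alone; it can therefore be
    moved along conjugations and affine changes of [J] down to the normal forms. *)
Definition good J := forall K, proper_cone K -> flow_in K J -> classified K.

Lemma proper_mx_preim P K : P \in unitmx -> proper_cone K -> proper_cone (mx_preim P K).
Proof.
move=> uP [cK KD KZ Kp Ks]; split.
- move=> x w Kx xw; apply: (cK (fun n => P *m x n)) => // i.
  rewrite mx_vec; under eq_fun do rewrite mx_vec.
  by apply: cvgD; [apply: cvgD|]; apply: cvgMl_tmp; exact: xw.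
- by move=> x y; rewrite /mx_preim /= mulmxDr; exact: KD.
- by move=> l x l0; rewrite /mx_preim /= -scalemxAr; exact: KZ.
- move=> x; rewrite /mx_preim /= mulmxN => Kx KNx.
  by rewrite -(mulKmx uP x) (Kp _ Kx KNx) mulmx0.
- move=> f f0; have [|v Kv fv] := Ks (f *m invmx P).
    apply: contra_neq f0 => f0.
    by rewrite -(mulmxK uP f) -[f *m P *m _]mulmxA; rewrite -(mulmxKV uP f) f0 mul0mx mul0mx.
  by exists (invmx P *m v); rewrite ?mulmxA // /mx_preim /= mulKVmx.
Qed.

Lemma classified_mx_preim P K : P \in unitmx -> classified (mx_preim P K) ->
  classified K.
Proof.
move=> uP [c ac [Q uQ KQ]]; exists c => //; exists (P *m Q).
  by rewrite unitmx_mul uP.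
by move=> x; rewrite -KQ /mx_preim /= mulmxA.
Qed.

Lemma classified_isomorphic K : classified K ->
  exists2 c, admissible c & isomorphic_cones K (cone_of c).
Proof.
move=> [c ac [P uP KP]]; exists c => //; exists (invmx P).
  by rewrite unitmx_inv.
apply/seteqP; split=> [_ [x Kx <-]|x].
  by apply/KP; rewrite mulKVmx.
by move=> /KP KPx; exists (P *m x) => //; rewrite mulKmx.
Qed.

Lemma good_conj (S J J' : 'M[R]_3) : S \in unitmx -> S *m J = J' *m S ->
  good J' -> good J.
Proof.
move=> uS SJ gJ' K pK fK.
apply: (@classified_mx_preim (invmx S)); first by rewrite unitmx_inv.
apply: gJ'; first by apply: proper_mx_preim; rewrite ?unitmx_inv.
move=> v Kv; have [z [z0 Kz dz]] := fK _ Kv.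
exists (fun t => S *m z t); split.
- by rewrite z0 mulKVmx.
- by move=> t; rewrite /mx_preim /= mulKmx.
- move=> t i; under eq_fun do rewrite mx_vec.
  have d j := deriveZ_fun (S i j) (dz t j).
  apply: is_derive_eq (deriveD_fun (deriveD_fun (d 0) (d 1)) (d 2)) _.
  by rewrite mulmxA -SJ -mulmxA [RHS]mx_vec.
Qed.

(** The curve [expR (c t) z (a t)] solves the new equation and stays in the cone, which is stable
    under positive scaling. A negative [a] reverses time. *)
Lemma good_affine (J : 'M[R]_3) (a c : R) : good (a *: J + c%:M) -> good J.
Proof.
move=> gJ K pK fK; apply: gJ => // v Kv.
have [z [z0 Kz dz]] := fK _ Kv.
exists (fun t => expR (c * t) *: z (a * t)); split.
- by rewrite !mulr0 expR0 scale1r.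
- by move=> t; apply: coneZ => //; exact: expR_gt0.
- move=> t i; under eq_fun do rewrite mxE.
  have := deriveM_fun (derive_exp t c) (derive_scale (dz (a * t) i)).
  move=> h; apply: is_derive_eq h _.
  rewrite mulmxDl mul_scalar_mx -scalemxAl -!scalemxAr.
  by move: (z _) (J *m _) => w u; rewrite !mxE; ring.
Qed.

End Transport.

(** * Rays in a proper cone *)

Section Rays.
Context {R : realType}.
Implicit Types (K : set 'cV[R]_3) (a b c l s t x y z : R).

Lemma cvg_affine (e : nat -> R) a b : e @ \oo --> 0 ->
  (fun n => a + b * e n) @ \oo --> a.
Proof.
move=> e0; rewrite -[X in _ --> X]addr0 -[X in _ + X](mulr0 b).
by apply: cvgD; [exact: cvg_cst | exact: cvgMl_tmp].
Qed.

Lemma cvg_expRN c : 0 < c -> (fun n : nat => expR (- (c * n%:R)) : R) @ \oo --> 0.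
Proof.
move=> c0; under eq_fun do rewrite -mulNr expRM_natr.
by apply: cvg_expr; rewrite ger0_norm ?expR_ge0 // expR_lt1 oppr_lt0.
Qed.

Section Proper.
Variables (K : set 'cV[R]_3) (pK : proper_cone K).
Local Notation k x y z := (K (vec3 x y z)).

Lemma in_cone_eq x y z x' y' z' : k x y z ->
  x = x' -> y = y' -> z = z' -> k x' y' z'.
Proof. by move=> ? <- <- <-. Qed.

Lemma in_coneD x y z x' y' z' : k x y z -> k x' y' z' ->
  k (x + x') (y + y') (z + z').
Proof. by rewrite -vec3D; exact: (coneD pK). Qed.

Lemma in_cone_pointed x y z : k x y z -> k (- x) (- y) (- z) ->
  [/\ x = 0, y = 0 & z = 0].
Proof.
move=> Kv KNv; apply: vec3_eq0; apply: (cone_pointed pK Kv).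
by rewrite vec3N.
Qed.

Lemma in_cone_lim (f g h : nat -> R) x y z : (forall n, k (f n) (g n) (h n)) ->
  f @ \oo --> x -> g @ \oo --> y -> h @ \oo --> z -> k x y z.
Proof.
move=> Kfgh fx gy hz; apply: (cone_lim pK Kfgh) => i.
by elim/ord3_ind: i; rewrite vec3E; under eq_fun do rewrite vec3E.
Qed.

Lemma in_cone_span a b c : (a, b, c) != (0, 0, 0) ->
  exists x y z, k x y z /\ a * x + b * y + c * z != 0.
Proof.
move=> abc; have [|v Kv fv] := cone_span pK (f := row3 a b c).
  apply: contra_neq abc => abc.
  have e i : row3 a b c 0 i = 0 by rewrite abc mxE.
  by move: (e 0) (e 1) (e 2); rewrite !mxE /= => -> -> ->.
exists (v 0 0), (v 1 0), (v 2 0); rewrite -vec3_eta; split=> //.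
by rewrite (vec3_eta v) row3_vec3 in fv.
Qed.

(** Scaling is assumed for positive factors only, so the apex is reached as the limit of
    [v / (n + 1)]. *)
Lemma in_cone0 : k 0 0 0.
Proof.
have [|x [y [z [Kv _]]]] := in_cone_span (a := 1) (b := 0) (c := 0).
  by rewrite !xpair_eqE oner_eq0.
apply: (@in_cone_lim (fun n => 0 + x * harmonic n) (fun n => 0 + y * harmonic n)
  (fun n => 0 + z * harmonic n)).
- move=> n; rewrite !add0r !(mulrC _ (harmonic n)) -vec3Z.
  by apply: (coneZ pK) => //; exact: harmonic_gt0.
- by apply: cvg_affine; exact: cvg_harmonic.
- by apply: cvg_affine; exact: cvg_harmonic.
- by apply: cvg_affine; exact: cvg_harmonic.
Qed.

Lemma in_coneZ l x y z : 0 <= l -> k x y z -> k (l * x) (l * y) (l * z).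
Proof.
rewrite le_eqVlt => /predU1P[<-|l0] Kv; last by rewrite -vec3Z; exact: (coneZ pK).
by rewrite !mul0r; exact: in_cone0.
Qed.

Lemma in_coneZK l x y z : 0 < l -> k (l * x) (l * y) (l * z) -> k x y z.
Proof.
move=> l0 /(in_coneZ (l := l^-1)) h; apply: in_cone_eq (h _) _ _ _.
- by rewrite invr_ge0 ltW.
- by rewrite mulKf // gt_eqF.
- by rewrite mulKf // gt_eqF.
- by rewrite mulKf // gt_eqF.
Qed.

(** Dividing the [n]-th point by [n + 1] gives a sequence that converges to the direction. *)
Lemma in_cone_recession a b c x y z :
  (forall n, k (a + n.+1%:R * x) (b + n.+1%:R * y) (c + n.+1%:R * z)) -> k x y z.
Proof.
move=> Kn; apply: (@in_cone_lim (fun n => x + a * harmonic n)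
  (fun n => y + b * harmonic n) (fun n => z + c * harmonic n)).
- move=> n; have := in_coneZ (ltW (harmonic_gt0 n)) (Kn n).
  have h : harmonic n * n.+1%:R = 1 :> R by rewrite /harmonic mulVf // pnatr_eq0.
  by move/in_cone_eq; apply; rewrite mulrDr mulrA h; ring.
- by apply: cvg_affine; exact: cvg_harmonic.
- by apply: cvg_affine; exact: cvg_harmonic.
- by apply: cvg_affine; exact: cvg_harmonic.
Qed.

(** The parameters of the line through [(a, b, c)] that lie in the cone form an upward closed set,
    since the direction is in the cone; a set without lower bound would make the opposite direction
    a recession direction. By closedness the infimum is attained. The models below are obtained by
    applying this to a line transversal to the orbits. *)
Lemma ray_threshold a b c x y z : k x y z -> ~ k (- x) (- y) (- z) ->
  (exists s, k (a + s * x) (b + s * y) (c + s * z)) ->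
  exists s0, forall s, k (a + s * x) (b + s * y) (c + s * z) <-> s0 <= s.
Proof.
move=> Kv KNv [s1 Ks1].
pose C := [set s | k (a + s * x) (b + s * y) (c + s * z)].
have Cup s t : C s -> s <= t -> C t.
  move=> Cs st; have := in_coneD Cs (in_coneZ (l := t - s) _ Kv).
  by rewrite subr_ge0 => /(_ st) /in_cone_eq; apply; ring.
have Clb : has_lbound C.
  apply: contra_notP KNv => nlb; apply: (@in_cone_recession a b c) => n.
  have [s Cs sn] : exists2 s, C s & s < - n.+1%:R.
    apply: contra_notP nlb => h; exists (- n.+1%:R) => s Cs.
    by rewrite leNgt; apply/negP => sn; apply: h; exists s.
  by have /in_cone_eq := Cup _ _ Cs (ltW sn); apply; ring.
have hC : has_inf C by split => //; exists s1.
exists (inf C) => s; split=> [Cs|infs]; first exact: ge_inf.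
apply: (Cup _ s _ infs).
have Cn n : C (inf C + harmonic n).
  have [t Ct tn] := inf_adherent (@harmonic_gt0 R n) hC.
  exact: Cup Ct (ltW tn).
apply: (in_cone_lim Cn).
- rewrite (_ : (fun n => _) = fun n => (a + inf C * x) + x * harmonic n).
    by apply: cvg_affine; exact: cvg_harmonic.
  by apply/funext => n; ring.
- rewrite (_ : (fun n => _) = fun n => (b + inf C * y) + y * harmonic n).
    by apply: cvg_affine; exact: cvg_harmonic.
  by apply/funext => n; ring.
- rewrite (_ : (fun n => _) = fun n => (c + inf C * z) + z * harmonic n).
    by apply: cvg_affine; exact: cvg_harmonic.
  by apply/funext => n; ring.
Qed.

Lemma classified_mx3 lbl (P : 'M[R]_3) : admissible lbl -> P \in unitmx ->
  (forall x y z, K (P *m vec3 x y z) <-> cone_of lbl (vec3 x y z)) ->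
  classified K.
Proof.
move=> al uP KP; exists lbl => //; exists P => // v.
by rewrite (vec3_eta v).
Qed.

End Proper.
End Rays.

(** * Normal forms of the generator *)

Section Lorentz.
Context {R : realType}.
Implicit Types (x y z : R).

(** For [p = q = 2] and [a = 1] the two bounds say that [|y|] is at most the geometric mean, and
    squaring gives the quadratic form. *)
Lemma lorentz_memE x y z : cone_of (PowerCone 2 2 1) (vec3 x y z) <->
  [/\ 0 <= x, 0 <= z & y ^+ 2 <= x * z].
Proof.
rewrite /= /power_cone /= /power_mean !vec3E.
have E : 0 <= x -> 0 <= z ->
    (- 1 * (x `^ 2^-1 * z `^ 2^-1) <= y <= x `^ 2^-1 * z `^ 2^-1) =
    (y ^+ 2 <= x * z).
  move=> x0 z0; rewrite !powR12_sqrt // mulN1r -ler_norml.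
  rewrite -(ler_pXn2r (n := 2)) ?nnegrE ?mulr_ge0 ?sqrtr_ge0 //.
  by rewrite real_normK ?num_real // exprMn !sqr_sqrtr.
by split=> -[]; [move=> + x0 z0 | move=> x0 z0]; rewrite ?E.
Qed.
End Lorentz.

Section NormalForms.
Context {R : realType}.
Implicit Types (K : set 'cV[R]_3) (a b c l s t u v w x y z : R).

Lemma cvg_quadratic (e : nat -> R) a b c : e @ \oo --> 0 ->
  (fun n => a + b * e n + c * e n ^+ 2) @ \oo --> a.
Proof.
move=> e0; rewrite -[X in _ --> X]addr0 -[X in _ + X](mulr0 c).
apply: cvgD; first exact: cvg_affine.
apply: cvgMl_tmp; rewrite -[X in _ --> X](mulr0 0).
by under eq_fun do rewrite expr2; exact: cvgM.
Qed.

Section Cone.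
Variables (K : set 'cV[R]_3) (pK : proper_cone K).
Local Notation k x y z := (K (vec3 x y z)).

(** The recession directions of an orbit for [t] tending to plus and minus infinity are [(0, 0, x)]
    and its opposite. Pointedness forces [x = 0] throughout, which puts the cone in a plane. *)
Lemma no_shear_flow : (forall t x y z, k x y z -> k x y (z + t * x)) -> False.
Proof.
move=> fl; have [|x [y [z [Kv]]]] := in_cone_span pK (a := 1) (b := 0) (c := 0).
  by rewrite !xpair_eqE oner_eq0.
rewrite mul1r !mul0r !addr0 => /eqP; apply.
have [||_ _ //] := in_cone_pointed pK (x := 0) (y := 0) (z := x).
- apply: (in_cone_recession pK (a := x) (b := y) (c := z)) => n.
  by apply: in_cone_eq (fl n.+1%:R _ _ _ Kv) _ _ _; ring.
- apply: (in_cone_recession pK (a := x) (b := y) (c := z)) => n.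
  by apply: in_cone_eq (fl (- n.+1%:R) _ _ _ Kv) _ _ _; ring.
Qed.

(** * A single Jordan block of size 3 *)

Section Unipotent.
Hypothesis fl : forall t x y z, k x y z ->
  k x (y + t * x) (z + t * y + t ^+ 2 / 2 * x).

(** At time [t = n + 1] the quadratic term dominates; scaling by [2 / t^2] normalizes its
    coefficient to [x]. *)
Lemma unipotent_limit x y z : k x y z -> k 0 0 x.
Proof.
move=> Kv.
have h n : harmonic n * n.+1%:R = 1 :> R by rewrite /harmonic mulVf // pnatr_eq0.
apply: (in_cone_lim pK
  (f := fun n => 0 + 0 * harmonic n + (2 * x) * harmonic n ^+ 2)
  (g := fun n => 0 + (2 * x) * harmonic n + (2 * y) * harmonic n ^+ 2)
  (h := fun n => x + (2 * y) * harmonic n + (2 * z) * harmonic n ^+ 2)).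
- move=> n.
  have p0 : (0 : R) <= 2 * harmonic n ^+ 2.
    by rewrite mulr_ge0 // exprn_ge0 // harmonic_ge0.
  apply: in_cone_eq (in_coneZ pK p0 (fl n.+1%:R Kv)) _ _ _.
  + by ring.
  + transitivity (2 * y * harmonic n ^+ 2 + 2 * x * harmonic n * (harmonic n * n.+1%:R)).
      by ring.
    by rewrite h; ring.
  + transitivity (2 * z * harmonic n ^+ 2 + 2 * y * harmonic n * (harmonic n * n.+1%:R)
      + (harmonic n * n.+1%:R) ^+ 2 * x); first by field.
    by rewrite h; ring.
- exact/cvg_quadratic/cvg_harmonic.
- exact/cvg_quadratic/cvg_harmonic.
- exact/cvg_quadratic/cvg_harmonic.
Qed.

Lemma unipotent_pos_classified : k 0 0 1 -> classified K.
Proof.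
move=> K3.
have KN3 z : k 0 0 z -> 0 <= z.
  move=> Kz; rewrite leNgt; apply/negP => z0.
  have [|_ _ /eqP] := in_cone_pointed pK K3; last by rewrite oner_eq0.
  apply: (in_coneZK pK (l := - z)); first by rewrite oppr_gt0.
  by apply: in_cone_eq Kz _ _ _; ring.
have Kx0 x y z : k x y z -> 0 <= x by move=> /unipotent_limit /KN3.
(* On the plane [x = 0] the flow is a shear along the third axis, so both directions of time give
   opposite rays. *)
have Ky0 y z : k 0 y z -> y = 0.
  move=> Kv; have [||_ _ //] := in_cone_pointed pK (x := 0) (y := 0) (z := y).
  - apply: (in_cone_recession pK (a := 0) (b := y) (c := z)) => n.
    by apply: in_cone_eq (fl n.+1%:R Kv) _ _ _; ring.
  - apply: (in_cone_recession pK (a := 0) (b := y) (c := z)) => n.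
    by apply: in_cone_eq (fl (- n.+1%:R) Kv) _ _ _; ring.
have Kz0 z : 0 <= z -> k 0 0 z.
  by move=> z0; apply: in_cone_eq (in_coneZ pK z0 K3) _ _ _; ring.
(* The time [- y / x] removes the second coordinate, so [z/x - (y/x)^2/2] is the only remaining
   parameter. *)
have Ksec x y z : 0 < x -> k x y z <-> k 1 0 (0 + (z / x - (y / x) ^+ 2 / 2) * 1).
  move=> x0; have xn : x != 0 by rewrite gt_eqF.
  split=> Kv.
    have p0 : 0 <= x^-1 by rewrite invr_ge0 ltW.
    by apply: in_cone_eq (fl (- (y / x)) (in_coneZ pK p0 Kv)) _ _ _; field.
  apply: in_cone_eq (in_coneZ pK (ltW x0) (fl (y / x) Kv)) _ _ _; by field.
have [s0 Hs0] : exists s0, forall s, k (1 + s * 0) (0 + s * 0) (0 + s * 1) <-> s0 <= s.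
  apply: (ray_threshold pK K3).
    by move=> /(in_cone_pointed pK K3)[_ _ /eqP]; rewrite oner_eq0.
  have [|x [y [z [Kv]]]] := in_cone_span pK (a := 1) (b := 0) (c := 0).
    by rewrite !xpair_eqE oner_eq0.
  rewrite mul1r !mul0r !addr0 => xn.
  have x0 : 0 < x by rewrite lt_neqAle eq_sym xn (Kx0 _ _ _ Kv).
  exists (z / x - (y / x) ^+ 2 / 2).
  by move/(Ksec _ _ _ x0): Kv => /in_cone_eq; apply; ring.
have Ks s : k 1 0 (0 + s * 1) <-> s0 <= s.
  by rewrite -Hs0 !mulr0 !addr0.
(* With third coordinate [s0 x + z/2] the condition that the parameter is at least [s0] becomes
   [y^2 <= x z]. *)
apply: (classified_mx3 (lbl := PowerCone 2 2 1) (P := mx3 1 0 0 0 1 0 s0 0 2^-1)).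
- by split; [split; [|field] | rewrite ltr01 lexx].
- by apply: unitmx3; rewrite !(mul0r, mulr0, mul1r, subr0, addr0) invr_eq0 pnatr_eq0.
move=> x y z; rewrite lorentz_memE mx3_vec3 !(mul0r, mul1r, add0r, addr0).
have [x0|x0|->] := ltgtP x 0.
- by split=> [/Kx0|[]]; rewrite ?(lt_geF x0).
- rewrite Ksec // Ks.
  have -> : (s0 <= (s0 * x + 2^-1 * z) / x - (y / x) ^+ 2 / 2) = (y ^+ 2 <= x * z).
    rewrite -subr_ge0 (_ : _ - s0 = (x * z - y ^+ 2) * (2^-1 / x ^+ 2)); last first.
      by field; rewrite gt_eqF.
    by rewrite pmulr_lge0 ?subr_ge0 // divr_gt0 ?invr_gt0 // exprn_gt0.
  split=> [h|[]//]; split=> //.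
  by rewrite -(pmulr_rge0 _ x0) (le_trans _ h) // sqr_ge0.
- rewrite mulr0 add0r mul0r; split=> [Kv|[_ z0 y0]].
    have y0 := Ky0 _ _ Kv; rewrite y0 in Kv *; split=> //.
      by have := KN3 _ Kv; rewrite pmulr_rge0 ?invr_gt0.
    by rewrite expr0n.
  have /eqP : y ^+ 2 == 0 by rewrite eq_le y0 sqr_ge0.
  by move/eqP; rewrite sqrf_eq0 => /eqP ->; apply: Kz0; rewrite mulr_ge0 ?invr_ge0.
Qed.
End Unipotent.

End Cone.

(** The limit ray lies on the third axis but its sign is unknown; the flow commutes with [-1], so
    the cone may be replaced by its opposite. *)
Lemma unipotent_classified K : proper_cone K ->
  (forall t x y z, K (vec3 x y z) ->
     K (vec3 x (y + t * x) (z + t * y + t ^+ 2 / 2 * x))) -> classified K.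
Proof.
move=> pK fl; have [|x [y [z [Kv]]]] := in_cone_span pK (a := 1) (b := 0) (c := 0).
  by rewrite !xpair_eqE oner_eq0.
rewrite mul1r !mul0r !addr0 neq_lt => /orP[x0|x0].
  have uP : mx3 (- 1) 0 0 0 (- 1) 0 0 0 (- 1 : R) \in unitmx.
    by apply: unitmx3; rewrite !(mul0r, mulr0, subr0, addr0) mulrNN mulr1 mulr1 oppr_eq0 oner_eq0.
  have E u v w : mx_preim (mx3 (- 1) 0 0 0 (- 1) 0 0 0 (- 1)) K (vec3 u v w) =
      K (vec3 (- u) (- v) (- w)).
    by rewrite /mx_preim /= mx3_vec3 !(mul0r, add0r, addr0) !mulN1r.
  apply: (classified_mx_preim uP); apply: unipotent_pos_classified.
  - exact: proper_mx_preim.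
  - move=> t u v w; rewrite !E => Kw.
    by apply: in_cone_eq (fl t _ _ _ Kw) _ _ _; ring.
  - rewrite E !oppr0; apply: (in_coneZK pK (l := - x)); first by rewrite oppr_gt0.
    apply: in_cone_eq (unipotent_limit pK fl Kv) _ _ _; ring.
apply: unipotent_pos_classified => //; apply: (in_coneZK pK x0).
by apply: in_cone_eq (unipotent_limit pK fl Kv) _ _ _; ring.
Qed.

End NormalForms.

Section JordanAndRotation.
Context {R : realType}.
Implicit Types (K : set 'cV[R]_3) (a b c l s t u v w x y z : R).

Lemma mx_preim_diag K a b c x y z :
  mx_preim (mx3 a 0 0 0 b 0 0 0 c) K (vec3 x y z) = K (vec3 (a * x) (b * y) (c * z)).
Proof. by rewrite /mx_preim /= mx3_vec3 !(mul0r, add0r, addr0). Qed.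

Lemma unitmx_diag a b c : a != 0 -> b != 0 -> c != 0 ->
  mx3 a 0 0 0 b 0 0 0 c \in unitmx.
Proof.
move=> a0 b0 c0; apply: unitmx3.
by rewrite !(mul0r, mulr0, subr0, addr0) !mulf_neq0.
Qed.

Section Cone.
Variables (K : set 'cV[R]_3) (pK : proper_cone K).
Local Notation k x y z := (K (vec3 x y z)).

Lemma in_cone_axis_sign x : x != 0 -> k x 0 0 -> k 1 0 0 \/ k (- 1) 0 0.
Proof.
rewrite neq_lt => /orP[x0|x0] Kx; [right|left].
  apply: (in_coneZK pK (l := - x)); first by rewrite oppr_gt0.
  by apply: in_cone_eq Kx _ _ _; ring.
by apply: (in_coneZK pK x0); apply: in_cone_eq Kx _ _ _; ring.
Qed.

(** * A Jordan block of size 2 and another eigenvalue *)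

Section Jordan.
Hypothesis fl : forall t x y z, k x y z -> k (x + t * z) (expR t * y) z.

(** Backwards in time [expR t] kills the second coordinate and the linear term of the first one
    dominates. Time [n] against the scaling [1/(n + 1)] gives the error term [(x + z)/(n + 1)]. *)
Lemma jordan_limit x y z : k x y z -> k (- z) 0 0.
Proof.
move=> Kv.
have h n : harmonic n * n%:R = 1 - harmonic n :> R.
  by rewrite /harmonic /= -natr1; field; rewrite natr1 pnatr_eq0.
have he : (fun n => harmonic n * expR (- (1 * n%:R)) : R) @ \oo --> 0.
  rewrite -[X in _ --> X](mulr0 0).
  by apply: cvgM; [exact: cvg_harmonic | exact: cvg_expRN].
apply: (in_cone_lim pK
  (f := fun n => - z + (x + z) * harmonic n)
  (g := fun n => 0 + y * (harmonic n * expR (- (1 * n%:R))))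
  (h := fun n => 0 + z * harmonic n)).
- move=> n; apply: in_cone_eq (in_coneZ pK (harmonic_ge0 n) (fl (- n%:R) Kv)) _ _ _.
  + transitivity (x * harmonic n - z * (harmonic n * n%:R)); first by ring.
    by rewrite h; ring.
  + by rewrite mul1r; ring.
  + by ring.
- exact/cvg_affine/cvg_harmonic.
- exact/cvg_affine.
- exact/cvg_affine/cvg_harmonic.
Qed.

Hypothesis K1 : k (- 1) 0 0.

Lemma jordan_third_ge0 x y z : k x y z -> 0 <= z.
Proof.
move=> /jordan_limit Kz; rewrite leNgt; apply/negP => z0.
have [|/eqP] := in_cone_pointed pK K1; last by rewrite oppr_eq0 oner_eq0.
apply: (in_coneZK pK (l := - z)); first by rewrite oppr_gt0.
by apply: in_cone_eq Kz _ _ _; ring.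
Qed.

Lemma jordan_limit_second x y z : k x y z -> k 0 y 0.
Proof.
move=> Kv; have z0 := jordan_third_ge0 Kv.
apply: (in_cone_lim pK
  (f := fun n => 0 + x * expR (- (1 * n%:R)))
  (g := fun n => y + 0 * expR (- (1 * n%:R)))
  (h := fun n => 0 + z * expR (- (1 * n%:R)))).
(* The first coordinate grows like [n z]. Adding [n z] times the ray [(-1, 0, 0)], allowed since
   [z >= 0], cancels this growth before scaling by [expR (- n)]. *)
- move=> n; have nz0 : 0 <= n%:R * z by rewrite mulr_ge0.
  have := in_coneD pK (fl n%:R Kv) (in_coneZ pK nz0 K1).
  move/(in_coneZ pK (expR_ge0 (- (1 * n%:R)))) => Kn.
  apply: in_cone_eq Kn _ _ _; [by ring | | by ring].
  transitivity ((expR (- (1 * n%:R)) * expR n%:R) * y); first by ring.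
  by rewrite -expRD mul1r addNr expR0; ring.
- exact/cvg_affine/cvg_expRN.
- exact/cvg_affine/cvg_expRN.
- exact/cvg_affine/cvg_expRN.
Qed.

Lemma jordan_pos_classified : k 0 1 0 -> classified K.
Proof.
move=> K2.
have Ky0 x y z : k x y z -> 0 <= y.
  move=> /jordan_limit_second Ky; rewrite leNgt; apply/negP => y0.
  have [|_ /eqP] := in_cone_pointed pK K2; last by rewrite oner_eq0.
  apply: (in_coneZK pK (l := - y)); first by rewrite oppr_gt0.
  by apply: in_cone_eq Ky _ _ _; ring.
have Kz0 := jordan_third_ge0.
have KN1 : ~ k 1 0 0.
  move=> KN1; have [||/eqP] := in_cone_pointed pK (x := 1) (y := 0) (z := 0) => //.
    by apply: in_cone_eq K1 _ _ _; ring.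
  by rewrite oner_eq0.
have Kface x y : k x y 0 <-> x <= 0 /\ 0 <= y.
  split=> [Kv|[x0 y0]].
    split; last exact: Ky0 Kv.
    have Kx : k x 0 0.
      apply: (in_cone_lim pK (f := fun n => x + 0 * expR (- (1 * n%:R)))
        (g := fun n => 0 + y * expR (- (1 * n%:R)))
        (h := fun n => 0 + 0 * expR (- (1 * n%:R)))).
      - move=> n; apply: in_cone_eq (fl (- (1 * n%:R)) Kv) _ _ _; by ring.
      - exact/cvg_affine/cvg_expRN.
      - exact/cvg_affine/cvg_expRN.
      - exact/cvg_affine/cvg_expRN.
    rewrite leNgt; apply/negP => x0; apply: KN1.
    by apply: (in_coneZK pK x0); apply: in_cone_eq Kx _ _ _; ring.
  have Nx0 : 0 <= - x by rewrite oppr_ge0.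
  by apply: in_cone_eq (in_coneD pK (in_coneZ pK Nx0 K1) (in_coneZ pK y0 K2)) _ _ _; ring.
(* The time [- x / z] removes the first coordinate. *)
have Ksec x y z : 0 < z -> k x y z <-> k 0 (0 + expR (- (x / z)) * (y / z) * 1) 1.
  move=> z0; have zn : z != 0 by rewrite gt_eqF.
  split=> Kv.
    have p0 : 0 <= z^-1 by rewrite invr_ge0 ltW.
    by apply: in_cone_eq (fl (- (x / z)) (in_coneZ pK p0 Kv)) _ _ _; field.
  apply: in_cone_eq (in_coneZ pK (ltW z0) (fl (x / z) Kv)) _ _ _.
  - by field.
  - transitivity ((expR (x / z) * expR (- (x / z))) * y); first by field.
    by rewrite -expRD subrr expR0 mul1r.
  - by ring.
have [s0 Hs0] : exists s0, forall s, k (0 + s * 0) (0 + s * 1) (1 + s * 0) <-> s0 <= s.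
  apply: (ray_threshold pK K2).
    by move=> /(in_cone_pointed pK K2)[_ /eqP]; rewrite oner_eq0.
  have [|x [y [z [Kv]]]] := in_cone_span pK (a := 0) (b := 0) (c := 1).
    by rewrite !xpair_eqE oner_eq0 !andbF.
  rewrite mul1r !mul0r !add0r => zn.
  have z0 : 0 < z by rewrite lt_neqAle eq_sym zn (Kz0 _ _ _ Kv).
  exists (expR (- (x / z)) * (y / z)).
  by move/(Ksec _ _ _ z0): Kv => /in_cone_eq; apply; ring.
have Ks s : k 0 (0 + s * 1) 1 <-> s0 <= s.
  by rewrite -Hs0 !mulr0 !addr0.
(* If [s0 = 0], the orbit of [(0, 0, 1)] is a straight line; its recession direction [(1, 0, 0)] is
   opposite to a known ray. *)
have s0_gt0 : 0 < s0.
  rewrite lt_neqAle; apply/andP; split; last first.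
    have : k 0 (0 + s0 * 1) 1 by apply/Ks.
    by move/Ky0; rewrite add0r mulr1.
  apply/negP => /eqP s00; apply: KN1.
  have K3 : k 0 0 1 by have /Ks : s0 <= 0; [rewrite s00 | rewrite mul0r addr0].
  apply: (in_cone_recession pK (a := 0) (b := 0) (c := 1)) => n.
  by apply: in_cone_eq (fl n.+1%:R K3) _ _ _; ring.
apply: (classified_mx3 (lbl := ExpCone R) (P := mx3 1 0 0 0 s0 0 0 0 1)) => //.
  by apply: unitmx_diag; rewrite ?oner_eq0 // gt_eqF.
move=> x y z; rewrite mx3_vec3 !(mul0r, mul1r, add0r, addr0).
rewrite /= /exp_cone /setU /= !vec3E.
have [z0|z0|->] := ltgtP z 0.
- split=> [/Kz0|[[_ _ zE]|[_]]]; rewrite ?(lt_geF z0) //.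
  by rewrite zE ltxx in z0.
- rewrite Ksec // Ks.
  have -> : (s0 <= expR (- (x / z)) * (s0 * y / z)) = (expR (x / z) <= y / z).
    rewrite -subr_ge0 -[in RHS]subr_ge0.
    have -> : expR (- (x / z)) * (s0 * y / z) - s0 =
        (y / z - expR (x / z)) * (s0 * expR (- (x / z))).
      transitivity (s0 * expR (- (x / z)) * (y / z) -
         s0 * (expR (x / z) * expR (- (x / z)))); last by ring.
      by rewrite -expRD subrr expR0; ring.
    by rewrite pmulr_lge0 // mulr_gt0 // expR_gt0.
  split=> [h|[[_ _ zE]|[]//]]; first by right.
  by rewrite zE ltxx in z0.
- rewrite Kface pmulr_rge0 //; split=> [[]|[[]|[_]]] //; first by left.
Qed.
End Jordan.

(** * Spirals and rotations about an axis *)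

Section Spiral.
Variable a : R.
Hypothesis fl : forall t x y z, k x y z ->
  k x (expR (a * t) * (cos t * y + sin t * z))
      (expR (a * t) * (cos t * z - sin t * y)).

Lemma spiral_half_turn x y z : k x y z ->
  k x (- (expR (a * pi) * y)) (- (expR (a * pi) * z)).
Proof.
by move=> /(fl pi) /in_cone_eq; apply => //; rewrite cospi sinpi; ring.
Qed.

Lemma spiral_half_turnV x y z : k x y z ->
  k x (- (expR (- (a * pi)) * y)) (- (expR (- (a * pi)) * z)).
Proof.
move=> /(fl (- pi)) /in_cone_eq; apply => //;
by rewrite cosN sinN cospi sinpi mulrN; ring.
Qed.

(** In one direction of time a half turn acts on [(y, z)] as [- expR b] with [b > 0]. Repeated full
    turns, rescaled, remove [x] and leave [(0, y, z)] in the cone; one more half turn gives a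
    multiple of its opposite. Hence [y = 0] on the whole cone, contradicting the span condition. *)
Lemma no_spiral_flow : a != 0 -> False.
Proof.
move=> a0.
have turn (b : R) : (forall x y z, k x y z -> k x (- (expR b * y)) (- (expR b * z))) ->
    0 < b -> False.
  move=> tb b0.
  have tn n x y z : k x y z ->
      k x (expR (2 * b * n%:R) * y) (expR (2 * b * n%:R) * z).
    move=> Kv; elim: n => [|n IHn].
      by apply: in_cone_eq Kv _ _ _; rewrite ?mulr0 ?expR0; ring.
    have E : expR (2 * b * n.+1%:R) = expR b * (expR b * expR (2 * b * n%:R)).
      by rewrite -!expRD; congr expR; rewrite -natr1; ring.
    by apply: in_cone_eq (tb _ _ _ (tb _ _ _ IHn)) _ _ _; rewrite ?E; ring.
  have Kyz x y z : k x y z -> k 0 y z.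
    move=> Kv; have b20 : 0 < 2 * b by rewrite mulr_gt0.
    apply: (in_cone_lim pK (f := fun n => 0 + x * expR (- (2 * b * n%:R)))
        (g := fun n => y + 0 * expR (- (2 * b * n%:R)))
        (h := fun n => z + 0 * expR (- (2 * b * n%:R)))).
    - move=> n; have := in_coneZ pK (expR_ge0 (- (2 * b * n%:R))) (tn n _ _ _ Kv).
      have E : expR (- (2 * b * n%:R)) * expR (2 * b * n%:R) = 1.
        by rewrite -expRD addNr expR0.
      by move/in_cone_eq; apply; rewrite ?mulrA ?E; ring.
    - exact/cvg_affine/cvg_expRN.
    - exact/cvg_affine/cvg_expRN.
    - exact/cvg_affine/cvg_expRN.
  have [|x [y [z [Kv]]]] := in_cone_span pK (a := 0) (b := 1) (c := 0).
    by rewrite !xpair_eqE oner_eq0 !andbF.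
  rewrite mul1r !mul0r add0r addr0 => /eqP; apply.
  have K0 := Kyz _ _ _ Kv.
  have [|_ //] := in_cone_pointed pK K0.
  apply: (in_coneZK pK (expR_gt0 b)).
  by apply: in_cone_eq (tb _ _ _ K0) _ _ _; ring.
move: a0; rewrite neq_lt => /orP[a0|a0].
  by apply: (turn (- (a * pi)) spiral_half_turnV); rewrite oppr_gt0 pmulr_llt0 // pi_gt0.
by apply: (turn (a * pi) spiral_half_turn); rewrite mulr_gt0 // pi_gt0.
Qed.
End Spiral.

Section Rotation.
Hypothesis fl : forall t x y z, k x y z ->
  k x (cos t * y + sin t * z) (cos t * z - sin t * y).

Lemma rotation_half_turn x y z : k x y z -> k x (- y) (- z).
Proof.
by move=> /(fl pi) /in_cone_eq; apply => //; rewrite cospi sinpi; ring.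
Qed.

Lemma rotation_axis x y z : k x y z -> k x 0 0.
Proof.
move=> Kv; have := in_coneD pK Kv (rotation_half_turn Kv) => K2.
by apply: (in_coneZK pK (l := 2)) => //; apply: in_cone_eq K2 _ _ _; ring.
Qed.

Lemma polar_coordinates y z : exists t,
  y = cos t * Num.sqrt (y ^+ 2 + z ^+ 2) /\ z = sin t * Num.sqrt (y ^+ 2 + z ^+ 2).
Proof.
set r := Num.sqrt _.
have s0 : 0 <= y ^+ 2 + z ^+ 2 by rewrite addr_ge0 ?sqr_ge0.
have r2 : r ^+ 2 = y ^+ 2 + z ^+ 2 by rewrite sqr_sqrtr.
have [r0|rn] := eqVneq r 0.
  exists 0; rewrite r0 !mulr0; move: r2; rewrite r0 expr0n /= => /esym /eqP.
  by rewrite paddr_eq0 ?sqr_ge0 // !sqrf_eq0 => /andP[/eqP -> /eqP ->].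
have r_gt0 : 0 < r by rewrite lt_neqAle eq_sym rn sqrtr_ge0.
have yr : -1 <= y / r <= 1.
  rewrite -ler_norml -(ler_pXn2r (n := 2)) ?nnegrE // real_normK ?num_real // expr1n.
  rewrite expr_div_n ler_pdivrMr ?exprn_gt0 // mul1r r2.
  by rewrite lerDl sqr_ge0.
have ca : cos (acos (y / r)) = y / r by rewrite acosK // in_itv.
have zz : z ^+ 2 = (sin (acos (y / r)) * r) ^+ 2.
  rewrite exprMn sin2cos2 ca r2 expr_div_n r2.
  by field; rewrite -r2 expf_neq0.
(* The arc cosine fixes the cosine and the square of the sine; the sign of [z] decides between the
   angle and its opposite. *)
move/eqP: zz; rewrite eqf_sqr => /orP[]/eqP zz.
  by exists (acos (y / r)); rewrite ca zz; split=> //; field.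
by exists (- acos (y / r)); rewrite cosN sinN ca zz; split; [field | ring].
Qed.

(** By rotation, membership depends only on [x] and the radius [r], and the cone is [s0 r <= x]. The
    slope [s0] is positive because the plane [x = 0] meets the cone only at the apex. *)
Lemma rotation_pos_classified : k 1 0 0 -> classified K.
Proof.
move=> K1.
have Kx0 x y z : k x y z -> 0 <= x.
  move=> /rotation_axis Kx; rewrite leNgt; apply/negP => x0.
  have [|/eqP] := in_cone_pointed pK K1; last by rewrite oner_eq0.
  apply: (in_coneZK pK (l := - x)); first by rewrite oppr_gt0.
  by apply: in_cone_eq Kx _ _ _; ring.
have K0 y z : k 0 y z -> y = 0 /\ z = 0.
  move=> Kv; have [|_ -> -> //] := in_cone_pointed pK Kv.
  by rewrite oppr0; exact: rotation_half_turn.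
have Kr x y z : k x y z <-> k x (Num.sqrt (y ^+ 2 + z ^+ 2)) 0.
  have [t []] := polar_coordinates y z; set r := Num.sqrt _ => yE zE.
  have cs := cos2Dsin2 t; split=> Kv.
    apply: in_cone_eq (fl t Kv) _ _ _ => //; rewrite [y in LHS]yE [z in LHS]zE.
      by transitivity ((cos t ^+ 2 + sin t ^+ 2) * r); [ring | rewrite cs mul1r].
    by ring.
  apply: in_cone_eq (fl (- t) Kv) _ _ _ => //; rewrite cosN sinN.
    by rewrite [RHS]yE; ring.
  by rewrite [RHS]zE; ring.
have [s0 Hs0] : exists s0, forall s, k (0 + s * 1) (1 + s * 0) (0 + s * 0) <-> s0 <= s.
  apply: (ray_threshold pK K1).
    by move=> /(in_cone_pointed pK K1)[/eqP]; rewrite oner_eq0.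
  have [|x [y [z [Kv]]]] := in_cone_span pK (a := 0) (b := 1) (c := 0).
    by rewrite !xpair_eqE oner_eq0 !andbF.
  rewrite mul1r !mul0r add0r addr0 => yn.
  set r := Num.sqrt (y ^+ 2 + z ^+ 2).
  have r0 : 0 < r.
    by rewrite sqrtr_gt0 ltr_wpDr ?sqr_ge0 // lt_neqAle eq_sym sqrf_eq0 yn sqr_ge0.
  exists (x / r); apply: (in_coneZK pK r0).
  by move/Kr: Kv => /in_cone_eq; apply; rewrite -/r; field; rewrite gt_eqF.
have Ks s : k s 1 0 <-> s0 <= s.
  by rewrite -Hs0 !mulr0 !addr0 mulr1 add0r.
have s0_gt0 : 0 < s0.
  have Ks0 : k s0 1 0 by apply/Ks.
  rewrite lt_neqAle (Kx0 _ _ _ Ks0) andbT; apply/negP => /eqP s00.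
  by move: Ks0; rewrite -s00 => /K0[/eqP]; rewrite oner_eq0.
have Kn x r : 0 <= r -> k x r 0 <-> s0 * r <= x.
  rewrite le_eqVlt => /predU1P[<-|r0].
    rewrite mulr0; split=> [/Kx0 //|x0].
    by apply: in_cone_eq (in_coneZ pK x0 K1) _ _ _; ring.
  rewrite -ler_pdivlMr // -Ks; split=> Kv.
    have p0 : 0 <= r^-1 by rewrite invr_ge0 ltW.
    by apply: in_cone_eq (in_coneZ pK p0 Kv) _ _ _; field; rewrite ?gt_eqF.
  by apply: in_cone_eq (in_coneZ pK (ltW r0) Kv) _ _ _; field; rewrite ?gt_eqF.
have sn : s0 != 0 by rewrite gt_eqF.
(* The new coordinates are [(x + z)/2] for the axis and [(x - z)/(2 s0)], [y/s0] across it; the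
   difference of squares [((x + z)/2)^2 - ((x - z)/2)^2] is [x z]. *)
apply: (classified_mx3 (lbl := PowerCone 2 2 1)
  (P := mx3 2^-1 0 2^-1 (2 * s0)^-1 0 (- (2 * s0)^-1) 0 s0^-1 0)).
- by split; [split; [|field] | rewrite ltr01 lexx].
- apply: unitmx3; rewrite (_ : _ + _ = 2^-1 * s0^-1 ^+ 2); last by field.
  by rewrite mulf_neq0 ?expf_neq0 ?invr_eq0 // pnatr_eq0.
move=> x y z; rewrite lorentz_memE mx3_vec3 Kr Kn ?sqrtr_ge0 //.
rewrite !(mul0r, addr0, add0r).
set w := _ ^+ 2 + _ ^+ 2.
have w0 : 0 <= w by rewrite addr_ge0 ?sqr_ge0.
have wE : s0 ^+ 2 * w = ((x - z) / 2) ^+ 2 + y ^+ 2 by rewrite /w; field.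
set h := 2^-1 * x + _.
have hE : h = (x + z) / 2 by rewrite /h; field.
have -> : (s0 * Num.sqrt w <= h) <-> 0 <= h /\ y ^+ 2 <= x * z.
  have key : 0 <= h -> (s0 * Num.sqrt w <= h) = (y ^+ 2 <= x * z).
    move=> h0; rewrite -(ler_pXn2r (n := 2)) ?nnegrE //; last first.
      by rewrite mulr_ge0 ?sqrtr_ge0 // ltW.
    rewrite exprMn sqr_sqrtr // wE hE -subr_ge0 -[in RHS]subr_ge0.
    by congr (0 <= _); field.
  split=> [hw|[h0]]; last by rewrite key.
  have h0 : 0 <= h by rewrite (le_trans _ hw) // mulr_ge0 ?sqrtr_ge0 // ltW.
  by rewrite -key.
(* The quadratic inequality describes two opposite nappes; the sign of [x + z] selects one. *)
rewrite hE; split=> [[xz yxz]|[x0 z0 yxz]]; last by rewrite divr_ge0 // addr_ge0.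
have xz0 : 0 <= x * z by rewrite (le_trans _ yxz) // sqr_ge0.
have [x0|x0] := leP 0 x; have [z0|z0] := leP 0 z; first (by split); exfalso.
- have: x <= 0 by rewrite -(nmulr_lge0 _ z0) mulrC mulrC.
  by move=> x0'; move: xz; lra.
- have: z <= 0 by rewrite -(nmulr_rge0 _ x0).
  by move=> z0'; move: xz; lra.
- by move: xz; lra.
Qed.
End Rotation.
End Cone.

Lemma jordan_classified K : proper_cone K ->
  (forall t x y z, K (vec3 x y z) -> K (vec3 (x + t * z) (expR t * y) z)) ->
  classified K.
Proof.
move=> pK fl.
wlog K1 : K pK fl / K (vec3 (- 1) 0 0).
  move=> H; have [|x [y [z [Kv]]]] := in_cone_span pK (a := 0) (b := 0) (c := 1).
    by rewrite !xpair_eqE oner_eq0 !andbF.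
  rewrite mul1r !mul0r !add0r -oppr_eq0 => zn.
  have [K1|K1] := in_cone_axis_sign pK zn (jordan_limit pK fl Kv); last exact: (H K).
  (* The first and third coordinates change sign together, as the term [t z] requires for the flow
     to be preserved. *)
  have uP : mx3 (- 1) 0 0 0 1 0 0 0 (- 1 : R) \in unitmx.
    by apply: unitmx_diag; rewrite ?oppr_eq0 oner_eq0.
  apply: (classified_mx_preim uP); apply: H; first exact: proper_mx_preim.
    move=> t u v w; rewrite !mx_preim_diag => Kw.
    by apply: in_cone_eq (fl t _ _ _ Kw) _ _ _; ring.
  by rewrite mx_preim_diag; apply: in_cone_eq K1 _ _ _; ring.
have [|x [y [z [Kv]]]] := in_cone_span pK (a := 0) (b := 1) (c := 0).
  by rewrite !xpair_eqE oner_eq0 !andbF.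
rewrite mul1r !mul0r add0r addr0 => yn.
have K2 := jordan_limit_second pK fl K1 Kv.
have [y0|y0|y0] := ltgtP y 0; last by rewrite y0 eqxx in yn.
  have uP : mx3 1 0 0 0 (- 1) 0 0 0 (1 : R) \in unitmx.
    by apply: unitmx_diag; rewrite ?oppr_eq0 oner_eq0.
  apply: (classified_mx_preim uP); apply: jordan_pos_classified.
  - exact: proper_mx_preim.
  - move=> t u v w; rewrite !mx_preim_diag => Kw.
    by apply: in_cone_eq (fl t _ _ _ Kw) _ _ _; ring.
  - by rewrite mx_preim_diag; apply: in_cone_eq K1 _ _ _; ring.
  - rewrite mx_preim_diag; apply: (in_coneZK pK (l := - y)); first by rewrite oppr_gt0.
    by apply: in_cone_eq K2 _ _ _; ring.
apply: jordan_pos_classified => //; apply: (in_coneZK pK y0).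
by apply: in_cone_eq K2 _ _ _; ring.
Qed.

Lemma rotation_classified K : proper_cone K ->
  (forall t x y z, K (vec3 x y z) ->
     K (vec3 x (cos t * y + sin t * z) (cos t * z - sin t * y))) ->
  classified K.
Proof.
move=> pK fl; have [|x [y [z [Kv]]]] := in_cone_span pK (a := 1) (b := 0) (c := 0).
  by rewrite !xpair_eqE oner_eq0.
rewrite mul1r !mul0r !addr0 => xn.
have [K1|K1] := in_cone_axis_sign pK xn (rotation_axis pK fl Kv).
  exact: rotation_pos_classified.
have uP : mx3 (- 1) 0 0 0 1 0 0 0 (1 : R) \in unitmx.
  by apply: unitmx_diag; rewrite ?oppr_eq0 oner_eq0.
apply: (classified_mx_preim uP); apply: rotation_pos_classified.
- exact: proper_mx_preim.
- move=> t u v w; rewrite !mx_preim_diag => Kw.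
  by apply: in_cone_eq (fl t _ _ _ Kw) _ _ _; ring.
- by rewrite mx_preim_diag; apply: in_cone_eq K1 _ _ _; ring.
Qed.
End JordanAndRotation.

Section Diagonal.
Context {R : realType}.
Implicit Types (K : set 'cV[R]_3) (a b c l s t u v w x y z : R).

Section Cone.
Variables (K : set 'cV[R]_3) (pK : proper_cone K).
Local Notation k x y z := (K (vec3 x y z)).

(** * A double semisimple eigenvalue *)

Section Homothety.
Hypothesis fl : forall t x y z, k x y z -> k (expR t * x) y z.

Lemma homothety_axis x y z : k x y z -> k x 0 0.
Proof.
move=> Kv.
apply: (in_cone_lim pK
  (f := fun n => x + 0 * expR (- (1 * n%:R)))
  (g := fun n => 0 + y * expR (- (1 * n%:R)))
  (h := fun n => 0 + z * expR (- (1 * n%:R)))).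
- move=> n; have := in_coneZ pK (expR_ge0 (- (1 * n%:R))) (fl (1 * n%:R) Kv).
  move=> Kn; apply: in_cone_eq Kn _ _ _; [| by ring | by ring].
  by rewrite mulrA -expRD addNr expR0; ring.
- exact/cvg_affine/cvg_expRN.
- exact/cvg_affine/cvg_expRN.
- exact/cvg_affine/cvg_expRN.
Qed.

Lemma homothety_plane x y z : k x y z -> k 0 y z.
Proof.
move=> Kv.
apply: (in_cone_lim pK
  (f := fun n => 0 + x * expR (- (1 * n%:R)))
  (g := fun n => y + 0 * expR (- (1 * n%:R)))
  (h := fun n => z + 0 * expR (- (1 * n%:R)))).
- by move=> n; apply: in_cone_eq (fl (- (1 * n%:R)) Kv) _ _ _; ring.
- exact/cvg_affine/cvg_expRN.
- exact/cvg_affine/cvg_expRN.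
- exact/cvg_affine/cvg_expRN.
Qed.

(* The cone is the product of the axis with a planar cone.  The latter is
   spanned by the two rays through [g + s0 w] and [- g + s1 w], where [w] is the
   sum of two independent vectors [g], [h] of the planar cone. *)
Lemma homothety_pos_classified : k 1 0 0 -> classified K.
Proof.
move=> K1.
have Kx0 x y z : k x y z -> 0 <= x.
  move=> /homothety_axis Kx; rewrite leNgt; apply/negP => x0.
  have [|/eqP] := in_cone_pointed pK K1; last by rewrite oner_eq0.
  apply: (in_coneZK pK (l := - x)); first by rewrite oppr_gt0.
  by apply: in_cone_eq Kx _ _ _; ring.
have [|x [g1 [g2 [Kg]]]] := in_cone_span pK (a := 0) (b := 1) (c := 0).
  by rewrite !xpair_eqE oner_eq0 !andbF.
rewrite mul1r !mul0r add0r addr0 => g1n.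
have {x}Kg : k 0 g1 g2 := homothety_plane Kg.
(* The functional [- g2 y + g1 z] vanishes at [g], so the new vector is independent of [g]. *)
have [|x [h1 [h2 [Kh]]]] := in_cone_span pK (a := 0) (b := - g2) (c := g1).
  by rewrite !xpair_eqE (negPf g1n) !andbF.
rewrite !mul0r add0r => ghn.
have {x}Kh : k 0 h1 h2 := homothety_plane Kh.
set w1 := g1 + h1; set w2 := g2 + h2.
have Kw : k 0 w1 w2 by apply: in_cone_eq (in_coneD pK Kg Kh) _ _ _; rewrite ?addr0.
have indep a b : a * g1 + b * w1 = 0 -> a * g2 + b * w2 = 0 -> a = 0 /\ b = 0.
  move=> e1 e2.
  have b0 : b * (- g2 * h1 + g1 * h2) = 0.
    by transitivity (g1 * (a * g2 + b * w2) - g2 * (a * g1 + b * w1));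
      [rewrite /w1 /w2; ring | rewrite e1 e2; ring].
  have {}b0 : b = 0 by move/eqP: b0; rewrite mulf_eq0 (negPf ghn) orbF => /eqP.
  by split=> //; move/eqP: e1; rewrite b0 mul0r addr0 mulf_eq0 (negPf g1n) orbF => /eqP.
have KNw : ~ k (- 0) (- w1) (- w2).
  move=> KNw; have [_ e1 e2] := in_cone_pointed pK Kw KNw.
  have [||_ /eqP] := indep 0 1; rewrite ?e1 ?e2 ?mul0r ?add0r ?mulr0 //.
  by rewrite oner_eq0.
have [s0 Hs0] : exists s0, forall s, k (0 + s * 0) (g1 + s * w1) (g2 + s * w2) <-> s0 <= s.
  apply: (ray_threshold pK Kw KNw); exists 0.
  by apply: in_cone_eq Kg _ _ _; ring.
have [s1 Hs1] : exists s1, forall s, k (0 + s * 0) (- g1 + s * w1) (- g2 + s * w2) <-> s1 <= s.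
  apply: (ray_threshold pK Kw KNw); exists 1.
  by apply: in_cone_eq Kh _ _ _; rewrite /w1 /w2; ring.
have {Hs0}Ks0 s : k 0 (g1 + s * w1) (g2 + s * w2) <-> s0 <= s.
  by rewrite -Hs0 mulr0 addr0.
have {Hs1}Ks1 s : k 0 (- g1 + s * w1) (- g2 + s * w2) <-> s1 <= s.
  by rewrite -Hs1 mulr0 addr0.
have K_w s : k 0 (s * w1) (s * w2) -> 0 <= s.
  move=> Ks; rewrite leNgt; apply/negP => s_lt0; apply: KNw.
  apply: (in_coneZK pK (l := - s)); first by rewrite oppr_gt0.
  by apply: in_cone_eq Ks _ _ _; ring.
have Ku0 : k 0 (g1 + s0 * w1) (g2 + s0 * w2) by apply/Ks0.
have Ku1 : k 0 (- g1 + s1 * w1) (- g2 + s1 * w2) by apply/Ks1.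
(* The two boundary vectors add up to [(s0 + s1) w]; a zero sum would make them opposite. *)
have s_gt0 : 0 < s0 + s1.
  rewrite lt_neqAle; apply/andP; split; last first.
    by apply: K_w; apply: in_cone_eq (in_coneD pK Ku0 Ku1) _ _ _; ring.
  apply/negP => /eqP s00.
  have s1E : s1 = - s0 by apply/eqP; rewrite -addr_eq0 addrC -s00.
  have [|_ e1 e2] := in_cone_pointed pK Ku0.
    by apply: in_cone_eq Ku1 _ _ _; rewrite ?s1E; ring.
  by have [||/eqP] := indep 1 s0; rewrite ?mul1r // oner_eq0.
apply: (classified_mx3 (lbl := Orthant R) (P := mx3 1 0 0
  0 (g1 + s0 * w1) (- g1 + s1 * w1) 0 (g2 + s0 * w2) (- g2 + s1 * w2))) => //.
  apply: unitmx3.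
  rewrite (_ : _ + _ = (s0 + s1) * (- g2 * h1 + g1 * h2)); last by rewrite /w1 /w2; ring.
  by rewrite mulf_neq0 // gt_eqF.
move=> x y z; rewrite mx3_vec3 !(mul0r, mul1r, addr0, add0r) /=.
have -> : orthant R (vec3 x y z) <-> [/\ 0 <= x, 0 <= y & 0 <= z].
  split=> [h|[x0 y0 z0] i]; first last.
    by elim/ord3_ind: i; rewrite vec3E.
  by split; [have := h 0 | have := h 1 | have := h 2]; rewrite vec3E.
split=> [Kv|[x0 y0 z0]]; last first.
  have := in_coneD pK (in_coneD pK (in_coneZ pK x0 K1) (in_coneZ pK y0 Ku0)) (in_coneZ pK z0 Ku1).
  by move/in_cone_eq; apply; ring.
have x0 := Kx0 _ _ _ Kv; have {}Kv := homothety_plane Kv.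
suff [y0 z0] : 0 <= y /\ 0 <= z by [].
(* The combination of the boundary vectors with coefficients [y] and [z] is
   [(y - z) g + (y s0 + z s1) w]; dividing by [|y - z|] makes the coefficient of [g] equal to [1] or
   [-1], where a threshold applies. *)
have [yz|yz|yz] := ltgtP y z.
- have zy0 : 0 < z - y by rewrite subr_gt0.
  have : k 0 (- g1 + (y * s0 + z * s1) / (z - y) * w1)
             (- g2 + (y * s0 + z * s1) / (z - y) * w2).
    apply: (in_coneZK pK zy0).
    by apply: in_cone_eq Kv _ _ _; field; rewrite ?gt_eqF.
  rewrite Ks1 -subr_ge0 (_ : _ - s1 = y * (s0 + s1) / (z - y)); last first.
    by field; rewrite gt_eqF.
  rewrite pmulr_lge0 ?invr_gt0 // pmulr_lge0 // => y0.
  by split=> //; rewrite (le_trans y0) // ltW.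
- have zy0 : 0 < y - z by rewrite subr_gt0.
  have : k 0 (g1 + (y * s0 + z * s1) / (y - z) * w1)
             (g2 + (y * s0 + z * s1) / (y - z) * w2).
    apply: (in_coneZK pK zy0).
    by apply: in_cone_eq Kv _ _ _; field; rewrite ?gt_eqF.
  rewrite Ks0 -subr_ge0 (_ : _ - s0 = z * (s0 + s1) / (y - z)); last first.
    by field; rewrite gt_eqF.
  rewrite pmulr_lge0 ?invr_gt0 // pmulr_lge0 // => z0.
  by split=> //; rewrite (le_trans z0) // ltW.
- have : k 0 (z * (s0 + s1) * w1) (z * (s0 + s1) * w2).
    by apply: in_cone_eq Kv _ _ _; rewrite ?yz; ring.
  by move/K_w; rewrite pmulr_lge0 // yz.
Qed.
End Homothety.
End Cone.

Lemma homothety_classified K : proper_cone K ->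
  (forall t x y z, K (vec3 x y z) -> K (vec3 (expR t * x) y z)) ->
  classified K.
Proof.
move=> pK fl; have [|x [y [z [Kv]]]] := in_cone_span pK (a := 1) (b := 0) (c := 0).
  by rewrite !xpair_eqE oner_eq0.
rewrite mul1r !mul0r !addr0 => xn.
have [K1|K1] := in_cone_axis_sign pK xn (homothety_axis pK fl Kv).
  exact: homothety_pos_classified.
have uP : mx3 (- 1) 0 0 0 1 0 0 0 (1 : R) \in unitmx.
  by apply: unitmx_diag; rewrite ?oppr_eq0 oner_eq0.
apply: (classified_mx_preim uP); apply: homothety_pos_classified.
- exact: proper_mx_preim.
- move=> t u v w; rewrite !mx_preim_diag => Kw.
  by apply: in_cone_eq (fl t _ _ _ Kw) _ _ _; ring.
- by rewrite mx_preim_diag; apply: in_cone_eq K1 _ _ _; ring.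
Qed.
End Diagonal.

(** * Three distinct real eigenvalues *)

Section DiagonalDistinct.
Context {R : realType}.
Implicit Types (K : set 'cV[R]_3) (a b c l s t u v w x y z : R).

Section Cone.
Variables (K : set 'cV[R]_3) (pK : proper_cone K) (th : R).
Hypothesis th01 : 0 < th < 1.
Local Notation k x y z := (K (vec3 x y z)).
Hypothesis fl : forall t x y z, k x y z -> k (expR t * x) (expR (th * t) * y) z.

Lemma hyperbolic_first x y z : k x y z -> k x 0 0.
Proof.
case/andP: th01 => th0 th1 Kv.
have th10 : 0 < 1 - th by rewrite subr_gt0.
apply: (in_cone_lim pK
  (f := fun n => x + 0 * expR (- (1 * n%:R)))
  (g := fun n => 0 + y * expR (- ((1 - th) * n%:R)))
  (h := fun n => 0 + z * expR (- (1 * n%:R)))).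
- move=> n; have := in_coneZ pK (expR_ge0 (- (1 * n%:R))) (fl (1 * n%:R) Kv).
  move=> Kn; apply: in_cone_eq Kn _ _ _; rewrite ?mulrA -?expRD.
  + by rewrite addNr expR0; ring.
  + by rewrite add0r [RHS]mulrC; congr (expR _ * _); ring.
  + by ring.
- exact/cvg_affine/cvg_expRN.
- exact/cvg_affine/cvg_expRN.
- exact/cvg_affine/cvg_expRN.
Qed.

Lemma hyperbolic_third x y z : k x y z -> k 0 0 z.
Proof.
case/andP: th01 => th0 th1 Kv.
apply: (in_cone_lim pK
  (f := fun n => 0 + x * expR (- (1 * n%:R)))
  (g := fun n => 0 + y * expR (- (th * n%:R)))
  (h := fun n => z + 0 * expR (- (1 * n%:R)))).
- move=> n; apply: in_cone_eq (fl (- (1 * n%:R)) Kv) _ _ _; rewrite ?mul1r ?mulrN; by ring.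
- exact/cvg_affine/cvg_expRN.
- exact/cvg_affine/cvg_expRN.
- exact/cvg_affine/cvg_expRN.
Qed.

(** The middle eigenvalue dominates an orbit only when an extreme coordinate vanishes: forwards in
    time if [x = 0], backwards if [z = 0]. *)
Lemma hyperbolic_second x y z : k x y z -> x * z = 0 -> k 0 y 0.
Proof.
case/andP: th01 => th0 th1 Kv /eqP; rewrite mulf_eq0 => /orP[]/eqP E.
  apply: (in_cone_lim pK
    (f := fun n => 0 + x * expR (- (th * n%:R)))
    (g := fun n => y + 0 * expR (- (th * n%:R)))
    (h := fun n => 0 + z * expR (- (th * n%:R)))).
  - move=> n; have := in_coneZ pK (expR_ge0 (- (th * n%:R))) (fl n%:R Kv).
    move=> Kn; apply: in_cone_eq Kn _ _ _; rewrite ?E; [by ring| |by ring].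
    by rewrite mulrA -expRD addNr expR0; ring.
  - exact/cvg_affine/cvg_expRN.
  - exact/cvg_affine/cvg_expRN.
  - exact/cvg_affine/cvg_expRN.
have th10 : 0 < 1 - th by rewrite subr_gt0.
apply: (in_cone_lim pK
  (f := fun n => 0 + x * expR (- ((1 - th) * n%:R)))
  (g := fun n => y + 0 * expR (- (th * n%:R)))
  (h := fun n => 0 + z * expR (- (th * n%:R)))).
- move=> n; have := in_coneZ pK (expR_ge0 (th * n%:R)) (fl (- n%:R) Kv).
  move=> Kn; apply: in_cone_eq Kn _ _ _; rewrite ?E; [| |by ring].
    by rewrite mulrA -expRD add0r [RHS]mulrC; congr (expR _ * _); ring.
  by rewrite mulrA -expRD mulrN subrr expR0; ring.
- exact/cvg_affine/cvg_expRN.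
- exact/cvg_affine/cvg_expRN.
- exact/cvg_affine/cvg_expRN.
Qed.

Local Notation m x z := (x `^ th * z `^ (1 - th)).

(** The time [ln z - ln x] and the scaling by [1/z] bring [x] and [z] to [1]. The mean is
    homogeneous of degree 1 and is multiplied by [expR (th t)] along the flow, so [y] divided by it
    is invariant. *)
Lemma hyperbolic_section x y z : 0 < x -> 0 < z ->
  k x y z <-> k 1 (y / m x z) 1.
Proof.
move=> x0 z0; have m0 : 0 < m x z by rewrite mulr_gt0 ?powR_gt0.
have E : z^-1 * expR (th * - (ln x - ln z)) = (m x z)^-1.
  apply: (mulIf (lt0r_neq0 m0)); rewrite mulVf ?gt_eqF //.
  rewrite /powR !gt_eqF // -{1}[z]lnK // -expRN -!expRD.
  by rewrite -[RHS]expR0; congr expR; ring.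
have E' : x * z^-1 * expR (- (ln x - ln z)) = 1.
  rewrite -{1}[x]lnK // -{1}[z]lnK // -expRN -!expRD -[RHS]expR0.
  by congr expR; ring.
have xn := lt0r_neq0 x0; have zn := lt0r_neq0 z0.
have iz0 : 0 <= z^-1 by rewrite invr_ge0 ltW.
split=> [Kv|Kv].
  apply: in_cone_eq (fl (- (ln x - ln z)) (in_coneZ pK iz0 Kv)) _ _ _.
  - by rewrite -[RHS]E'; ring.
  - by rewrite -E; ring.
  - by rewrite mulVf.
apply: in_cone_eq (in_coneZ pK (ltW z0) (fl (ln x - ln z) Kv)) _ _ _.
- rewrite mulr1 expRB !lnK ?posrE //; by field.
- rewrite -E mulrN expRN; field.
  by rewrite zn gt_eqF // expR_gt0.
- by rewrite mulr1.
Qed.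

Hypothesis (K1 : k 1 0 0) (K3 : k 0 0 1).

Lemma hyperbolic_ge0 x y z : k x y z -> 0 <= x /\ 0 <= z.
Proof.
move=> Kv; have Kx := hyperbolic_first Kv; have Kz := hyperbolic_third Kv.
split; rewrite leNgt; apply/negP => v0.
  have [|/eqP] := in_cone_pointed pK K1; last by rewrite oner_eq0.
  apply: (in_coneZK pK (l := - x)); first by rewrite oppr_gt0.
  by apply: in_cone_eq Kx _ _ _; ring.
have [|_ _ /eqP] := in_cone_pointed pK K3; last by rewrite oner_eq0.
apply: (in_coneZK pK (l := - z)); first by rewrite oppr_gt0.
by apply: in_cone_eq Kz _ _ _; ring.
Qed.

Lemma hyperbolic_interior : k 1 0 1.
Proof. by apply: in_cone_eq (in_coneD pK K1 K3) _ _ _; ring. Qed.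

(** Used with [e = 1] and [e = -1] for the two ends of the section. The point [(1, e c, 1)] is
    proportional to [(1/c, e, 1/c)], and along the interior direction [(1, 0, 1)] a threshold [s0]
    exists; it is positive because [(0, e, 0)] is excluded, and [b = 1/s0]. If no positive [c]
    occurs, [b = 0]. *)
Lemma hyperbolic_bound e : e != 0 -> ~ k 0 e 0 ->
  exists2 b, 0 <= b & forall c, 0 <= c -> k 1 (e * c) 1 <-> c <= b.
Proof.
move=> e0 KNe.
have K13 := hyperbolic_interior.
have [[c0 c0_gt0 Kc0]|none] := pselect (exists2 c, 0 < c & k 1 (e * c) 1); last first.
  exists 0 => // c c_ge0; split=> [Kc|c_le0].
    by rewrite leNgt; apply/negP => c_gt0; apply: none; exists c.
  have -> : c = 0 by apply/eqP; rewrite eq_le c_le0.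
  by rewrite mulr0.
have [s0 Hs0] : exists s0, forall s, k (0 + s * 1) (e + s * 0) (0 + s * 1) <-> s0 <= s.
  apply: (ray_threshold pK K13).
    by move=> /(in_cone_pointed pK K13)[/eqP]; rewrite oner_eq0.
  exists c0^-1; apply: (in_coneZK pK c0_gt0).
  by apply: in_cone_eq Kc0 _ _ _; field; rewrite gt_eqF.
have Ks s : k s e s <-> s0 <= s by rewrite -Hs0 mulr1 mulr0 add0r addr0.
have Ks0 : k s0 e s0 by apply/Ks.
have s0_gt0 : 0 < s0.
  have [s00 _] := hyperbolic_ge0 Ks0.
  rewrite lt_neqAle s00 andbT; apply/negP => /eqP s0E.
  by apply: KNe; move: Ks0; rewrite -s0E.
exists s0^-1; first by rewrite invr_ge0 ltW.
move=> c; rewrite le_eqVlt => /predU1P[<-|c_gt0].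
  by rewrite mulr0 invr_ge0 ltW.
have -> : (c <= s0^-1) = (s0 <= c^-1) by rewrite -{1}[c]invrK lef_pV2 ?posrE ?invr_gt0.
rewrite -Ks; split=> Kc.
  by apply: (in_coneZK pK c_gt0); apply: in_cone_eq Kc _ _ _; field; rewrite ?gt_eqF.
by apply: in_cone_eq (in_coneZ pK (ltW c_gt0) Kc) _ _ _; field; rewrite ?gt_eqF.
Qed.

Lemma hyperbolic_boundary x y z : 0 <= x -> 0 <= z -> x * z = 0 ->
  k x y z <-> k 0 y 0.
Proof.
move=> x0 z0 xz; split=> [Kv|Ky]; first exact: hyperbolic_second Kv xz.
have := in_coneD pK (in_coneD pK (in_coneZ pK x0 K1) (in_coneZ pK z0 K3)) Ky.
by move/in_cone_eq; apply; ring.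
Qed.

(** Both exponents have to be nonzero here, since [0] to the power [0] is [1]. *)
Lemma mean_boundary x z : x * z = 0 -> m x z = 0.
Proof.
case/andP: th01 => th0 th1.
have th10 : 1 - th != 0 by rewrite subr_eq0 eq_sym lt_eqF.
move=> /eqP; rewrite mulf_eq0 => /orP[]/eqP ->.
  by rewrite powR0 ?mul0r // gt_eqF.
by rewrite [0 `^ _]powR0 ?mulr0.
Qed.

Hypothesis th2 : th <= 2^-1.

Lemma hyperbolic_conjugate : conjugate_exponents th^-1 (1 - th)^-1.
Proof.
case/andP: th01 => th0 th1; split; last by rewrite !invrK; ring.
by rewrite -[X in X <= _]invrK lef_pV2 ?posrE ?invr_gt0.
Qed.

Lemma hyperbolic_power_mean (v : 'cV[R]_3) : power_mean th^-1 (1 - th)^-1 v = m (v 0 0) (v 2 0).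
Proof. by rewrite /power_mean !invrK. Qed.

(** The ray [(0, -1, 0)] makes every section a half-line, so the cone is the region below [b] times
    the mean: an orthant for [b = 0], type 3 after scaling by [b] otherwise. *)
Lemma hyperbolic_unbounded_classified : k 0 (- 1) 0 -> classified K.
Proof.
move=> K2; have KN2 : ~ k 0 1 0.
  move=> KN2; have [|_ /eqP] := in_cone_pointed pK KN2; last by rewrite oner_eq0.
  by apply: in_cone_eq K2 _ _ _; ring.
have K13 := hyperbolic_interior.
have [b b0 Hb] := hyperbolic_bound (oner_neq0 _) KN2.
have By y : k 0 y 0 <-> y <= 0.
  split=> [Ky|y0].
    rewrite leNgt; apply/negP => y0; apply: KN2.
    by apply: (in_coneZK pK y0); apply: in_cone_eq Ky _ _ _; ring.
  have Ny0 : 0 <= - y by rewrite oppr_ge0.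
  by apply: in_cone_eq (in_coneZ pK Ny0 K2) _ _ _; ring.
have Sc c : k 1 c 1 <-> c <= b.
  have [c0|c0] := leP 0 c; first by rewrite -Hb // mul1r.
  split=> _; first by rewrite (le_trans (ltW c0)).
  have Nc0 : 0 <= - c by rewrite oppr_ge0 ltW.
  by apply: in_cone_eq (in_coneD pK K13 (in_coneZ pK Nc0 K2)) _ _ _; ring.
have mem x y z : k x y z <-> [/\ 0 <= x, 0 <= z & y <= b * m x z].
  suff h : 0 <= x -> 0 <= z -> k x y z <-> y <= b * m x z.
    split=> [Kv|[x0 z0]]; last by rewrite h.
    by have [x0 z0] := hyperbolic_ge0 Kv; split=> //; rewrite -h.
  move=> x0 z0; have [xz|xz] := eqVneq (x * z) 0.
    by rewrite hyperbolic_boundary // By mean_boundary // mulr0.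
  move: xz; rewrite mulf_eq0 negb_or => /andP[xn zn].
  have x_gt0 : 0 < x by rewrite lt_neqAle eq_sym xn.
  have z_gt0 : 0 < z by rewrite lt_neqAle eq_sym zn.
  by rewrite hyperbolic_section // Sc ler_pdivrMr // mulr_gt0 ?powR_gt0.
have [bE|bn] := eqVneq b 0.
  apply: (classified_mx3 (lbl := Orthant R) (P := mx3 1 0 0 0 (- 1) 0 0 0 1)) => //.
    by apply: unitmx_diag; rewrite ?oppr_eq0 oner_eq0.
  move=> x y z; rewrite mx3_vec3 !(mul0r, mul1r, addr0, add0r) mem bE mul0r.
  rewrite mulN1r oppr_le0 /= /orthant /=; split=> [[x0 z0 y0] i|h].
    by elim/ord3_ind: i; rewrite vec3E.
  by split; [have := h 0 | have := h 2 | have := h 1]; rewrite vec3E.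
have b_gt0 : 0 < b by rewrite lt_neqAle eq_sym bn.
apply: (classified_mx3 (lbl := PowerHypograph th^-1 (1 - th)^-1)
  (P := mx3 1 0 0 0 b 0 0 0 1)).
- exact: hyperbolic_conjugate.
- by apply: unitmx_diag; rewrite ?oner_eq0.
move=> x y z; rewrite mx3_vec3 !(mul0r, mul1r, addr0, add0r) mem /=.
rewrite /power_hypograph /= hyperbolic_power_mean !vec3E ler_pM2l //.
by split=> -[].
Qed.

(** Scaling the second coordinate by [b] turns the section [[-a, b]] into [[-a/b, 1]], whence
    [alpha = a/b], with type 5 for [a = 0]. On the coordinate planes [x z = 0] the mean vanishes and
    the hypothesis on [(0, y, 0)] gives the same condition [y = 0]. *)
Lemma hyperbolic_bounded_classified a b : 0 <= a <= b -> 0 < b ->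
  (forall y, k 0 y 0 -> y = 0) ->
  (forall c, k 1 c 1 <-> - a <= c <= b) -> classified K.
Proof.
move=> /andP[a0 ab] b0 By Sc; have bn := lt0r_neq0 b0.
have mem x y z : k x (b * y) z <->
    [/\ - (a / b) * m x z <= y <= m x z, 0 <= x & 0 <= z].
  suff h : 0 <= x -> 0 <= z ->
      k x (b * y) z <-> - (a / b) * m x z <= y <= m x z.
    split=> [Kv|[+ x0 z0]]; last by rewrite h.
    by have [x0 z0] := hyperbolic_ge0 Kv; split=> //; rewrite -h.
  move=> x0 z0; have [xz|xz] := eqVneq (x * z) 0.
    rewrite hyperbolic_boundary // mean_boundary // mulr0 -eq_le.
    split=> [/By/eqP|/eqP <-]; last by rewrite mulr0; exact: in_cone0.
    by rewrite mulf_eq0 (negPf bn) /= => /eqP ->.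
  move: xz; rewrite mulf_eq0 negb_or => /andP[xn zn].
  have x_gt0 : 0 < x by rewrite lt_neqAle eq_sym xn.
  have z_gt0 : 0 < z by rewrite lt_neqAle eq_sym zn.
  rewrite hyperbolic_section // Sc; have m0 : 0 < m x z by rewrite mulr_gt0 ?powR_gt0.
  rewrite ler_pdivrMr // ler_pdivlMr // ler_pM2l //.
  have E : b * (- (a / b) * m x z) = - a * m x z by field.
  by rewrite -(ler_pM2l b0 (- (a / b) * _)) E.
have [aE|an] := eqVneq a 0.
  apply: (classified_mx3 (lbl := HalfPowerCone th^-1 (1 - th)^-1)
    (P := mx3 1 0 0 0 b 0 0 0 1)).
  - exact: hyperbolic_conjugate.
  - by apply: unitmx_diag; rewrite ?oner_eq0.
  move=> x y z; rewrite mx3_vec3 !(mul0r, mul1r, addr0, add0r) mem /=.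
  by rewrite /half_power_cone /= hyperbolic_power_mean !vec3E aE mul0r oppr0 mul0r.
apply: (classified_mx3 (lbl := PowerCone th^-1 (1 - th)^-1 (a / b))
  (P := mx3 1 0 0 0 b 0 0 0 1)).
- split; first exact: hyperbolic_conjugate.
  have a_gt0 : 0 < a by rewrite lt_neqAle eq_sym an.
  by rewrite divr_gt0 //= ler_pdivrMr // mul1r.
- by apply: unitmx_diag; rewrite ?oner_eq0.
move=> x y z; rewrite mx3_vec3 !(mul0r, mul1r, addr0, add0r) mem /=.
by rewrite /power_cone /= hyperbolic_power_mean !vec3E.
Qed.

End Cone.

Lemma hyperbolic_mx_preim K th b : b != 0 ->
  (forall t x y z, K (vec3 x y z) ->
     K (vec3 (expR t * x) (expR (th * t) * y) z)) ->
  forall t x y z, mx_preim (mx3 1 0 0 0 b 0 0 0 1) K (vec3 x y z) ->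
  mx_preim (mx3 1 0 0 0 b 0 0 0 1) K (vec3 (expR t * x) (expR (th * t) * y) z).
Proof.
move=> b0 fl t x y z; rewrite !mx_preim_diag => Kw.
by apply: in_cone_eq (fl t _ _ _ Kw) _ _ _; ring.
Qed.

Lemma hyperbolic_classified K th : proper_cone K -> 0 < th <= 2^-1 ->
  (forall t x y z, K (vec3 x y z) ->
     K (vec3 (expR t * x) (expR (th * t) * y) z)) ->
  classified K.
Proof.
move=> pK /andP[th0 th2] fl.
have th01 : 0 < th < 1.
  by rewrite th0 (le_lt_trans th2) // invf_lt1 // ltr1n.
have N1 : (- 1 : R) != 0 by rewrite oppr_eq0 oner_eq0.
have n1 : (1 : R) != 0 by rewrite oner_eq0.
wlog K1 : K pK fl / K (vec3 1 0 0).
  move=> H; have [|x [y [z [Kv]]]] := in_cone_span pK (a := 1) (b := 0) (c := 0).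
    by rewrite !xpair_eqE oner_eq0.
  rewrite mul1r !mul0r !addr0 => xn.
  have [K1|K1] := in_cone_axis_sign pK xn (hyperbolic_first pK th01 fl Kv).
    exact: (H K).
  have uP := unitmx_diag N1 n1 n1.
  apply: (classified_mx_preim uP); apply: H; first exact: proper_mx_preim.
    move=> t u v w; rewrite !mx_preim_diag => Kw.
    by apply: in_cone_eq (fl t _ _ _ Kw) _ _ _; ring.
  by rewrite mx_preim_diag; apply: in_cone_eq K1 _ _ _; ring.
wlog K3 : K pK fl K1 / K (vec3 0 0 1).
  move=> H; have [|x [y [z [Kv]]]] := in_cone_span pK (a := 0) (b := 0) (c := 1).
    by rewrite !xpair_eqE oner_eq0 !andbF.
  rewrite mul1r !mul0r !add0r => zn.
  have Kz := hyperbolic_third pK th01 fl Kv.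
  have [z0|z0|z0] := ltgtP z 0; last by rewrite z0 eqxx in zn.
    have uP := unitmx_diag n1 n1 N1.
    apply: (classified_mx_preim uP); apply: H; first exact: proper_mx_preim.
    - move=> t u v w; rewrite !mx_preim_diag => Kw.
      by apply: in_cone_eq (fl t _ _ _ Kw) _ _ _; ring.
    - by rewrite mx_preim_diag; apply: in_cone_eq K1 _ _ _; ring.
    rewrite mx_preim_diag; apply: (in_coneZK pK (l := - z)); first by rewrite oppr_gt0.
    by apply: in_cone_eq Kz _ _ _; ring.
  apply: (H K) => //; apply: (in_coneZK pK z0).
  by apply: in_cone_eq Kz _ _ _; ring.
have uN := unitmx_diag n1 N1 n1.
have [K2|KN2] := pselect (K (vec3 0 (- 1) 0)).
  exact: (hyperbolic_unbounded_classified pK th01 fl).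
have [K2|KNN2] := pselect (K (vec3 0 1 0)).
  apply: (classified_mx_preim uN).
  apply: (hyperbolic_unbounded_classified _ th01) => //.
  - exact: proper_mx_preim.
  - exact: hyperbolic_mx_preim.
  - by rewrite mx_preim_diag; apply: in_cone_eq K1 _ _ _; ring.
  - by rewrite mx_preim_diag; apply: in_cone_eq K3 _ _ _; ring.
  - by rewrite mx_preim_diag; apply: in_cone_eq K2 _ _ _; ring.
have [b b0 Hb] := hyperbolic_bound pK th01 fl K1 K3 n1 KNN2.
have [a a0 Ha] := hyperbolic_bound pK th01 fl K1 K3 N1 KN2.
have Sc c : K (vec3 1 c 1) <-> - a <= c <= b.
  have [c0|c0] := leP 0 c.
    rewrite -[c in vec3 _ c _]mul1r Hb // (le_trans _ c0) //.
    by rewrite oppr_le0.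
  have Nc0 : 0 <= - c by rewrite oppr_ge0 ltW.
  have cb : c <= b by rewrite (le_trans (ltW c0)).
  by rewrite -[c in vec3 _ c _]opprK -mulN1r Ha // cb andbT lerNl.
have By y : K (vec3 0 y 0) -> y = 0.
  move=> Ky; have [y0|y0|//] := ltgtP y 0; exfalso.
    apply: KN2; apply: (in_coneZK pK (l := - y)); first by rewrite oppr_gt0.
    by apply: in_cone_eq Ky _ _ _; ring.
  apply: KNN2; apply: (in_coneZK pK y0).
  by apply: in_cone_eq Ky _ _ _; ring.
(* If both ends were [0], the whole cone would lie in the plane [y = 0]. *)
have ab0 : (a != 0) || (b != 0).
  rewrite -negb_and; apply/negP => /andP[/eqP aE /eqP bE].
  have [|x [y [z [Kv]]]] := in_cone_span pK (a := 0) (b := 1) (c := 0).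
    by rewrite !xpair_eqE oner_eq0 !andbF.
  rewrite mul1r !mul0r add0r addr0 => /eqP; apply.
  have [x0 z0] := hyperbolic_ge0 pK th01 fl K1 K3 Kv.
  have [xz|xz] := eqVneq (x * z) 0.
    exact/By/(hyperbolic_second pK th01 fl Kv).
  move: xz; rewrite mulf_eq0 negb_or => /andP[xn zn].
  have x_gt0 : 0 < x by rewrite lt_neqAle eq_sym xn.
  have z_gt0 : 0 < z by rewrite lt_neqAle eq_sym zn.
  move/(hyperbolic_section pK fl _ x_gt0 z_gt0): Kv.
  rewrite Sc aE bE oppr0 -eq_le eq_sym mulf_eq0 invr_eq0 => /orP[/eqP //|].
  by rewrite mulf_eq0 !gt_eqF // powR_gt0.
have [ab|ba] := leP a b.
  apply: (hyperbolic_bounded_classified pK th01 fl K1 K3 th2 _ _ By Sc).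
    by rewrite a0.
  rewrite lt_neqAle b0 andbT; apply: contraTneq ab0 => bE.
  by rewrite negb_or !negbK -bE eqxx andbT eq_le a0 andbT bE.
(* Reflecting the second coordinate exchanges [a] and [b], so that the larger end is the upper
   one. *)
apply: (classified_mx_preim uN).
apply: (@hyperbolic_bounded_classified _ _ th th01 _ _ _ th2 b a) => //.
- exact: proper_mx_preim.
- exact: hyperbolic_mx_preim.
- by rewrite mx_preim_diag; apply: in_cone_eq K1 _ _ _; ring.
- by rewrite mx_preim_diag; apply: in_cone_eq K3 _ _ _; ring.
- by rewrite b0 ltW.
- by rewrite (le_lt_trans b0).
- move=> y; rewrite mx_preim_diag mul1r mulN1r => /By /eqP.
  by rewrite oppr_eq0 => /eqP.
- move=> c; rewrite mx_preim_diag !mul1r mulN1r Sc.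
  by rewrite lerN2 lerNl andbC.
Qed.
End DiagonalDistinct.

(** * Reduction to the normal forms *)

Section NormalFormFlows.
Context {R : realType}.
Implicit Types (K : set 'cV[R]_3) (a b c d e f g h k l m n p q r s t x y z : R).

Lemma flow_in_coords K a b c d e f g h k : flow_in K (mx3 a b c d e f g h k) ->
  forall x y z, K (vec3 x y z) -> exists u v w : R -> R,
  [/\ [/\ u 0 = x, v 0 = y & w 0 = z], forall t, K (vec3 (u t) (v t) (w t)) &
   forall t, [/\ is_derive t (1 : R) u (a * u t + b * v t + c * w t),
     is_derive t (1 : R) v (d * u t + e * v t + f * w t) &
     is_derive t (1 : R) w (g * u t + h * v t + k * w t)]].
Proof.
move=> fl x y z Kv; have [Z [Z0 KZ dZ]] := fl _ Kv.
exists (fun t => Z t 0 0), (fun t => Z t 1 0), (fun t => Z t 2 0); split.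
- by rewrite Z0 !vec3E.
- by move=> t; rewrite -vec3_eta.
- by move=> t; split; [move: (dZ t 0) | move: (dZ t 1) | move: (dZ t 2)];
    rewrite mx_vec !mxE.
Qed.

Lemma derive_cst_unique (u : R -> R) (c : R) :
  (forall t, is_derive t (1 : R) u c) -> forall t, u t = u 0 + c * t.
Proof.
move=> du; apply: (derive_unique_fun du); last by rewrite mulr0 addr0.
by move=> t; exact: derive_affine.
Qed.

Lemma good_hyperbolic th : 0 < th <= 2^-1 -> good (mx3 (1 : R) 0 0 0 th 0 0 0 0).
Proof.
move=> thP K pK fl; apply: (hyperbolic_classified pK thP) => t x y z Kv.
have [u [v [w [[<- <- <-] Kt dt]]]] := flow_in_coords fl Kv.
apply: in_cone_eq (Kt t) _ _ _.
- have du s : is_derive s (1 : R) u (1 * u s).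
    by case: (dt s) => h _ _; apply: is_derive_eq h _; ring.
  by rewrite (derive_exp_unique du) ?mul1r.
- have dv s : is_derive s (1 : R) v (th * v s).
    by case: (dt s) => _ h _; apply: is_derive_eq h _; ring.
  by rewrite (derive_exp_unique dv).
- have dw s : is_derive s (1 : R) w (0 * w s).
    by case: (dt s) => _ _ h; apply: is_derive_eq h _; ring.
  by rewrite (derive_exp_unique dw) ?mul0r ?expR0 ?mul1r.
Qed.

Lemma good_homothety : good (mx3 (1 : R) 0 0 0 0 0 0 0 0).
Proof.
move=> K pK fl; apply: (homothety_classified pK) => t x y z Kv.
have [u [v [w [[<- <- <-] Kt dt]]]] := flow_in_coords fl Kv.
apply: in_cone_eq (Kt t) _ _ _.
- have du s : is_derive s (1 : R) u (1 * u s).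
    by case: (dt s) => h _ _; apply: is_derive_eq h _; ring.
  by rewrite (derive_exp_unique du) ?mul1r.
- have dv s : is_derive s (1 : R) v (0 * v s).
    by case: (dt s) => _ h _; apply: is_derive_eq h _; ring.
  by rewrite (derive_exp_unique dv) ?mul0r ?expR0 ?mul1r.
- have dw s : is_derive s (1 : R) w (0 * w s).
    by case: (dt s) => _ _ h; apply: is_derive_eq h _; ring.
  by rewrite (derive_exp_unique dw) ?mul0r ?expR0 ?mul1r.
Qed.

Lemma good_spiral a : good (mx3 (0 : R) 0 0 0 a 1 0 (- 1) a).
Proof.
move=> K pK fl.
have {}fl t x y z : K (vec3 x y z) ->
    K (vec3 x (expR (a * t) * (cos t * y + sin t * z))
              (expR (a * t) * (cos t * z - sin t * y))).
  move=> Kv; have [u [v [w [[<- <- <-] Kt dt]]]] := flow_in_coords fl Kv.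
  have [||vt wt] := @derive_rotation_unique R v w a _ _ t.
  - by move=> s; case: (dt s) => _ h _; apply: is_derive_eq h _; ring.
  - by move=> s; case: (dt s) => _ _ h; apply: is_derive_eq h _; ring.
  apply: in_cone_eq (Kt t) _ vt wt.
  have du s : is_derive s (1 : R) u (0 * u s).
    by case: (dt s) => h _ _; apply: is_derive_eq h _; ring.
  by rewrite (derive_exp_unique du) ?mul0r ?expR0 ?mul1r.
have [a0|/(no_spiral_flow pK fl) //] := eqVneq a 0.
apply: (rotation_classified pK) => t x y z /(fl t).
by rewrite a0 mul0r expR0 !mul1r.
Qed.

Lemma good_jordan : good (mx3 (0 : R) 0 (1 : R) 0 1 0 0 0 0).
Proof.
move=> K pK fl; apply: (jordan_classified pK) => t x y z Kv.
have [u [v [w [[<- <- <-] Kt dt]]]] := flow_in_coords fl Kv.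
have wE s : w s = w 0.
  have dw r : is_derive r (1 : R) w 0.
    by case: (dt r) => _ _ h; apply: is_derive_eq h _; ring.
  by rewrite (derive_cst_unique dw) ?mul0r ?addr0.
apply: in_cone_eq (Kt t) _ _ (wE t).
- have du s : is_derive s (1 : R) u ((w 0)).
    by case: (dt s) => h _ _; apply: is_derive_eq h _; rewrite wE; ring.
  by rewrite (derive_cst_unique du) 1?mulrC.
- have dv s : is_derive s (1 : R) v (1 * v s).
    by case: (dt s) => _ h _; apply: is_derive_eq h _; ring.
  by rewrite (derive_exp_unique dv) ?mul1r.
Qed.

Lemma good_shear : good (mx3 (0 : R) 0 0 0 0 0 (1 : R) 0 0).
Proof.
move=> K pK fl; exfalso; apply: (no_shear_flow pK) => t x y z Kv.
have [u [v [w [[<- <- <-] Kt dt]]]] := flow_in_coords fl Kv.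
have uE s : u s = u 0.
  have du r : is_derive r (1 : R) u 0.
    by case: (dt r) => h _ _; apply: is_derive_eq h _; ring.
  by rewrite (derive_cst_unique du) ?mul0r ?addr0.
have vE s : v s = v 0.
  have dv r : is_derive r (1 : R) v 0.
    by case: (dt r) => _ h _; apply: is_derive_eq h _; ring.
  by rewrite (derive_cst_unique dv) ?mul0r ?addr0.
apply: in_cone_eq (Kt t) (uE t) (vE t) _.
have dw s : is_derive s (1 : R) w ((u 0)).
  by case: (dt s) => _ _ h; apply: is_derive_eq h _; rewrite uE; ring.
by rewrite (derive_cst_unique dw) 1?mulrC.
Qed.

(** The triangular system is integrated coordinate by coordinate, each solution being the derivative
    of the next. *)
Lemma good_unipotent : good (mx3 (0 : R) 0 0 (1 : R) 0 0 0 1 0).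
Proof.
move=> K pK fl; apply: (unipotent_classified pK) => t x y z Kv.
have [u [v [w [[<- <- <-] Kt dt]]]] := flow_in_coords fl Kv.
have uE s : u s = u 0.
  have du r : is_derive r (1 : R) u 0.
    by case: (dt r) => h _ _; apply: is_derive_eq h _; ring.
  by rewrite (derive_cst_unique du) ?mul0r ?addr0.
have vE s : v s = v 0 + u 0 * s.
  have dv r : is_derive r (1 : R) v ((u 0)).
    by case: (dt r) => _ h _; apply: is_derive_eq h _; rewrite uE; ring.
  by rewrite (derive_cst_unique dv).
apply: in_cone_eq (Kt t) (uE t) _ _; first by rewrite vE; ring.
have dw s : is_derive s (1 : R) w (v 0 + u 0 * s).
  by case: (dt s) => _ _ h; apply: is_derive_eq h _; rewrite vE; ring.
have dg s : is_derive s (1 : R)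
    (fun s => w 0 + v 0 * s + u 0 / 2 * (s * s)) (v 0 + u 0 * s).
  have h := derive_affine s (w 0) (v 0).
  apply: is_derive_eq (deriveD_fun h (deriveZ_fun (u 0 / 2)
    (deriveM_fun (is_derive_id _ _) (is_derive_id _ _)))) _.
  by rewrite /=; field.
by rewrite (derive_unique_fun dw dg); [field | ring].
Qed.
End NormalFormFlows.

(** * Reduction of non-scalar matrices to the normal forms *)

Section LinearAlgebra.
Context {R : realType}.
Implicit Types (a b c d e f g h k l m n p q r s t x y z : R).

Lemma mx3_affine x y a b c d e f g h k :
  x *: mx3 a b c d e f g h k + y%:M =
  mx3 (x * a + y) (x * b) (x * c) (x * d) (x * e + y) (x * f)
      (x * g) (x * h) (x * k + y).
Proof.
rewrite scalar_mx3; apply/matrixP => i j.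
by elim/ord3_ind: i; elim/ord3_ind: j; rewrite !mxE /= ?addr0.
Qed.

Lemma good_swap12 a b c : good (mx3 b 0 0 0 a 0 0 0 c) -> good (mx3 a 0 0 0 b 0 0 0 c).
Proof.
apply: (good_conj (S := mx3 0 1 0 1 0 0 0 0 1)).
  by apply: unitmx3; rewrite !(mul0r, mulr0, mulr1, subr0, addr0, sub0r) oppr_eq0 oner_eq0.
by rewrite !mx3_mul; congr mx3; ring.
Qed.

Lemma good_swap23 a b c : good (mx3 a 0 0 0 c 0 0 0 b) -> good (mx3 a 0 0 0 b 0 0 0 c).
Proof.
apply: (good_conj (S := mx3 1 0 0 0 0 1 0 1 0)).
  by apply: unitmx3; rewrite !(mul0r, mulr0, mulr1, subr0, addr0, sub0r, mul1r) oppr_eq0 oner_eq0.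
by rewrite !mx3_mul; congr mx3; ring.
Qed.

(** The affine map sending [a] to [1] and [c] to [0] sends [b] to [th]. If [th] exceeds [1/2], the
    decreasing map sending [a] to [0] and [c] to [1] gives [1 - th], and the first and third
    coordinates are exchanged. *)
Lemma good_diag_sorted a b c : c < b -> b < a -> good (mx3 a 0 0 0 b 0 0 0 c).
Proof.
move=> cb ba; have ca : 0 < a - c by rewrite subr_gt0 (lt_trans cb).
have can := lt0r_neq0 ca.
set th := (b - c) / (a - c).
have th0 : 0 < th by rewrite divr_gt0 // subr_gt0.
have th1 : 0 < 1 - th.
  by rewrite (_ : 1 - th = (a - b) / (a - c)); [rewrite divr_gt0 // subr_gt0 | rewrite /th; field].
have [th2|th2] := leP th 2^-1.
  apply: (good_affine (a := (a - c)^-1) (c := - c / (a - c))); rewrite mx3_affine.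
  have := good_hyperbolic (th := th); rewrite th0 th2 => /(_ isT).
  by congr (good (mx3 _ _ _ _ _ _ _ _ _)); rewrite /th; field.
apply: (good_affine (a := - (a - c)^-1) (c := a / (a - c))); rewrite mx3_affine !mulr0.
apply: good_swap12; apply: good_swap23; apply: good_swap12.
have th3 : 1 - th <= 2^-1.
  by rewrite lerBlDl -lerBlDr (_ : 1 - 2^-1 = 2^-1) ?ltW //; field.
have := good_hyperbolic (th := 1 - th); rewrite th1 th3 => /(_ isT).
by congr (good (mx3 _ _ _ _ _ _ _ _ _)); rewrite /th; field.
Qed.

Lemma good_diag_distinct a b c : a != b -> b != c -> a != c ->
  good (mx3 a 0 0 0 b 0 0 0 c).
Proof.
wlog ab : a b / b < a.
  move=> H ab bc ac; have [ba|ba|ba] := ltgtP a b; last by rewrite ba eqxx in ab.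
    by apply: good_swap12; apply: H; rewrite // eq_sym.
  exact: H.
move=> _ bc ac; have [cb|cb|cb] := ltgtP b c; last by rewrite cb eqxx in bc.
  apply: good_swap23; have [ca|ca|ca] := ltgtP a c; last by rewrite ca eqxx in ac.
    by apply: good_swap12; apply: good_diag_sorted.
  exact: good_diag_sorted.
exact: good_diag_sorted.
Qed.

Lemma good_double l n a : n != l -> good (mx3 l 0 0 a l 0 0 0 n).
Proof.
move=> nl; have nl0 : n - l != 0 by rewrite subr_eq0.
apply: (good_affine (a := (n - l)^-1) (c := - l / (n - l))); rewrite mx3_affine.
have [->|an] := eqVneq a 0.
  rewrite !mulr0; apply: good_swap23; apply: good_swap12.
  have := good_homothety (R := R).
  by congr (good (mx3 _ _ _ _ _ _ _ _ _)); field.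
(* After normalization the double eigenvalue is [0], the simple one [1], and the off-diagonal entry
   [a / (n - l)]; the new coordinates are [((n - l) y / a, z, x)]. *)
apply: (@good_conj _ (mx3 0 ((n - l) / a) 0 0 0 1 1 0 0) _ _ _ _ good_jordan).
  apply: unitmx3; rewrite (_ : _ + _ = (n - l) / a); last by ring.
  by rewrite mulf_neq0 // invr_eq0.
by rewrite !mx3_mul; congr mx3; field; rewrite ?nl0 ?an.
Qed.

(** The rows of the conjugating matrices are Jordan chains of linear functionals: one row times [J]
    gives another row or zero. The chain has length 3 exactly when [a] and [c] are both nonzero. *)
Lemma good_strictly_triangular a b c : (a, b, c) != (0, 0, 0) ->
  good (mx3 (0 : R) 0 0 a 0 0 b c 0).
Proof.
have [->|an] := eqVneq a 0; have [->|cn] := eqVneq c 0.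
- have [->|bn _] := eqVneq b 0; first by rewrite eqxx.
  apply: (@good_conj _ (mx3 b 0 0 0 1 0 0 0 1) _ _ _ _ good_shear).
    by apply: unitmx_diag; rewrite ?oner_eq0.
  by rewrite !mx3_mul; congr mx3; ring.
- move=> _; apply: (@good_conj _ (mx3 b c 0 1 0 0 0 0 1) _ _ _ _ good_shear).
    by apply: unitmx3; rewrite (_ : _ + _ = - c) ?oppr_eq0 //; ring.
  by rewrite !mx3_mul; congr mx3; ring.
- move=> _; apply: (@good_conj _ (mx3 a 0 0 0 (- (b / a)) 1 0 1 0) _ _ _ _ good_shear).
    by apply: unitmx3; rewrite (_ : _ + _ = - a) ?oppr_eq0 //; ring.
  by rewrite !mx3_mul; congr mx3; field.
- move=> _; apply: (@good_conj _ (mx3 (a * c) 0 0 b c 0 0 0 1) _ _ _ _ good_unipotent).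
    by apply: unitmx3; rewrite (_ : _ + _ = a * c * c) ?mulf_neq0 //; ring.
  by rewrite !mx3_mul; congr mx3; ring.
Qed.

(** The excluded case is that of a scalar matrix. The rows of the conjugating matrices are left
    eigenvectors or generalized ones, so their denominators are differences of distinct eigenvalues;
    a coincidence of two eigenvalues leaves a possible Jordan block for [good_double]. *)
Lemma good_triangular l m n a b c :
  ~ [/\ l = m, m = n & (a, b, c) = (0, 0, 0)] ->
  good (mx3 l 0 0 a m 0 b c n).
Proof.
move=> ns; have [lm|lm] := eqVneq l m; have [mn|mn] := eqVneq m n.
- subst m n; apply: (good_affine (a := 1) (c := - l)); rewrite mx3_affine.
  have := @good_strictly_triangular a b c; case: eqP => [abc|_].
    by exfalso; apply: ns.
  by move=> /(_ isT); congr (good (mx3 _ _ _ _ _ _ _ _ _)); ring.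
- subst m; have ln : n - l != 0 by rewrite subr_eq0 eq_sym.
  set j := c / (n - l).
  apply: (@good_conj _ (mx3 1 0 0 0 1 0 ((j * a + b) / (n - l)) j 1)
    _ _ _ _ (@good_double l n a _)); last by rewrite eq_sym.
    by apply: unitmx3; rewrite (_ : _ + _ = 1) ?oner_eq0 //; ring.
  by rewrite !mx3_mul; congr mx3; rewrite /j; field; rewrite ?ln.
- subst n; have ml : m - l != 0 by rewrite subr_eq0 eq_sym.
  set j := a / (m - l).
  apply: (@good_conj _ (mx3 j 1 0 ((b - c * j) / (m - l)) 0 1 1 0 0)
    _ _ _ _ (@good_double m l c _)); last by [].
    by apply: unitmx3; rewrite (_ : _ + _ = 1) ?oner_eq0 //; ring.
  by rewrite !mx3_mul; congr mx3; rewrite /j; field; rewrite ?ml.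
have ml : m - l != 0 by rewrite subr_eq0 eq_sym.
have nm : n - m != 0 by rewrite subr_eq0 eq_sym.
have [ln|ln] := eqVneq l n.
  subst n; set j := c / (l - m).
  apply: (@good_conj _ (mx3 1 0 0 0 j 1 (a / (m - l)) 1 0)
    _ _ _ _ (@good_double l m (j * a + b) _)); last by rewrite eq_sym.
    by apply: unitmx3; rewrite (_ : _ + _ = - 1) ?oppr_eq0 ?oner_eq0 //; ring.
  by rewrite !mx3_mul; congr mx3; rewrite /j; field; rewrite ?ml ?nm.
have nl : n - l != 0 by rewrite subr_eq0 eq_sym.
set j := c / (n - m).
apply: (@good_conj _ (mx3 1 0 0 (a / (m - l)) 1 0 ((j * a + b) / (n - l)) j 1)
  _ _ _ _ (@good_diag_distinct l m n _ _ _)) => //.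
  by apply: unitmx3; rewrite (_ : _ + _ = 1) ?oner_eq0 //; ring.
by rewrite !mx3_mul; congr mx3; rewrite /j; field; rewrite ?ml ?nm ?nl.
Qed.

(** The block has trace [2 m] and determinant [m^2 + n^2], hence eigenvalues [m] plus or minus
    [i n]; division by [n] gives unit angular speed. The numbers [al] and [be] solve the system of
    the block with right-hand side [(a, b)], which decouples the axis. *)
Lemma good_complex p q m n a b : q != 0 -> n != 0 ->
  good (mx3 (0 : R) 0 0 a p q b (- (n ^+ 2 + (p - m) ^+ 2) / q) (2 * m - p)).
Proof.
move=> qn nn.
have dn : m ^+ 2 + n ^+ 2 != 0.
  by rewrite paddr_eq0 ?sqr_ge0 // negb_and !sqrf_eq0 nn orbT.
apply: (good_affine (a := n^-1) (c := 0)); rewrite mx3_affine.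
set r := - (n ^+ 2 + (p - m) ^+ 2) / q.
set al := (a * (2 * m - p) - b * q) / (m ^+ 2 + n ^+ 2).
set be := (p * b - r * a) / (m ^+ 2 + n ^+ 2).
apply: (@good_conj _ (mx3 1 0 0 al 1 0 (((p - m) * al + q * be) / n) ((p - m) / n) (q / n))
  _ _ _ _ (@good_spiral _ (m / n))).
  apply: unitmx3; rewrite !(mul0r, mul1r, subr0, addr0).
  by rewrite mulf_neq0 // invr_eq0.
by rewrite !mx3_mul; congr mx3; rewrite /be /al /r; field; rewrite ?qn ?nn ?dn.
Qed.
End LinearAlgebra.

Section Nonscalar.
Context {R : realType}.
Implicit Types (a b c l m n p q r s t x y z : R) (J : 'M[R]_3).

(** The discriminant of the lower block decides. If it is negative, the half trace and [n] are the
    real and imaginary parts of its eigenvalues; otherwise the matrix is conjugate to a triangular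
    one. *)
Lemma good_block l a p q b r s :
  (forall c, mx3 l 0 0 a p q b r s <> c%:M) -> good (mx3 l 0 0 a p q b r s).
Proof.
move=> ns; pose disc := (p - s) ^+ 2 + 4 * q * r.
have [disc0|disc0] := leP 0 disc; last first.
  have qn : q != 0.
    apply: contraTneq disc0 => q0.
    by rewrite /disc q0 mulr0 mul0r addr0 -leNgt sqr_ge0.
  pose n := Num.sqrt (- disc) / 2.
  have nn : n != 0.
    by rewrite mulf_neq0 ?invr_eq0 ?pnatr_eq0 // sqrtr_eq0 -ltNge oppr_gt0.
  have n2 : 4 * n ^+ 2 = - disc.
    rewrite /n expr_div_n sqr_sqrtr; first by field.
    by rewrite oppr_ge0 ltW.
  apply: (good_affine (a := 1) (c := - l)); rewrite mx3_affine.
  have := @good_complex R (p - l) q ((p + s) / 2 - l) n a b qn nn.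
  congr (good (mx3 _ _ _ _ _ _ _ _ _)); try by field.
  rewrite mul1r; apply: (mulIf qn); rewrite divfK //.
  apply: (mulIf (_ : (4 : R) != 0)); first by rewrite pnatr_eq0.
  transitivity (- (4 * n ^+ 2) - (p - s) ^+ 2); first by field.
  by rewrite n2 /disc; ring.
have [r0|rn] := eqVneq r 0.
  rewrite {}r0 in ns disc disc0 *.
  apply: (@good_conj _ (mx3 1 0 0 0 0 1 0 1 0) _ (mx3 l 0 0 b s 0 a q p)).
  - by apply: unitmx3; rewrite !(mul0r, mulr0, mul1r, subr0, addr0, sub0r) oppr_eq0 oner_eq0.
  - by rewrite !mx3_mul; congr mx3; ring.
  apply: good_triangular => -[lsE spE [bE aE qE]].
  by apply: (ns l); rewrite scalar_mx3 bE aE qE -spE -lsE.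
(* With the eigenvalue [m], the row [(r, m - p)] is a left eigenvector of the block. The third row
   then has entry [1] below the diagonal, so the triangular matrix is not scalar. *)
pose m := (p + s + Num.sqrt disc) / 2.
have m2 : (m - p) * (m - s) = q * r.
  have d2 : Num.sqrt disc ^+ 2 = disc by rewrite sqr_sqrtr.
  transitivity ((Num.sqrt disc ^+ 2 - (p - s) ^+ 2) / 4); first by rewrite /m; field.
  by rewrite d2 /disc; field.
apply: (@good_conj _ (mx3 1 0 0 0 r (m - p) 0 0 1) _
  (mx3 l 0 0 (r * a + (m - p) * b) m 0 b 1 (s + p - m))).
- by apply: unitmx3; rewrite !(mul0r, mulr0, mul1r, subr0, addr0, sub0r, mulr1).
- rewrite !mx3_mul; congr mx3; try by ring.
  transitivity (q * r + (m - p) * s); first by ring.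
  by rewrite -m2; ring.
by apply: good_triangular => -[_ _ []] _ _ /eqP; rewrite oner_eq0.
Qed.

Lemma monic_cubic_root (f : {poly R}) : f \is monic -> size f = 4 ->
  exists x, root f x.
Proof.
move=> fm sf; set a := f`_2; set b := f`_1; set c := f`_0.
have fE x : f.[x] = x ^+ 3 + a * x ^+ 2 + b * x + c.
  rewrite horner_coef sf !big_ord_recl big_ord0 /= /bump /=.
  have -> : f`_3 = 1 by have /monicP := fm; rewrite /lead_coef sf.
  by rewrite /a /b /c; ring.
(* Writing [M^3] as [M] times [M^2] yields a term that absorbs each lower coefficient, so [f]
   changes sign between [- M] and [M]. *)
pose M := 1 + `|a| + `|b| + `|c|.
have M1 : 1 <= M by rewrite /M -!addrA lerDl !addr_ge0.
have [a1 a2] : - `|a| <= a /\ a <= `|a| by split; [exact: lerNnormlW | exact: ler_norm].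
have [b1 b2] : - `|b| <= b /\ b <= `|b| by split; [exact: lerNnormlW | exact: ler_norm].
have [c1 c2] : - `|c| <= c /\ c <= `|c| by split; [exact: lerNnormlW | exact: ler_norm].
have M2 : M <= M ^+ 2 by rewrite expr2 ler_peMl // (le_trans ler01).
have MM1 : 1 <= M ^+ 2 by rewrite (le_trans M1).
have M0 : 0 <= M ^+ 2 by rewrite (le_trans ler01).
have aM : 0 <= (`|a| + a) * M ^+ 2 /\ 0 <= (`|a| - a) * M ^+ 2.
  by split; apply: mulr_ge0; rewrite // ?subr_ge0 // -lerBlDl sub0r.
have bM : 0 <= `|b| * M ^+ 2 + b * M.
  have h1 : `|b| * M <= `|b| * M ^+ 2 by rewrite ler_wpM2l.
  have h2 : - `|b| * M <= b * M by rewrite ler_wpM2r // (le_trans ler01).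
  by rewrite (le_trans _ (lerD h1 h2)) // mulNr subrr.
have cM : `|c| <= `|c| * M ^+ 2 by rewrite ler_peMr.
have fM : 0 <= f.[M].
  rewrite fE; have -> : M ^+ 3 + a * M ^+ 2 + b * M + c =
      M ^+ 2 + (`|a| + a) * M ^+ 2 + (`|b| * M ^+ 2 + b * M) + (`|c| * M ^+ 2 + c).
    by rewrite exprS {1}/M; ring.
  move: (lerD cM c1); rewrite subrr => cM'.
  by case: aM => aM _; do 3 apply: addr_ge0 => //.
have fN : f.[- M] <= 0.
  rewrite fE -oppr_ge0; have -> : - ((- M) ^+ 3 + a * (- M) ^+ 2 + b * - M + c) =
      M ^+ 2 + (`|a| - a) * M ^+ 2 + (`|b| * M ^+ 2 + b * M) + (`|c| * M ^+ 2 - c).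
    have M3 : M ^+ 3 = (1 + `|a| + `|b| + `|c|) * M ^+ 2 by rewrite exprS {1}/M.
    transitivity (M ^+ 3 - a * M ^+ 2 + b * M - c); first by ring.
    by rewrite M3; ring.
  have cM' : 0 <= `|c| * M ^+ 2 - c by rewrite subr_ge0 (le_trans c2).
  by case: aM => _ aM; do 3 apply: addr_ge0 => //.
have NM : - M <= M by rewrite (le_trans (y := 0)) ?oppr_le0 // (le_trans ler01).
have [|x _ fx] := @poly_ivt R f (- M) M NM; last by exists x.
by rewrite fN fM.
Qed.

Lemma row_to_first (u : 'rV[R]_3) : u != 0 ->
  exists2 S : 'M[R]_3, S \in unitmx & row 0 S = u.
Proof.
move=> u0.
have uE : u = row3 (u 0 0) (u 0 1) (u 0 2).
  by apply/rowP => i; elim/ord3_ind: i; rewrite !mxE.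
have rE a b c d e f g h k : row 0 (mx3 a b c d e f g h k) = row3 a b c.
  by apply/rowP => i; rewrite !mxE.
have [a0|an] := eqVneq (u 0 0) 0; last first.
  exists (mx3 (u 0 0) (u 0 1) (u 0 2) 0 1 0 0 0 1); rewrite ?rE //.
  by apply: unitmx3; rewrite !(mul0r, mulr0, mul1r, oppr0, subr0, addr0, sub0r, mulr1).
have [b0|bn] := eqVneq (u 0 1) 0; last first.
  exists (mx3 (u 0 0) (u 0 1) (u 0 2) 1 0 0 0 0 1); rewrite ?rE //.
  by apply: unitmx3; rewrite !(mul0r, mulr0, mul1r, oppr0, subr0, addr0, sub0r, mulr1) oppr_eq0.
have cn : u 0 2 != 0.
  apply: contra_neq u0 => c0; rewrite uE a0 b0 c0.
  by apply/rowP => i; elim/ord3_ind: i; rewrite !mxE.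
exists (mx3 (u 0 0) (u 0 1) (u 0 2) 1 0 0 0 1 0); rewrite ?rE //.
by apply: unitmx3; rewrite !(mul0r, mulr0, mul1r, oppr0, subr0, addr0, sub0r, mulr1, add0r).
Qed.

(** The characteristic polynomial is a real cubic, so there is a left eigenvector; taken as the
    first row of [S], it makes the first row of the conjugate a multiple of [(1, 0, 0)]. *)
Lemma good_nonscalar J : (forall c, J <> c%:M) -> good J.
Proof.
move=> ns.
have [||l] := @monic_cubic_root (char_poly J).
- exact: char_poly_monic.
- by rewrite size_char_poly.
rewrite -eigenvalue_root_char => /eigenvalueP [u uJ u0].
have [S uS Su] := row_to_first u0.
apply: (@good_conj _ S _ (S *m J *m invmx S)) => //.
  by rewrite mulmxKV.
set J' := S *m J *m invmx S.
have J'ns c : J' <> c%:M.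
  move=> J'E; apply: (ns c).
  have : invmx S *m J' *m S = J by rewrite /J' -!mulmxA mulVmx // mulmx1 mulKmx.
  by move=> <-; rewrite J'E mul_mx_scalar -scalemxAl mulVmx // scalemx1.
have rJ' : row 0 J' = l *: delta_mx 0 0.
  by rewrite /J' !row_mul Su uJ -scalemxAl -Su -row_mul mulmxV // row1.
have e i : J' 0 i = l * (i == 0)%:R.
  by have /rowP /(_ i) := rJ'; rewrite !mxE /=.
have := J'ns; rewrite (mx3_eta J') !e /= mulr1 !mulr0.
exact: good_block.
Qed.

End Nonscalar.

(** * The matrix exponential *)

Section ExponentialSeries.
Context {R : realType}.
Implicit Types (a : nat -> R) (B C t x : R).

(** The exponential generating function of [a]. The entries of [exp(tX)] have this form with [a] the
    entries of the powers of [X], and differentiation is the shift of [a]. *)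
Definition egf a x := limn (pseries (fun k => a k / k`!%:R) x).

Definition exp_bounded a := exists C B, forall k, `|a k| <= C * B ^+ k.

Lemma exp_bounded_shift a : exp_bounded a -> exp_bounded (fun k => a k.+1).
Proof.
by move=> [C [B aB]]; exists (C * B), B => k; rewrite -mulrA -exprS.
Qed.

Lemma is_cvg_egf a x : exp_bounded a -> cvgn (pseries (fun k => a k / k`!%:R) x).
Proof.
move=> [C [B aB]]; apply: normed_cvg; rewrite /=.
(* Comparison with an exponential series; absolute values appear since [C] and [B] carry no sign. *)
have cE : cvgn (series (`|C| *: exp_coeff (`|B| * `|x|))).
  exact/is_cvg_seriesZ/is_cvg_series_exp_coeff.
have pE k : 0 <= (`|C| *: exp_coeff (`|B| * `|x|)) k.
  apply: mulr_ge0 => //; rewrite /exp_coeff /=.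
  by rewrite divr_ge0 // exprn_ge0 // mulr_ge0.
apply: series_le_cvg cE => [k|//|k]; first by rewrite /= normr_ge0.
have ak : `|a k| <= `|C| * `|B| ^+ k.
  by rewrite (le_trans (aB k)) // (le_trans (ler_norm _)) // normrM normrX.
rewrite [leLHS](_ : _ = `|a k| * (`|x| ^+ k / k`!%:R)); last first.
  by rewrite /= !normrM normrX normfV (@ger0_norm _ k`!%:R) //; ring.
rewrite [leRHS](_ : _ = `|C| * `|B| ^+ k * (`|x| ^+ k / k`!%:R)); last first.
  transitivity (`|C| * ((`|B| * `|x|) ^+ k / k`!%:R)) => //.
  by rewrite exprMn; ring.
by rewrite ler_wpM2r // divr_ge0 // exprn_ge0.
Qed.

Lemma egf0 a : exp_bounded a -> egf a 0 = a 0%N.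
Proof.
move=> ba; apply/cvg_lim => //; rewrite -cvg_shiftS.
rewrite (_ : [sequence _]_n = fun _ => a 0%N); first exact: cvg_cst.
apply/funext => n /=; rewrite /pseries /series /= big_nat_recl // big1 ?addr0.
  by rewrite expr0 mulr1 fact0 divr1.
by move=> i _; rewrite expr0n mulr0.
Qed.

Lemma derive_egf a t : exp_bounded a ->
  is_derive t (1 : R) (egf a) (egf (fun k => a k.+1) t).
Proof.
move=> ba; have ba1 := exp_bounded_shift ba; have ba2 := exp_bounded_shift ba1.
have dE b : pseries_diffs (fun k => b k / k`!%:R) = fun k => b k.+1 / k`!%:R :> R.
  apply/funext => k; rewrite /pseries_diffs factS natrM.
  by field; rewrite nat1r !pnatr_eq0 -!lt0n fact_gt0.
(* Termwise differentiation at [t] requires convergence at a point of larger modulus, here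
   [|t| + 1]. *)
have := @pseries_snd_diffs R (fun k => a k / k`!%:R) (`|t| + 1) t.
rewrite !dE; apply; try exact: is_cvg_egf.
by rewrite [X in _ < X]ger0_norm ?addr_ge0 // ltrDl.
Qed.

Lemma egf_linear3 (c0 c1 c2 : R) a0 a1 a2 x :
  exp_bounded a0 -> exp_bounded a1 -> exp_bounded a2 ->
  egf (fun k => c0 * a0 k + c1 * a1 k + c2 * a2 k) x =
  c0 * egf a0 x + c1 * egf a1 x + c2 * egf a2 x.
Proof.
move=> b0 b1 b2; apply/cvg_lim => //.
have cv a : exp_bounded a -> pseries (fun k => a k / k`!%:R) x @ \oo --> egf a x.
  by move=> ba; exact: is_cvg_egf.
have -> : pseries (fun k => (c0 * a0 k + c1 * a1 k + c2 * a2 k) / k`!%:R) x =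
  fun n => c0 * pseries (fun k => a0 k / k`!%:R) x n
         + c1 * pseries (fun k => a1 k / k`!%:R) x n
         + c2 * pseries (fun k => a2 k / k`!%:R) x n.
  apply/funext => n; rewrite /pseries /series /= !mulr_sumr -!big_split /=.
  by apply: eq_bigr => i _; ring.
by apply: cvgD; [apply: cvgD|]; apply: cvgMl_tmp; exact: cv.
Qed.
End ExponentialSeries.

Section MatrixExponential.
Context {R : realType}.
Implicit Types (X : 'M[R]_3) (K : set 'cV[R]_3) (t : R).

(** The sum [B] of the absolute values of all entries bounds every row sum, so each multiplication
    by [X] costs at most a factor [B]. *)
Lemma exp_bounded_mx X i j : exp_bounded (fun k => (X ^+ k) i j).
Proof.
pose B := \sum_i \sum_j `|X i j|.
have B0 : 0 <= B by do 2 apply: sumr_ge0 => ? _.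
exists 1, B => k; rewrite mul1r; elim: k i j => [|k IHk] i j.
  by rewrite !expr0 mxE; case: (i == j); rewrite ?normr1 ?normr0.
rewrite !exprS -mulmxE mxE (le_trans (ler_norm_sum _ _ _)) //.
apply: (@le_trans _ _ (\sum_l `|X i l| * B ^+ k)).
  by apply: ler_sum => l _; rewrite normrM ler_wpM2l.
rewrite -mulr_suml ler_wpM2r ?exprn_ge0 //.
rewrite /B [leRHS](bigD1 i) //= lerDl.
by do 2 apply: sumr_ge0 => ? _.
Qed.

Lemma expmxE X t i j : expmx (t *: X) i j = egf (fun k => (X ^+ k) i j) t.
Proof.
rewrite /expmx; set s := series _.
have tX k : (t *: X) ^+ k = t ^+ k *: X ^+ k.
  elim: k => [|k IHk]; first by rewrite !expr0 scale1r.
  by rewrite !exprS IHk -!mulmxE -scalemxAl -scalemxAr scalerA.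
suff cs : s @ \oo --> (\matrix_(i, j) egf (fun k => (X ^+ k) i j) t : 'M[R]_3).
  by rewrite (cvg_lim _ cs) // mxE.
apply: cvg_mx => {}i {}j; rewrite mxE.
have := @is_cvg_egf _ _ t (exp_bounded_mx X i j).
rewrite (_ : (fun n => s n i j) = pseries (fun k => (X ^+ k) i j / k`!%:R) t) //.
apply/funext => n; rewrite /s /pseries /series /= summxE.
by apply: eq_bigr => k _; rewrite tX !mxE; ring.
Qed.

Lemma expmx0 X : expmx (0 *: X) = 1%:M.
Proof.
by apply/matrixP => i j; rewrite expmxE egf0 ?expr0 //; exact: exp_bounded_mx.
Qed.

Lemma derive_expmx X (v : 'cV[R]_3) t i : is_derive t (1 : R)
  (fun s => (expmx (s *: X) *m v) i 0) ((X *m (expmx (t *: X) *m v)) i 0 : R).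
Proof.
have d l j : is_derive t (1 : R) (fun s => expmx (s *: X) l j)
    ((X *m expmx (t *: X)) l j).
  under eq_fun do rewrite expmxE.
  have := @derive_egf _ _ t (exp_bounded_mx X l j); congr (is_derive _ _ _ _).
  rewrite mxE sum3 !expmxE -egf_linear3; try exact: exp_bounded_mx.
  by congr (egf _ _); apply/funext => k; rewrite exprS -mulmxE mxE sum3.
under eq_fun do rewrite mx_vec.
rewrite mulmxA mx_vec.
have h j := deriveM_fun (d i j) (is_derive_cst (v j 0) t 1).
apply: is_derive_eq (deriveD_fun (deriveD_fun (h 0) (h 1)) (h 2)) _.
by rewrite /cst /=; ring.
Qed.

Lemma flow_in_lie_algebra K X : lie_algebra (Aut_cone K) X -> flow_in K X.
Proof.
move=> AX v Kv; exists (fun t => expmx (t *: X) *m v); split.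
- by rewrite expmx0 mul1mx.
- by move=> t; have [_ <-] := AX t; exists v.
- by move=> t i; exact: derive_expmx.
Qed.

(** A maximum at least [2] is attained or exceeded by a free family of that size; were all its
    members scalar, they would span at most the line of the identity. *)
Lemma lie_dim_nonscalar (G : set 'M[R]_3) : (2 <= lie_dim G)%N ->
  exists2 X, lie_algebra G X & forall c, X <> c%:M.
Proof.
move=> dG; have [d [d2 [s [fs Gs]]]] : exists d : nat, (1 < d)%N /\
    exists s : d.-tuple 'M[R]_3, free s /\ forall i, lie_algebra G (tnth s i).
  apply: contrapT => nd; move: dG; rewrite leqNgt => /negP; apply.
  rewrite ltnS; apply/bigmax_leqP => d /asboolP sd.
  by rewrite leqNgt; apply/negP => d1; apply: nd; exists d.
apply: contrapT => ns.
have sub : (span s <= <[1%:M : 'M[R]_3]>)%VS.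
  apply/span_subvP => X /tnthP [i ->].
  have [c ->] : exists c, tnth s i = c%:M.
    apply: contrapT => nc; apply: ns; exists (tnth s i) => // c cE.
    by apply: nc; exists c.
  by apply/vlineP; exists c; rewrite scalemx1.
have := dimvS sub; rewrite dim_vline.
have -> : \dim (span s) = d by move: fs; rewrite /free size_tuple => /eqP.
by case: (_ == _) => //=; rewrite leqNgt; move: d2; case: (d) => [|[]].
Qed.

Lemma classified_existence K : regular_cone K -> (2 <= lie_dim (Aut_cone K))%N ->
  classified K.
Proof.
move=> rK /lie_dim_nonscalar [X AX ns].
exact: good_nonscalar ns _ (regular_proper rK) (flow_in_lie_algebra AX).
Qed.
End MatrixExponential.

(** * Lyapunov-like matrices *)

Section ExponentialIndependence.
Context {R : realType}.

(* Restricting to [s : nat], the hypothesis says that [\sum_i c_i P(e^{a_i}) = 0]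
   for all polynomials [P]; choose [P] vanishing at all nodes but one. *)
Lemma exp_independent (a c : seq R) : uniq a ->
  (forall s : R, \sum_(i < size a) c`_i * expR (a`_i * s) = 0) ->
  forall i : nat, (i < size a)%N -> c`_i = 0.
Proof.
move=> ua sum0 i0 i0a; pose x (i : 'I_(size a)) := expR a`_i.
have sumP (P : {poly R}) : \sum_(i < size a) c`_i * P.[x i] = 0.
  under eq_bigr do rewrite horner_coef mulr_sumr.
  rewrite exchange_big /= big1 // => k _.
  transitivity (P`_k * \sum_(i < size a) c`_i * expR (a`_i * k%:R)).
    rewrite mulr_sumr; apply: eq_bigr => i _.
    by rewrite expRM_natr; ring.
  by rewrite sum0 mulr0.
pose j := Ordinal i0a.
have := sumP (\prod_(i < size a | i != j) ('X - (x i)%:P)).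
rewrite (bigD1 j) //= [X in _ + X]big1 ?addr0; last first.
  by move=> i ij; rewrite horner_prod (bigD1 i) //= !hornerXsubC subrr mul0r mulr0.
move/eqP; rewrite mulf_eq0 => /orP[/eqP //|].
rewrite horner_prod prodf_seq_eq0 => /hasP[i _ /andP[ij]].
rewrite !hornerE subr_eq0 => /eqP /expR_inj /eqP.
by rewrite nth_uniq // eq_sym => /eqP aij; rewrite -val_eqE /= aij eqxx in ij.
Qed.
End ExponentialIndependence.

Section Lyapunov.
Context {R : realType}.
Implicit Types (K L : set 'cV[R]_3) (X T : 'M[R]_3) (f : 'rV[R]_3) (x v : 'cV[R]_3).

Definition nonneg_on K f := forall x, K x -> 0 <= (f *m x) 0 0.

(** Geometrically, [X x] lies in every supporting plane of the cone at [x]. *)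
Definition lyapunov_like K X := forall f x, nonneg_on K f -> K x ->
  (f *m x) 0 0 = 0 -> (f *m (X *m x)) 0 0 = 0.

Lemma lyapunov_conj K L T X : T \in unitmx -> (forall x, L (T *m x) <-> K x) ->
  lyapunov_like L X -> lyapunov_like K (invmx T *m X *m T).
Proof.
move=> uT TK LX f x f0 Kx fx.
have := LX (f *m invmx T) (T *m x); rewrite !mulmxA mulmxKV // => -> //.
  by move=> y Ly; rewrite -mulmxA; apply: f0; apply/TK; rewrite mulKVmx.
exact/TK.
Qed.

(** Along the integral curve through [x], the functional is nonnegative and vanishes at time [0], so
    its derivative there is zero. *)
Lemma flow_in_lyapunov K X : flow_in K X -> lyapunov_like K X.
Proof.
move=> fl f x f0 Kx fx; have [z [z0 Kz dz]] := fl _ Kx.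
pose g := fun t => f 0 0 * z t 0 0 + f 0 1 * z t 1 0 + f 0 2 * z t 2 0.
have dg t : is_derive t (1 : R) g ((f *m (X *m z t)) 0 0).
  rewrite row_vec.
  exact: (deriveD_fun (deriveD_fun (deriveZ_fun _ (dz t 0))
    (deriveZ_fun _ (dz t 1))) (deriveZ_fun _ (dz t 2))).
rewrite -[x]z0; apply: (derive_ge0_at_0 (dg 0)).
- by move=> t; case: (dg t).
- by move=> t; rewrite /g -row_vec; exact: f0.
- by rewrite /g -row_vec z0.
Qed.

End Lyapunov.

(** * Generators of flows on the orthant, the exponential cone and the Lorentz cone *)

Section LyapunovExamples.
Context {R : realType}.
Implicit Types (K : set 'cV[R]_3) (a b c d e f g h k t x y z : R).

Lemma flow_in_explicit K a b c d e f g h k (u v w : R -> R -> R -> R -> R) :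
  (forall t x y z, K (vec3 x y z) -> K (vec3 (u x y z t) (v x y z t) (w x y z t))) ->
  (forall x y z, [/\ u x y z 0 = x, v x y z 0 = y & w x y z 0 = z]) ->
  (forall x y z t,
    [/\ is_derive t (1 : R) (u x y z) (a * u x y z t + b * v x y z t + c * w x y z t),
    is_derive t (1 : R) (v x y z) (d * u x y z t + e * v x y z t + f * w x y z t) &
    is_derive t (1 : R) (w x y z) (g * u x y z t + h * v x y z t + k * w x y z t)]) ->
  flow_in K (mx3 a b c d e f g h k).
Proof.
move=> fl i0 dv V; rewrite (vec3_eta V).
move: (V 0 0) (V 1 0) (V 2 0) => x y z Kv.
exists (fun t => vec3 (u x y z t) (v x y z t) (w x y z t)); split.
- by case: (i0 x y z) => -> -> ->.
- by move=> t; exact: fl.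
- move=> t i; have [du dv' dw] := dv x y z t; rewrite mx3_vec3.
  by elim/ord3_ind: i; rewrite vec3E; under eq_fun do rewrite vec3E.
Qed.

Lemma lyapunov_orthant : lyapunov_like (orthant R) (mx3 1 0 0 0 0 0 0 0 0).
Proof.
apply/flow_in_lyapunov/(@flow_in_explicit _ _ _ _ _ _ _ _ _ _
  (fun x y z t => expR (1 * t) * x) (fun x y z t => y) (fun x y z t => z)).
- move=> t x y z h i.
  by elim/ord3_ind: i; [have := h 0 | have := h 1 | have := h 2]; rewrite !vec3E //;
    apply: mulr_ge0; rewrite expR_ge0.
- by move=> x y z; rewrite mulr0 expR0 mul1r.
- move=> x y z t; split.
  + apply: is_derive_eq (deriveM_fun (derive_exp t 1) (is_derive_cst x t 1)) _.
    by rewrite /cst /=; ring.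
  + by apply: is_derive_eq (is_derive_cst y t 1) _; ring.
  + by apply: is_derive_eq (is_derive_cst z t 1) _; ring.
Qed.

Lemma lyapunov_exp_cone : lyapunov_like (exp_cone R) (mx3 0 0 1 0 1 0 0 0 0).
Proof.
apply/flow_in_lyapunov/(@flow_in_explicit _ _ _ _ _ _ _ _ _ _
  (fun x y z t => x + z * t) (fun x y z t => expR (1 * t) * y) (fun x y z t => z)).
- move=> t x y z; rewrite /exp_cone /setU /= !vec3E mul1r => -[[x0 y0 ->]|[xyz z0]].
    by left; rewrite mul0r addr0 mulr_ge0 ?expR_ge0.
  right; split=> //; rewrite mulrDl [z * t]mulrC mulfK ?gt_eqF // expRD -mulrA mulrC.
  by rewrite ler_pM2l ?expR_gt0.
- by move=> x y z; rewrite !mulr0 expR0 mul1r addr0.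
- move=> x y z t; split.
  + by apply: is_derive_eq (derive_affine t x z) _; ring.
  + apply: is_derive_eq (deriveM_fun (derive_exp t 1) (is_derive_cst y t 1)) _.
    by rewrite /cst /=; ring.
  + by apply: is_derive_eq (is_derive_cst z t 1) _; ring.
Qed.

(** A parabolic flow, which leaves the form [x z - y^2] invariant; its generator is nilpotent of
    order 3. *)
Lemma lyapunov_lorentz :
  lyapunov_like (cone_of (PowerCone 2 2 (1 : R))) (mx3 0 0 0 1 0 0 0 2 0).
Proof.
apply/flow_in_lyapunov/(@flow_in_explicit _ _ _ _ _ _ _ _ _ _
  (fun x y z t => x) (fun x y z t => y + x * t)
  (fun x y z t => (z + 2 * y * t) + x * (t * t))).
- move=> t x y z; rewrite !lorentz_memE => -[x0 z0 xyz].
  have h : (y + x * t) ^+ 2 <= x * (z + 2 * y * t + x * (t * t)).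
    rewrite -subr_ge0 (_ : _ - _ = x * z - y ^+ 2); last by ring.
    by rewrite subr_ge0.
  split=> //; have [x_gt0|x_le0] := ltP 0 x.
    by rewrite -(pmulr_rge0 _ x_gt0) (le_trans _ h) // sqr_ge0.
  have xE : x = 0 by apply/eqP; rewrite eq_le x_le0.
  move: xyz; rewrite xE mul0r => y0.
  have : y ^+ 2 == 0 by rewrite eq_le y0 sqr_ge0.
  by rewrite sqrf_eq0 => /eqP ->; rewrite mulr0 !mul0r !addr0.
- by move=> x y z; rewrite !mulr0 !addr0.
- move=> x y z t; split.
  + by apply: is_derive_eq (is_derive_cst x t 1) _; ring.
  + by apply: is_derive_eq (derive_affine t y x) _; ring.
  + apply: is_derive_eq (deriveD_fun (derive_affine t z (2 * y)) (deriveZ_fun x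
      (deriveM_fun (is_derive_id _ _) (is_derive_id _ _)))) _.
    by rewrite /=; ring.
Qed.
End LyapunovExamples.

(** * Lyapunov-like matrices on the cones of types 3, 4 and 5 *)

Section PowerType.
Context {R : realType}.
Implicit Types (c : cone_label R) (X : 'M[R]_3) (a k m p q s t u x y z : R).

(** The three families share their upper boundary, which is all that the next arguments see, so they
    are treated together. *)
Definition power_type c p q : Prop :=
  match c with
  | PowerHypograph p' q' | HalfPowerCone p' q' | PowerCone p' q' _ =>
    p' = p /\ q' = q
  | _ => False
  end.

(* The section of the cone at a point [(x, z)] with [m = x^{1/p} z^{1/q}]. *)
Definition power_section c m y : Prop :=
  match c with
  | PowerHypograph _ _ => y <= m
  | HalfPowerCone _ _ => 0 <= y <= m
  | PowerCone _ _ a => - a * m <= y <= m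
  | _ => False
  end.

Local Notation mean p q x z := (x `^ p^-1 * z `^ q^-1).

Lemma power_memE c p q x y z : power_type c p q ->
  cone_of c (vec3 x y z) <->
  [/\ 0 <= x, 0 <= z & power_section c (mean p q x z) y].
Proof.
case: c => [||p' q'|p' q' a|p' q'] //= [-> ->];
  rewrite ?/power_hypograph ?/power_cone ?/half_power_cone /= /power_mean !vec3E;
  by split=> -[].
Qed.

Lemma power_sectionZ c k m y : 0 < k ->
  power_section c (k * m) (k * y) <-> power_section c m y.
Proof.
move=> k0; case: c => [||p' q'|p' q' a|p' q'] //=.
- by rewrite ler_pM2l.
- by rewrite (_ : - a * (k * m) = k * (- a * m)) ?ler_pM2l //; ring.
- by rewrite pmulr_rge0 // ler_pM2l.
Qed.

Lemma power_section_le c m y : power_section c m y -> y <= m.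
Proof. by case: c => [||p' q'|p' q' a|p' q'] //= /andP[]. Qed.

Lemma power_section_top c m : admissible c -> 0 <= m -> forall p q,
  power_type c p q -> power_section c m m.
Proof.
case: c => [||p' q'|p' q' a|p' q'] //= ac m0 p q _; rewrite lexx ?m0 //.
case: ac => _ /andP[a0 _]; rewrite andbT mulNr (le_trans _ m0) // oppr_le0.
by rewrite mulr_ge0 // ltW.
Qed.

Lemma power_type_conjugate c p q : admissible c -> power_type c p q ->
  conjugate_exponents p q.
Proof. by case: c => [||p' q'|p' q' a|p' q'] //= + [<- <-] => [|[]|]. Qed.

Lemma conjugate_bounds p q : conjugate_exponents p q ->
  [/\ 0 < p, 0 < q, 1 < q, q <= 2 & (q = 2 -> p = 2)].
Proof.
move=> [p2 pq]; have p0 : 0 < p by rewrite (lt_le_trans _ p2).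
have ip0 : 0 < p^-1 by rewrite invr_gt0.
have ip2 : p^-1 <= 2^-1 by rewrite lef_pV2 ?posrE.
have iq1 : q^-1 < 1 by rewrite -pq ltrDr.
have iq2 : 2^-1 <= q^-1 by move: pq ip2; lra.
have q0 : 0 < q by rewrite -invr_gt0 (lt_le_trans _ iq2) ?invr_gt0.
split=> //.
- by rewrite -[q]invrK invf_gt1 ?invr_gt0.
- by rewrite -[q]invrK -[2]invrK lef_pV2 ?posrE ?invr_gt0.
- move=> qE; apply: invr_inj; move: pq; rewrite qE; lra.
Qed.

Lemma lyapunov_power c p q : admissible c -> power_type c p q ->
  lyapunov_like (cone_of c) (mx3 1 0 0 0 p^-1 0 0 0 0).
Proof.
move=> ac cpq; apply/flow_in_lyapunov/(@flow_in_explicit _ _ _ _ _ _ _ _ _ _ _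
  (fun x y z t => expR (1 * t) * x) (fun x y z t => expR (p^-1 * t) * y)
  (fun x y z t => z)).
- move=> t x y z; rewrite !(power_memE _ _ _ cpq) => -[x0 z0 yS].
  split=> //; first by rewrite mulr_ge0 ?expR_ge0.
  rewrite powRM ?expR_ge0 // -expRM mul1r [t * _]mulrC -mulrA.
  by apply/power_sectionZ; rewrite ?expR_gt0.
- by move=> x y z; rewrite !mulr0 expR0 !mul1r.
- move=> x y z t; split.
  + apply: is_derive_eq (deriveM_fun (derive_exp t 1) (is_derive_cst x t 1)) _.
    by rewrite /cst /=; ring.
  + apply: is_derive_eq (deriveM_fun (derive_exp t p^-1) (is_derive_cst y t 1)) _.
    by rewrite /cst /=; ring.
  + by apply: is_derive_eq (is_derive_cst z t 1) _; ring.
Qed.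

(* The functional defining the tangent plane along the ray of [(1, e^s, e^{qs})];
   its nonnegativity on the cone is Young's inequality. *)
Lemma power_tangent c p q s : admissible c -> power_type c p q ->
  nonneg_on (cone_of c) (row3 (expR s / p) (- 1) (expR ((1 - q) * s) / q)).
Proof.
move=> ac cpq v; have [p2 pq] := power_type_conjugate ac cpq.
have [p0 q0 _ _ _] := conjugate_bounds (conj p2 pq).
rewrite (vec3_eta v); move: (v 0 0) (v 1 0) (v 2 0) => x y z.
move/(power_memE _ _ _ cpq) => [x0 z0 /power_section_le ym].
rewrite row3_vec3; set w := expR ((1 - q) * s).
have := @conjugate_powR R ((expR s * x) `^ p^-1) ((w * z) `^ q^-1) p q.
rewrite !powR_ge0 => /(_ isT isT p0 q0 pq).
rewrite -!powRrM !mulVf ?gt_eqF // !powRr1 ?mulr_ge0 ?expR_ge0 //.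
rewrite !powRM ?expR_ge0 // -!expRM.
have -> : expR (s * p^-1) * x `^ p^-1 * (expR ((1 - q) * s * q^-1) * z `^ q^-1) =
    mean p q x z.
  transitivity ((expR (s * p^-1) * expR ((1 - q) * s * q^-1)) * mean p q x z).
    by ring.
  rewrite -expRD (_ : _ + _ = 0) ?expR0 ?mul1r //.
  transitivity ((p^-1 + q^-1 - 1) * s); last by rewrite pq; ring.
  by field; rewrite !gt_eqF.
move=> /(le_trans ym); rewrite -subr_ge0; congr (0 <= _).
by field; rewrite !gt_eqF.
Qed.

Lemma power_curve c p q s : admissible c -> power_type c p q ->
  cone_of c (vec3 1 (expR s) (expR (q * s))).
Proof.
move=> ac cpq; have [p2 pq] := power_type_conjugate ac cpq.
have [p0 q0 _ _ _] := conjugate_bounds (conj p2 pq).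
apply/(power_memE _ _ _ cpq); split; rewrite ?ler01 ?expR_ge0 //.
rewrite powR1 mul1r -expRM (_ : _ * q^-1 = s); last by field; rewrite gt_eqF.
exact: power_section_top ac (expR_ge0 _) _ _ cpq.
Qed.

(** The Lyapunov condition for a point of the upper boundary and its tangent functional, whose value
    there is [(1/p + 1/q - 1) expR s = 0]. *)
Lemma power_curve_relation c p q X s : admissible c -> power_type c p q ->
  lyapunov_like (cone_of c) X ->
  expR s / p * (X 0 0 + X 0 1 * expR s + X 0 2 * expR (q * s)) -
  (X 1 0 + X 1 1 * expR s + X 1 2 * expR (q * s)) +
  expR ((1 - q) * s) / q * (X 2 0 + X 2 1 * expR s + X 2 2 * expR (q * s)) = 0.
Proof.
move=> ac cpq LX; have [p2 pq] := power_type_conjugate ac cpq.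
have [p0 q0 _ _ _] := conjugate_bounds (conj p2 pq).
have := LX _ _ (power_tangent s ac cpq) (power_curve s ac cpq).
rewrite (mx3_eta X) mx3_vec3 !row3_vec3 -(mx3_eta X) => h.
rewrite -[RHS]h; last first.
  rewrite mulr1 mulrAC -expRD (_ : (1 - q) * s + q * s = s); last by ring.
  transitivity ((p^-1 + q^-1 - 1) * expR s); first by ring.
  by rewrite pq; ring.
by ring.
Qed.

(** For [1 < q < 2] the exponents [1 - q < 0 < 2 - q < 1 < q < 2 < q + 1] are distinct. Each
    off-diagonal entry is alone at its exponent, and the three diagonal entries share the exponent
    [1]. *)
Lemma lyapunov_power_offdiag c p q X : admissible c -> power_type c p q ->
  lyapunov_like (cone_of c) X -> q < 2 ->
  [/\ [/\ X 0 1 = 0, X 0 2 = 0 & X 1 0 = 0], [/\ X 1 2 = 0, X 2 0 = 0 & X 2 1 = 0] &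
      X 1 1 = X 0 0 / p + X 2 2 / q].
Proof.
move=> ac cpq LX q2; have [p2 pq] := power_type_conjugate ac cpq.
have [p0 q0 q1 _ _] := conjugate_bounds (conj p2 pq).
have pn := lt0r_neq0 p0; have qn := lt0r_neq0 q0.
pose a := [:: 1 - q; 0; 2 - q; 1; q; 2; q + 1].
pose e := [:: X 2 0 / q; - X 1 0; X 2 1 / q; X 0 0 / p - X 1 1 + X 2 2 / q;
  - X 1 2; X 0 1 / p; X 0 2 / p].
have ua : uniq a.
  apply: (@sorted_uniq _ (<%R)); [exact: lt_trans | exact: ltxx |].
  by rewrite /= !andbT; do !(apply/andP; split); lra.
have h s : \sum_(i < size a) e`_i * expR (a`_i * s) = 0.
  rewrite -[RHS](power_curve_relation s ac cpq LX).
  rewrite !big_ord_recl big_ord0 /= /bump /=.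
  have E x y : expR x * expR y = expR (x + y) by rewrite expRD.
  have e2 : expR s * expR s = expR (2 * s) by rewrite E; congr expR; ring.
  have e3 : expR s * expR (q * s) = expR ((q + 1) * s) by rewrite E; congr expR; ring.
  have e4 : expR ((1 - q) * s) * expR s = expR ((2 - q) * s) by rewrite E; congr expR; ring.
  have e5 : expR ((1 - q) * s) * expR (q * s) = expR s by rewrite E; congr expR; ring.
  rewrite -e2 -e3 -e4 mul0r expR0 mul1r.
  rewrite [X in _ = _ + X](_ : _ = X 2 0 / q * expR ((1 - q) * s) +
     X 2 1 / q * (expR ((1 - q) * s) * expR s) +
     X 2 2 / q * (expR ((1 - q) * s) * expR (q * s))); last by ring.
  by rewrite e5; ring.
have e0 := exp_independent ua h.
have := (e0 0%N isT, e0 1%N isT, e0 2 isT, e0 3 isT, e0 4 isT, e0 5 isT, e0 6 isT).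
rewrite /= => -[[[[[[x20 x10] x21] diag] x12] x01] x02].
have div0 x k : k != 0 -> x / k = 0 -> x = 0.
  by move=> k0 /eqP; rewrite mulf_eq0 invr_eq0 (negPf k0) orbF => /eqP.
have opp0 x : - x = 0 -> x = 0 by move/eqP; rewrite oppr_eq0 => /eqP.
split; [split | split |].
- exact: div0 x01.
- exact: div0 x02.
- exact: opp0.
- exact: opp0.
- exact: div0 x20.
- exact: div0 x21.
- by apply/eqP; rewrite eq_sym -subr_eq0 -diag; apply/eqP; ring.
Qed.

End PowerType.

(** * The exponent 2 *)

Section PowerTypeTwo.
Context {R : realType}.
Implicit Types (c : cone_label R) (X : 'M[R]_3) (a k m p q s t u x y z : R).

(** The counterpart of [power_curve_relation] on the lower boundary [(1, - a expR s, expR (2 s))].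
    The functional is [a] times the upper tangent functional at the top point [(x, m, z)], plus
    [y + a m]. *)
Lemma lyapunov_lower_curve a X s : 0 < a <= 1 ->
  lyapunov_like (cone_of (PowerCone 2 2 a)) X ->
  a * expR s / 2 * (X 0 0 + X 0 1 * (- (a * expR s)) + X 0 2 * expR (2 * s)) +
  (X 1 0 + X 1 1 * (- (a * expR s)) + X 1 2 * expR (2 * s)) +
  a * expR (- s) / 2 * (X 2 0 + X 2 1 * (- (a * expR s)) + X 2 2 * expR (2 * s)) = 0.
Proof.
move=> a01 LX; have /andP[a0 a1] := a01.
have ac : admissible (PowerCone 2 2 a) by split=> //; split=> //; field.
have cpq : power_type (PowerCone 2 2 a) 2 2 by [].
have f0 : nonneg_on (cone_of (PowerCone 2 2 a))
    (row3 (a * expR s / 2) 1 (a * expR (- s) / 2)).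
  move=> v; rewrite (vec3_eta v); move: (v 0 0) (v 1 0) (v 2 0) => x y z.
  move/(power_memE _ _ _ cpq) => [x0 z0 /andP[ym _]].
  set m := _ `^ _ * _ in ym; have m0 : 0 <= m by rewrite mulr_ge0 ?powR_ge0.
  have Km : cone_of (PowerCone 2 2 a) (vec3 x m z).
    by apply/(power_memE _ _ _ cpq); split=> //; exact: power_section_top ac m0 _ _ cpq.
  have := power_tangent s ac cpq Km; rewrite !row3_vec3 => h.
  have hy : 0 <= y - - a * m by rewrite subr_ge0.
  have := addr_ge0 (mulr_ge0 (ltW a0) h) hy; congr (0 <= _).
  by rewrite (_ : (1 - 2) * s = - s); [field | ring].
have Kx : cone_of (PowerCone 2 2 a) (vec3 1 (- (a * expR s)) (expR (2 * s))).
  apply/(power_memE _ _ _ cpq); split; rewrite ?ler01 ?expR_ge0 //.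
  rewrite powR1 mul1r -expRM (_ : 2 * s * 2^-1 = s); last by field.
  by rewrite /= mulNr lexx /= (le_trans (y := 0)) ?expR_ge0 // oppr_le0 mulr_ge0 ?expR_ge0 // ltW.
have := LX _ _ f0 Kx.
rewrite (mx3_eta X) mx3_vec3 !row3_vec3 -(mx3_eta X) => h.
have e2 : expR (2 * s) = expR s * expR s by rewrite -expRD; congr expR; ring.
have eN : expR (- s) * expR s = 1 by rewrite -expRD addNr expR0.
rewrite -[RHS]h; last first.
  rewrite e2; transitivity (a * expR s * ((expR (- s) * expR s) - 1) / 2); first by field.
  by rewrite eN; ring.
by ring.
Qed.

(** At [q = 2] the exponents [0] and [2] each occur twice, so the upper boundary only ties [X 2 1]
    to [X 1 0] and [X 0 1] to [X 1 2]. *)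
Lemma lyapunov_power_two c X : admissible c -> power_type c 2 2 ->
  lyapunov_like (cone_of c) X ->
  [/\ X 0 2 = 0, X 2 0 = 0, X 2 1 = 2 * X 1 0, X 0 1 = 2 * X 1 2 &
      X 1 1 = X 0 0 / 2 + X 2 2 / 2].
Proof.
move=> ac cpq LX.
pose a := [:: -1; 0; 1; 2; 3 : R].
pose e := [:: X 2 0 / 2; X 2 1 / 2 - X 1 0; X 0 0 / 2 - X 1 1 + X 2 2 / 2;
  X 0 1 / 2 - X 1 2; X 0 2 / 2].
have ua : uniq a.
  apply: (@sorted_uniq _ (<%R)); [exact: lt_trans | exact: ltxx |].
  by rewrite /= !andbT; do !(apply/andP; split); lra.
have h s : \sum_(i < size a) e`_i * expR (a`_i * s) = 0.
  rewrite -[RHS](power_curve_relation s ac cpq LX).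
  rewrite !big_ord_recl big_ord0 /= /bump /=.
  have E x y : expR x * expR y = expR (x + y) by rewrite expRD.
  have e1 : expR (-1 * s) = expR ((1 - 2) * s) by congr expR; ring.
  have e2 : expR (2 * s) = expR s * expR s by rewrite E; congr expR; ring.
  have e3 : expR (3 * s) = expR s * expR s * expR s by rewrite !E; congr expR; ring.
  have e4 : expR ((1 - 2) * s) * expR s = 1 by rewrite E -[RHS]expR0; congr expR; ring.
  rewrite e1 e2 e3 mul0r expR0 mul1r.
  rewrite [X in _ = _ + X](_ : _ = X 2 0 / 2 * expR ((1 - 2) * s) +
     X 2 1 / 2 * (expR ((1 - 2) * s) * expR s) +
     X 2 2 / 2 * ((expR ((1 - 2) * s) * expR s) * expR s)); last by ring.
  by rewrite e4; ring.
have e0 := exp_independent ua h.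
have := (e0 0%N isT, e0 1%N isT, e0 2 isT, e0 3 isT, e0 4 isT).
by rewrite /= => -[[[[x20 x21] diag] x01] x02]; split; lra.
Qed.

(** The rest of the boundary removes the remaining freedom: the ray [(0, -1, 0)] for the hypograph,
    the face [y = 0] for the half cone, and the lower curve for [a < 1]. *)
Lemma lyapunov_power_two_offdiag c X : admissible c -> power_type c 2 2 ->
  c <> PowerCone 2 2 1 -> lyapunov_like (cone_of c) X -> X 1 0 = 0 /\ X 1 2 = 0.
Proof.
case: c => [||p q|p q a|p q] //= ac [pE qE]; subst p q.
- move=> _ LX.
  have [_ _ x21 x01 _] := @lyapunov_power_two (PowerHypograph 2 2) X ac (conj erefl erefl) LX.
  have Kx : power_hypograph 2 2 (vec3 0 (- 1) (0 : R)).
    rewrite /power_hypograph /= /power_mean !vec3E; split=> //.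
    by rewrite (le_trans (@lerN10 _)) // mulr_ge0 ?powR_ge0.
  have := LX (row3 1 0 0) _ _ Kx; have := LX (row3 0 0 1) _ _ Kx.
  rewrite (mx3_eta X) mx3_vec3 !row3_vec3 -(mx3_eta X).
  move=> h1 h2.
  have n1 : nonneg_on (power_hypograph 2 2) (row3 0 0 (1 : R)).
    by move=> v [_ _ z0]; rewrite (vec3_eta v) row3_vec3; move: z0; lra.
  have n2 : nonneg_on (power_hypograph 2 2) (row3 (1 : R) 0 0).
    by move=> v [_ x0 _]; rewrite (vec3_eta v) row3_vec3; move: x0; lra.
  have {}h1 := h1 n1 ltac:(ring); have {}h2 := h2 n2 ltac:(ring).
  by split; lra.
- move=> na LX.
  have /andP[a0 a1] : 0 < a <= 1 by case: ac.
  have [x02 x20 x21 x01 x11] := @lyapunov_power_two (PowerCone 2 2 a) X ac (conj erefl erefl) LX.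
  (* Here [u = expR s]. The factor [1 - a^2] vanishes exactly for the excluded Lorentz cone, and the
     values [u = 1] and [u = 2] then separate the two entries. *)
  have rel u : 0 < u -> (1 - a ^+ 2) * (X 1 0 + X 1 2 * u ^+ 2) = 0.
    move=> u0; have := lyapunov_lower_curve (ln u) (proj2 ac) LX.
    have e2 : expR (2 * ln u) = u ^+ 2.
      by rewrite mulrC expRM_natr lnK.
    rewrite expRN e2 lnK // x02 x20 x11 x21 x01 => h; rewrite -[RHS]h.
    by field; rewrite gt_eqF.
  have an : 1 - a ^+ 2 != 0.
    rewrite subr_eq0 eq_sym sqrf_eq1 negb_or; apply/andP; split.
      by apply/eqP => aE; apply: na; rewrite aE.
    by rewrite gt_eqF // (lt_trans _ a0) // oppr_lt0 ltr01.
  have r1 : X 1 0 + X 1 2 * 1 ^+ 2 = 0.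
    by move/eqP: (rel 1 ltr01); rewrite mulf_eq0 (negPf an) => /eqP.
  have r2 : X 1 0 + X 1 2 * 2 ^+ 2 = 0.
    by move/eqP: (rel 2 (ltr0n _ 2)); rewrite mulf_eq0 (negPf an) => /eqP.
  by split; move: r1 r2; lra.
- move=> _ LX.
  have n1 : nonneg_on (half_power_cone 2 2) (row3 0 (1 : R) 0).
    by move=> v [/andP[y0 _] _ _]; rewrite (vec3_eta v) row3_vec3; move: y0; lra.
  have K1 x z : 0 <= x -> 0 <= z -> half_power_cone 2 2 (vec3 x 0 (z : R)).
    move=> x0 z0; rewrite /half_power_cone /= /power_mean !vec3E lexx.
    by rewrite mulr_ge0 ?powR_ge0.
  have := LX _ _ n1 (K1 1 0 ler01 (lexx _)); have := LX _ _ n1 (K1 0 1 (lexx _) ler01).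
  rewrite (mx3_eta X) !mx3_vec3 !row3_vec3 -(mx3_eta X).
  by move=> h1 h2; have {}h1 := h1 ltac:(ring); have {}h2 := h2 ltac:(ring); split; lra.
Qed.
End PowerTypeTwo.

(** * Rigidity of isomorphisms *)

Section Rigidity.
Context {R : realType}.
Implicit Types (c : cone_label R) (X Y T : 'M[R]_3) (a k l m p q s t u x y z : R).

Definition diag3 (l0 l1 l2 : R) := mx3 l0 0 0 0 l1 0 0 0 l2.

Lemma lyapunov_power_diag c p q X : admissible c -> power_type c p q ->
  c <> PowerCone 2 2 1 -> lyapunov_like (cone_of c) X ->
  X = diag3 (X 0 0) (X 0 0 / p + X 2 2 / q) (X 2 2).
Proof.
move=> ac cpq c1 LX.
have [_ _ _ q2 qp] := conjugate_bounds (power_type_conjugate ac cpq).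
move: q2; rewrite le_eqVlt => /predU1P[qE|q2].
  rewrite qE (qp qE) in cpq *.
  have [x02 x20 x21 x01 x11] := lyapunov_power_two ac cpq LX.
  have [x10 x12] := lyapunov_power_two_offdiag ac cpq c1 LX.
  by rewrite {1}(mx3_eta X) /diag3 x01 x02 x10 x11 x12 x20 x21 x10 !mulr0.
have [[x01 x02 x10] [x12 x20 x21] x11] := lyapunov_power_offdiag ac cpq LX q2.
by rewrite {1}(mx3_eta X) /diag3 x01 x02 x10 x11 x12 x20 x21.
Qed.

(** The coordinate functional [i] vanishes on the coordinate ray [j] for distinct [i], [j], which
    isolates the entry [X i j]. *)
Lemma lyapunov_orthant_diag X : lyapunov_like (orthant R) X ->
  X = diag3 (X 0 0) (X 1 1) (X 2 2).
Proof.
move=> LX.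
have h i j : i != j -> X i j = 0.
  move=> ij; have := LX (delta_mx 0 i) (delta_mx j 0).
  have E (v : 'cV[R]_3) : ((delta_mx 0 i : 'rV[R]_3) *m v) 0 0 = v i 0 by rewrite -rowE mxE.
  rewrite !E -colE !mxE (negPf ij) /=; apply=> //.
    by move=> v v0; rewrite E.
  by move=> k; rewrite mxE; case: (_ && _).
rewrite {1}(mx3_eta X) /diag3 (h 0 1) // (h 0 2) // (h 1 0) //.
by rewrite (h 1 2) // (h 2 0) // (h 2 1).
Qed.

Lemma diag3_mul l0 l1 l2 k0 k1 k2 :
  diag3 l0 l1 l2 *m diag3 k0 k1 k2 = diag3 (l0 * k0) (l1 * k1) (l2 * k2).
Proof. by rewrite /diag3 mx3_mul; congr mx3; ring. Qed.

Lemma diag3_inj l0 l1 l2 k0 k1 k2 : diag3 l0 l1 l2 = diag3 k0 k1 k2 ->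
  [/\ l0 = k0, l1 = k1 & l2 = k2].
Proof.
move=> /matrixP e.
by split; [move: (e 0 0) | move: (e 1 1) | move: (e 2 2)]; rewrite !mxE.
Qed.

(** Serves to separate this cone from the Lorentz cone. The face [z = 0] makes [X] upper triangular,
    nilpotency kills the diagonal, and the tangent planes along the curved boundary kill the
    rest. *)
Lemma lyapunov_exp_cone_nilpotent X : lyapunov_like (exp_cone R) X ->
  X *m X *m X = 0 -> X = 0.
Proof.
move=> LX.
have memF x y : x <= 0 -> 0 <= y -> exp_cone R (vec3 x y 0).
  by move=> x0 y0; left; rewrite /= !vec3E.
have nz : nonneg_on (exp_cone R) (row3 0 0 1).
  move=> v; rewrite (vec3_eta v) row3_vec3 /exp_cone /setU /= !vec3E.
  by move=> [[_ _ ->]|[_ z0]]; [rewrite !mul0r !add0r mulr0 | move: z0; lra].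
have ny : nonneg_on (exp_cone R) (row3 0 1 0).
  move=> v; rewrite (vec3_eta v) row3_vec3 /exp_cone /setU /= !vec3E.
  rewrite !mul0r add0r addr0 mul1r => -[[_ y0 _]|[xyz z0]] //.
  by rewrite -(pmulr_lge0 _ (_ : 0 < (v 2 0)^-1)) ?invr_gt0 // (le_trans _ xyz) ?expR_ge0.
have K1 := memF (- 1) 0 (lerN10 _) (lexx _).
have K2 := memF 0 1 (lexx _) ler01.
have := (LX _ _ nz K1, LX _ _ nz K2, LX _ _ ny K1).
rewrite (mx3_eta X) !mx3_vec3 !row3_vec3 -(mx3_eta X) => -[[h20 h21] h10].
have {}h20 := h20 ltac:(ring); have {}h21 := h21 ltac:(ring); have {}h10 := h10 ltac:(ring).
have x20 : X 2 0 = 0 by lra.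
have x21 : X 2 1 = 0 by lra.
have x10 : X 1 0 = 0 by lra.
(* The tangent plane along the ray of [(ln u, u, 1)]. *)
have rel u : 0 < u ->
    - (X 0 0 * ln u + X 0 1 * u + X 0 2) + u^-1 * (X 1 1 * u + X 1 2) + (ln u - 1) * X 2 2 = 0.
  move=> u0; have nu : nonneg_on (exp_cone R) (row3 (- 1) u^-1 (ln u - 1)).
    move=> v; rewrite (vec3_eta v) row3_vec3 /exp_cone /setU /= !vec3E.
    move: (v 0 0) (v 1 0) (v 2 0) => x y z [[x0 y0 ->]|[xyz z0]].
      by rewrite mulr0 addr0 mulN1r addr_ge0 ?oppr_ge0 // mulr_ge0 // invr_ge0 ltW.
    have h1 := expR_ge1Dx (x / z - ln u).
    have h2 : expR (x / z - ln u) <= y / z / u.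
      by rewrite expRB lnK // ler_pM2r ?invr_gt0.
    have h3 := le_trans h1 h2; rewrite -subr_ge0 in h3.
    have := mulr_ge0 (ltW z0) h3; congr (0 <= _).
    by field; rewrite !gt_eqF.
  have Ku : exp_cone R (vec3 (ln u) u 1).
    by right; rewrite /= !vec3E !divr1 lnK // ltr01 lexx.
  have := LX _ _ nu Ku.
  rewrite (mx3_eta X) !mx3_vec3 !row3_vec3 -(mx3_eta X) x10 x20 x21 => h.
  by rewrite -[RHS]h; [ring | field; rewrite gt_eqF].
have cube0 l : l * l * l = 0 -> l = 0.
  by move/eqP; rewrite !mulf_eq0 orbb orbb => /eqP.
rewrite {1 2 3}(mx3_eta X) x10 x20 x21 !mx3_mul => /matrixP X3.
have x00 : X 0 0 = 0 by apply: cube0; have := X3 0 0; rewrite !mxE /= => <-; ring.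
have x11 : X 1 1 = 0 by apply: cube0; have := X3 1 1; rewrite !mxE /= => <-; ring.
have x22 : X 2 2 = 0 by apply: cube0; have := X3 2 2; rewrite !mxE /= => <-; ring.
(* With zero diagonal the relation reads [- X01 u - X02 + X12 / u = 0]; three values of [u]
   determine the three entries. *)
have := (rel 1 ltr01, rel 2 (ltr0n _ 2), rel 4 (ltr0n _ 4)).
rewrite x00 x11 x22 !mul0r !mulr0 !add0r !addr0 => -[[r1 r2] r4].
have [x01 x02 x12] : [/\ X 0 1 = 0, X 0 2 = 0 & X 1 2 = 0] by split; lra.
rewrite (mx3_eta X) x10 x20 x21 x00 x01 x02 x11 x12 x22; apply/matrixP => i j.
by elim/ord3_ind: i; elim/ord3_ind: j; rewrite !mxE.
Qed.

Definition cone_iso T c c' := T \in unitmx /\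
  forall v : 'cV[R]_3, cone_of c' (T *m v) <-> cone_of c v.

Lemma cone_iso_sym T c c' : cone_iso T c c' -> cone_iso (invmx T) c' c.
Proof.
by move=> [uT h]; split; [rewrite unitmx_inv | move=> v; rewrite -h mulKVmx].
Qed.

Lemma conjugate_mul T X Y : T \in unitmx ->
  (invmx T *m X *m T) *m (invmx T *m Y *m T) = invmx T *m (X *m Y) *m T.
Proof. by move=> uT; rewrite !mulmxA mulmxK. Qed.

Lemma conjugate_inj T X Y : T \in unitmx ->
  invmx T *m X *m T = invmx T *m Y *m T -> X = Y.
Proof.
move=> uT /(congr1 (fun M => T *m M *m invmx T)).
by rewrite !mulmxA !mulmxV // !mul1mx -!mulmxA mulmxV // !mulmx1.
Qed.

Lemma cone_iso_lyapunov T c c' X : cone_iso T c c' ->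
  lyapunov_like (cone_of c') X -> lyapunov_like (cone_of c) (invmx T *m X *m T).
Proof. by move=> [uT TK]; exact: lyapunov_conj. Qed.

Definition special_label c :=
  c = ExpCone R \/ c = Orthant R \/ c = PowerCone 2 2 1.

Lemma label_cases c : special_label c \/
  exists p q, power_type c p q /\ c <> PowerCone 2 2 1.
Proof.
have [->|h] := pselect (c = PowerCone 2 2 1); first by left; right; right.
case: c h => [||p q|p q a|p q] h.
- by left; left.
- by left; right; left.
- by right; exists p, q.
- by right; exists p, q.
- by right; exists p, q.
Qed.

(** The identity [X^4 = X^3] is common to an idempotent (orthant), a nilpotent of order 3 (Lorentz
    cone) and a mixture of both (exponential cone). A diagonal matrix satisfying it is idempotent,
    so the last clause prevents [X] from being diagonalizable. *)
Lemma special_lyapunov c : special_label c -> exists X,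
  [/\ lyapunov_like (cone_of c) X,
      (X *m X) *m (X *m X) = X *m X *m X, X <> 0, X <> 1%:M &
      c <> Orthant R -> X *m X <> X].
Proof.
have neq i j X Y : X i j != Y i j -> X <> Y by move=> n e; rewrite e eqxx in n.
move=> [->|[->|->]].
- exists (mx3 0 0 1 0 1 0 0 0 0); split; first exact: lyapunov_exp_cone.
  + by rewrite !mx3_mul; congr mx3; ring.
  + by apply: (neq 1 1); rewrite !mxE oner_eq0.
  + by apply: (neq 0 0); rewrite !mxE eq_sym oner_eq0.
  + move=> _; rewrite mx3_mul; apply: (neq 0 2); rewrite !mxE /=.
    by rewrite !(mul0r, mulr0, addr0) eq_sym oner_eq0.
- exists (mx3 1 0 0 0 0 0 0 0 0); split => //; first exact: lyapunov_orthant.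
  + by rewrite !mx3_mul; congr mx3; ring.
  + by apply: (neq 0 0); rewrite !mxE oner_eq0.
  + by apply: (neq 1 1); rewrite !mxE eq_sym oner_eq0.
- exists (mx3 0 0 0 1 0 0 0 2 0); split; first exact: lyapunov_lorentz.
  + by rewrite !mx3_mul; congr mx3; ring.
  + by apply: (neq 1 0); rewrite !mxE oner_eq0.
  + by apply: (neq 0 0); rewrite !mxE eq_sym oner_eq0.
  + move=> _; rewrite mx3_mul; apply: (neq 1 0); rewrite !mxE /=.
    by rewrite !(mul0r, mulr0, addr0) eq_sym oner_eq0.
Qed.

Lemma quartic_root l : l * l * (l * l) = l * l * l -> l = 0 \/ l = 1.
Proof.
move=> e; have : l * l * l * (l - 1) = 0.
  by transitivity (l * l * (l * l) - l * l * l); [ring | rewrite e subrr].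
move/eqP; rewrite !mulf_eq0 !orbb subr_eq0 => /orP[]/eqP; by [left | right].
Qed.

(** The transported matrix is [diag(l, l/p + m/q, m)] with all entries [0] or [1]. Mixed values of
    [l] and [m] would put [1/p] or [1/q], both strictly between [0] and [1], in the middle; so the
    matrix is [0] or [1], which is excluded. *)
Lemma power_not_special T c c' p q : admissible c -> power_type c p q ->
  c <> PowerCone 2 2 1 -> special_label c' -> cone_iso T c c' -> False.
Proof.
move=> ac cpq c1 sc' iso; have uT := iso.1.
have [X [LX X4 X0 X1 _]] := special_lyapunov sc'.
have := lyapunov_power_diag ac cpq c1 (cone_iso_lyapunov iso LX).
set Y := invmx T *m X *m T; move: (Y 0 0) (Y 2 2) => l m YE.
have [p2 pq] := power_type_conjugate ac cpq.
have [p0 q0 q1 _ _] := conjugate_bounds (conj p2 pq).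
have ip0 : 0 < p^-1 by rewrite invr_gt0.
have iq0 : 0 < q^-1 by rewrite invr_gt0.
have Y4 : (Y *m Y) *m (Y *m Y) = Y *m Y *m Y by rewrite /Y !conjugate_mul // X4.
rewrite YE !diag3_mul in Y4.
have [/quartic_root l01 /quartic_root k01 /quartic_root m01] := diag3_inj Y4.
have Y0 : Y <> 0.
  move=> Y0; apply: X0; apply: (conjugate_inj uT).
  by rewrite -/Y Y0 mulmx0 mul0mx.
have Y1 : Y <> 1%:M.
  move=> Y1; apply: X1; apply: (conjugate_inj uT).
  by rewrite -/Y Y1 mulmx1 mulVmx.
case: l01 k01 m01 => lE k01 [] mE; rewrite lE mE in YE k01.
- apply: Y0; rewrite YE !mul0r addr0; apply/matrixP => i j.
  by elim/ord3_ind: i; elim/ord3_ind: j; rewrite !mxE.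
- by case: k01; move: pq ip0 iq0; lra.
- by case: k01; move: pq ip0 iq0; lra.
- by apply: Y1; rewrite YE !mul1r pq scalar_mx3.
Qed.

(** On the orthant the transported matrix is diagonal with entries [0] or [1], hence idempotent. *)
Lemma orthant_special T c' : special_label c' -> cone_iso T (Orthant R) c' ->
  c' = Orthant R.
Proof.
move=> sc' iso; have uT := iso.1; apply: contrapT => c'n.
have [X [LX X4 X0 X1 /(_ c'n) X2]] := special_lyapunov sc'.
have := lyapunov_orthant_diag (cone_iso_lyapunov iso LX).
set Y := invmx T *m X *m T; move: (Y 0 0) (Y 1 1) (Y 2 2) => l k m YE.
have Y4 : (Y *m Y) *m (Y *m Y) = Y *m Y *m Y by rewrite /Y !conjugate_mul // X4.
rewrite YE !diag3_mul in Y4.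
have [/quartic_root l01 /quartic_root k01 /quartic_root m01] := diag3_inj Y4.
have sq t : t = 0 \/ t = 1 -> t * t = t by move=> [] ->; ring.
apply: X2; apply: (conjugate_inj uT).
by rewrite -conjugate_mul // -/Y YE diag3_mul !sq.
Qed.

Lemma exp_cone_not_lorentz T : ~ cone_iso T (ExpCone R) (PowerCone 2 2 1).
Proof.
move=> iso; have uT := iso.1.
have := lyapunov_exp_cone_nilpotent (cone_iso_lyapunov iso (@lyapunov_lorentz R)).
rewrite !conjugate_mul // => h.
have /matrixP /(_ 1 0) : mx3 0 0 0 1 0 0 0 2 0 = 0 :> 'M[R]_3.
  apply: (conjugate_inj uT); rewrite mulmx0 mul0mx; apply: h.
  rewrite !mx3_mul (_ : mx3 _ _ _ _ _ _ _ _ _ = 0) ?mulmx0 ?mul0mx //.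
  by apply/matrixP => i j; elim/ord3_ind: i; elim/ord3_ind: j; rewrite !mxE /=; ring.
by rewrite !mxE /= => /eqP; rewrite oner_eq0.
Qed.

Lemma special_unique T c c' : special_label c -> special_label c' ->
  cone_iso T c c' -> c = c'.
Proof.
move=> sc sc' iso; have iso' := cone_iso_sym iso.
have [cE|cn] := pselect (c = Orthant R).
  by rewrite cE in iso *; rewrite (orthant_special sc' iso).
have [c'E|c'n] := pselect (c' = Orthant R).
  by rewrite c'E in iso' *; rewrite (orthant_special sc iso').
case: sc => [cE|[//|cE]]; case: sc' => [c'E|[//|c'E]]; subst c c' => //.
  by have := exp_cone_not_lorentz iso.
by have := exp_cone_not_lorentz iso'.
Qed.
End Rigidity.

(** * Comparison of the cones of types 3, 4 and 5 *)

Section PowerUnique.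
Context {R : realType}.
Implicit Types (c : cone_label R) (T : 'M[R]_3) (a k l m p q s t u x y z : R).

Definition section_iso k c c' :=
  forall y, power_section c 1 y <-> power_section c' 1 (k * y).

Lemma section_iso_sym k c c' : k != 0 -> section_iso k c c' ->
  section_iso k^-1 c' c.
Proof. by move=> k0 h y; rewrite h mulVKf. Qed.

Lemma section_hypograph_unbounded k p q p' q' a : k != 0 -> 0 < a <= 1 ->
  ~ section_iso k (PowerHypograph p q) (PowerCone p' q' a) /\
  ~ section_iso k (PowerHypograph p q) (HalfPowerCone p' q').
Proof.
move=> k0 /andP[a0 a1]; rewrite /section_iso /=.
have nk : 0 < `|k| by rewrite normr_gt0.
(* A point of the half-line whose image is [2] or [-2], outside both bounded sections. *)
have y1 : - (2 / `|k|) <= 1 by rewrite (le_trans (y := 0)) // oppr_le0 divr_ge0.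
have kk : k * - (2 / `|k|) = 2 \/ k * - (2 / `|k|) = - 2.
  have [kp|kn] := leP 0 k; [right|left].
    by rewrite ger0_norm //; field.
  by rewrite ltr0_norm //; field.
by split=> /(_ (- (2 / `|k|)))[/(_ y1) + _]; case: kk => -> /andP[]; lra.
Qed.

(** The points [1] and [- a] lie on both sides of [0], and scaling keeps them there. *)
Lemma section_power_half k p q p' q' a : k != 0 -> 0 < a <= 1 ->
  ~ section_iso k (PowerCone p q a) (HalfPowerCone p' q').
Proof.
move=> k0 /andP[a0 a1] h.
have h1 : power_section (PowerCone p q a) 1 1 by rewrite /=; apply/andP; split; lra.
have h2 : power_section (PowerCone p q a) 1 (- a) by rewrite /=; apply/andP; split; lra.
have /andP[k1 _] := (h 1).1 h1; have /andP[k2 _] := (h _).1 h2.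
have k_gt0 : 0 < k by rewrite lt_neqAle eq_sym k0 -[k]mulr1.
by move: k2; rewrite mulrN oppr_ge0 leNgt mulr_gt0.
Qed.

(** A positive [k] has to be [1]. A negative one exchanges the ends, so [1 <= - k a <= a' a], which
    forces [a = a' = 1]. *)
Lemma section_power_power k p q p' q' a a' : k != 0 -> 0 < a <= 1 -> 0 < a' <= 1 ->
  section_iso k (PowerCone p q a) (PowerCone p' q' a') -> a = a'.
Proof.
move=> k0 /andP[a0 a1] /andP[b0 b1] h; have hV := section_iso_sym k0 h.
have mem1 b u v : 0 < b -> power_section (PowerCone u v b) 1 1.
  by move=> b_gt0; rewrite /=; apply/andP; split; lra.
have mema b u v : 0 < b -> power_section (PowerCone u v b) 1 (- b).
  by move=> b_gt0; rewrite /=; apply/andP; split; lra.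
have /andP[k1 k2] := (h 1).1 (mem1 _ _ _ a0).
have /andP[k3 k4] := (h _).1 (mema _ _ _ a0).
have /andP[k5 k6] := (hV 1).1 (mem1 _ _ _ b0).
have /andP[k7 k8] := (hV _).1 (mema _ _ _ b0).
rewrite !mulr1 in k1 k2 k3 k4 k5 k6 k7 k8.
have [kp|kn] := ltP 0 k.
  have kV : k^-1 <= 1 -> 1 <= k by rewrite invf_le1.
  have kE : k = 1 by apply/eqP; rewrite eq_le k2 kV.
  move: k3 k7; rewrite kE invr1 !mul1r => ? ?; lra.
have {k0}kn : k < 0 by rewrite lt_neqAle k0.
have h1 : - a * k >= 1 by rewrite -ler_ndivlMr // mul1r.
have Nk : - k <= a' by lra.
have h2 : - k * a <= a' * a by rewrite ler_wpM2r // ltW.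
have h3 : a' * a <= a by rewrite ler_piMl // ltW.
have h4 : a' * a <= a' by rewrite ler_piMr // ltW.
have e : - a * k = - k * a by ring.
by move: h1; rewrite e; lra.
Qed.

Lemma section_rigid k c c' p q : k != 0 -> admissible c -> admissible c' ->
  power_type c p q -> power_type c' p q -> section_iso k c c' -> c = c'.
Proof.
move=> k0 ac ac' cpq cpq' h; have hV := section_iso_sym k0 h.
have kV : k^-1 != 0 by rewrite invr_eq0.
have one : (0 : R) < (1 : R) <= (1 : R) by rewrite ltr01 lexx.
case: c ac cpq h hV => [||p1 q1|p1 q1 a|p1 q1] ac //= [? ?] h hV;
case: c' ac' cpq' h hV => [||p2 q2|p2 q2 a'|p2 q2] ac' //= [? ?] h hV; subst p1 p2 q1 q2 => //.
- by have [] := section_hypograph_unbounded p q p q k0 (proj2 ac').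
- by have [] := section_hypograph_unbounded p q p q k0 one.
- by have [] := section_hypograph_unbounded p q p q kV (proj2 ac).
- by rewrite (section_power_power k0 (proj2 ac) (proj2 ac') h).
- by have := section_power_half k0 (proj2 ac) h.
- by have [] := section_hypograph_unbounded p q p q kV one.
- by have := section_power_half kV (proj2 ac') hV.
Qed.

(** A nonzero column of the isomorphism is an eigenvector of [diag(1, a, 0)]; since the eigenvalues
    are distinct, it lies on a coordinate axis. *)
Lemma eigen_column t0 t1 t2 l a : 0 < a < 1 ->
  t0 * l = 1 * t0 -> t1 * l = a * t1 -> t2 * l = 0 * t2 ->
  (t0, t1, t2) != (0, 0, 0) ->
  [\/ [/\ l = 1, t1 = 0 & t2 = 0], [/\ l = a, t0 = 0 & t2 = 0] |
      [/\ l = 0, t0 = 0 & t1 = 0]].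
Proof.
move=> /andP[a0 a1] e0 e1 e2 tn.
have z t b : t * l = b * t -> t = 0 \/ l = b.
  move=> e; have /eqP : t * (l - b) = 0 by rewrite mulrBr e; ring.
  by rewrite mulf_eq0 subr_eq0 => /orP[]/eqP; [left | right].
have [t00|lE] := z _ _ e0; have [t10|lE1] := z _ _ e1; have [t20|lE2] := z _ _ e2;
  try (by exfalso; lra).
- by rewrite t00 t10 t20 eqxx in tn.
- by constructor 3.
- by constructor 2.
- by constructor 1.
Qed.

(** The generator [diag(1, 1/p', 0)] of the target pulls back to [diag(l, l/p + m/q, m)] with the
    same eigenvalues. The middle entry lies between the other two, so it must be [1/p'], and the
    isomorphism fixes the middle axis and at most exchanges the outer ones. *)
Lemma power_iso_monomial T c c' p q p' q' : admissible c -> admissible c' ->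
  power_type c p q -> power_type c' p' q' -> c <> PowerCone 2 2 1 ->
  cone_iso T c c' -> p = p' /\ exists t0 t1 t2, [/\ t0 != 0, t1 != 0 & t2 != 0] /\
  forall y, T *m vec3 1 y 1 = vec3 t0 (t1 * y) t2.
Proof.
move=> ac ac' cpq cpq' c1 iso; have uT := iso.1.
have := lyapunov_power_diag ac cpq c1 (cone_iso_lyapunov iso (lyapunov_power ac' cpq')).
set Y := invmx T *m _ *m T; move: (Y 0 0) (Y 2 2) => l m YE.
have TY : T *m Y = mx3 1 0 0 0 p'^-1 0 0 0 0 *m T by rewrite /Y -!mulmxA mulKVmx.
rewrite {}YE {Y} in TY.
have [p2 pq] := power_type_conjugate ac cpq.
have [p'2 pq'] := power_type_conjugate ac' cpq'.
have [p0 q0 q1 _ _] := conjugate_bounds (conj p2 pq).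
have [p'0 q'0 q'1 _ _] := conjugate_bounds (conj p'2 pq').
have : \det T != 0 by move: uT; rewrite unitmxE unitfE.
move: TY; rewrite (mx3_eta T) /diag3 !mx3_mul det_mx3 => /matrixP TY.
have := (TY 0 0, TY 0 1, TY 0 2, TY 1 0, TY 1 1, TY 1 2, TY 2 0, TY 2 1, TY 2 2).
rewrite {TY} !mxE /=.
move: (T 0 0) (T 0 1) (T 0 2) (T 1 0) (T 1 1) (T 1 2) (T 2 0) (T 2 1) (T 2 2).
move=> t00 t01 t02 t10 t11 t12 t20 t21 t22.
rewrite !(mulr0, mul0r, addr0, add0r).
move=> [[[[[[[[e00 e01] e02] e10] e11] e12] e20] e21] e22] dn.
have iq : q^-1 = 1 - p^-1 by lra.
have pE : p = (p^-1)^-1 by rewrite invrK.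
have p'E : p' = (p'^-1)^-1 by rewrite invrK.
rewrite {}iq in e01 e11 e21; rewrite {}pE {}p'E.
have a0 : 0 < p^-1 by rewrite invr_gt0.
have b0 : 0 < p'^-1 by rewrite invr_gt0.
have a2 : p^-1 <= 2^-1 by rewrite lef_pV2 ?posrE.
have b2 : p'^-1 <= 2^-1 by rewrite lef_pV2 ?posrE.
move: (p^-1) (p'^-1) a0 b0 a2 b2 e01 e11 e21 e10 e12 => a b a0 b0 a2 b2.
move=> e01 e11 e21 e10 e12.
have b01 : 0 < b < 1 by apply/andP; split; lra.
rewrite -(mul0r t20) in e20; rewrite -(mul0r t21) in e21; rewrite -(mul0r t22) in e22.
have n0 : (t00, t10, t20) != (0, 0, 0).
  by apply: contra_neq dn => -[-> -> ->]; ring.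
have n1 : (t01, t11, t21) != (0, 0, 0).
  by apply: contra_neq dn => -[-> -> ->]; ring.
have n2 : (t02, t12, t22) != (0, 0, 0).
  by apply: contra_neq dn => -[-> -> ->]; ring.
(* The eigenvalue comparisons are linear apart from the product [a b]; these bounds let linear
   arithmetic discard the impossible orders. *)
have ab : 0 < a * b by rewrite mulr_gt0.
have ab' : a * b < b by rewrite gtr_pMl //; lra.
have c0 := eigen_column b01 e00 e10 e20 n0.
have c1' := eigen_column b01 e01 e11 e21 n1.
have c2 := eigen_column b01 e02 e12 e22 n2.
clear c1 e00 e01 e02 e10 e11 e12 e20 e21 e22.
case: c0 => -[lE z1 z2]; case: c2 => -[mE z3 z4]; case: c1' => -[kE z5 z6];
  rewrite lE mE in kE; rewrite {}z1 {}z2 {}z3 {}z4 {}z5 {}z6 in dn *;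
  clear n0 n1 n2;
  try (by exfalso; (lra || (case/eqP: dn; ring))).
(* Two arrangements survive: the identity, with [b = a], and the exchange of the outer axes, with
   [b = 1 - a], where the bounds by [1/2] force [a = b = 1/2]. *)
- have -> : a = b by lra.
  split=> //; exists t00, t11, t22; split.
    by split; apply: contra_neq dn => ->; ring.
  by move=> y; rewrite mx3_vec3; congr vec3; ring.
- have -> : a = b by lra.
  split=> //; exists t02, t11, t20; split.
    by split; apply: contra_neq dn => ->; ring.
  by move=> y; rewrite mx3_vec3; congr vec3; ring.
Qed.

Lemma power_unique T c c' p q p' q' : admissible c -> admissible c' ->
  power_type c p q -> power_type c' p' q' -> c <> PowerCone 2 2 1 ->
  cone_iso T c c' -> c = c'.
Proof.
move=> ac ac' cpq cpq' c1 iso.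
have [pp' [t0 [t1 [t2 [[t0n t1n t2n] TE]]]]] := power_iso_monomial ac ac' cpq cpq' c1 iso.
have [_ pq] := power_type_conjugate ac cpq.
have [_ pq'] := power_type_conjugate ac' cpq'.
have qq' : q = q'.
  by apply: invr_inj; move: pq pq'; rewrite -pp'; lra.
subst p' q'.
have h y : power_section c 1 y <->
    [/\ 0 <= t0, 0 <= t2 & power_section c' (t0 `^ p^-1 * t2 `^ q^-1) (t1 * y)].
  have := iso.2 (vec3 1 y 1).
  rewrite TE (power_memE _ _ _ cpq') (power_memE _ _ _ cpq) !powR1 mulr1 => e.
  split=> [hy|/e[]//]; apply/e; split=> //; exact: ler01.
(* The origin lies in every section, so its image gives the signs of [t0] and [t2]. *)
have [t0p t2p _] : [/\ 0 <= t0, 0 <= t2 & power_section c' (t0 `^ p^-1 * t2 `^ q^-1) (t1 * 0)].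
  apply/h; case: (c) cpq ac => [||? ?|? ? a|? ?] //= _; rewrite ?ler01 ?lexx //.
  by move=> [_ /andP[a0 _]]; rewrite mulr1 oppr_le0 ltW.
set m := _ * _ in h.
have t0_gt0 : 0 < t0 by rewrite lt_neqAle eq_sym t0n.
have t2_gt0 : 0 < t2 by rewrite lt_neqAle eq_sym t2n.
have m0 : 0 < m by rewrite mulr_gt0 // powR_gt0.
(* The point [(1, y, 1)] goes to height [t1 y] over a point whose mean is [m]; normalizing that mean
   to [1] gives the factor [t1 / m]. *)
apply: (section_rigid (k := t1 / m) _ ac ac' cpq cpq').
  by rewrite mulf_neq0 // invr_eq0 gt_eqF.
move=> y; rewrite h; have e := power_sectionZ c' 1 (t1 / m * y) m0.
have E : m * (t1 / m * y) = t1 * y by field; rewrite gt_eqF.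
by rewrite mulr1 E in e; rewrite -e; split=> [[]|].
Qed.

Lemma label_unique T c c' : admissible c -> admissible c' -> cone_iso T c c' ->
  c = c'.
Proof.
move=> ac ac' iso; have iso' := cone_iso_sym iso.
have [sc|[p [q [cpq cn]]]] := label_cases c.
  have [sc'|[p' [q' [cpq' cn']]]] := label_cases c'.
    exact: special_unique sc sc' iso.
  by have := power_not_special ac' cpq' cn' sc iso'.
have [sc'|[p' [q' [cpq' cn']]]] := label_cases c'.
  by have := power_not_special ac cpq cn sc' iso.
exact: power_unique ac ac' cpq cpq' cn iso.
Qed.

End PowerUnique.

Theorem theorem3p2 (R : realType) (K : set 'cV[R]_3) :
  regular_cone K -> (2 <= lie_dim (Aut_cone K))%N ->
  exists! c : cone_label R, admissible c /\ isomorphic_cones K (cone_of c).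
Proof.
move=> rK dK.
have [c ac iso] := classified_isomorphic (classified_existence rK dK).
exists c; split=> // c' [ac' iso'].
have [S uS SK] := iso; have [S' uS' SK'] := iso'.
apply: (label_unique (T := S' *m invmx S)) => //; split.
  by rewrite unitmx_mul uS' unitmx_inv.
move=> v; rewrite -SK -SK'; split=> -[x Kx]; rewrite -mulmxA.
  move/(can_inj (mulKmx uS')) => xE; exists x => //.
  by rewrite xE mulKVmx.
by move=> <-; exists x => //; rewrite mulKmx.
Qed.
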